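(* Let $d\ge1$, $\gamma>1$, $c>0$, $\beta\in\mathbb{R}$ and $\lambda_1,\dots,\lambda_d>0$. Let $X^{(1)},\dots,X^{(d)}$ be independent one-dimensional Lévy processes, $X^{(i)}$ having triplet $(a_i,b_i,\nu_i)$, where $\nu_i$ is supported on $\mathbb{R}_+=[0,\infty)$ and $\nu_i[x,\infty)=c\,x^{\beta}e^{-\lambda_i\log^\gamma x}$ for all sufficiently large $x$. For $n\ge1$ and $t\in[0,1]$ let $$\bar X_n^{(i)}(t)=\frac1n\Big(X^{(i)}(nt)-b_int-nt\int_{[1,\infty)}x\,\nu_i(dx)\Big),\qquad \bar{\boldsymbol X}_n=(\bar X_n^{(1)},\dots,\bar X_n^{(d)}).$$ Then $\{\bar{\boldsymbol X}_n\}_{n\ge1}$ satisfies the extended LDP on $\big(\prod_{i=1}^d\mathbb{D},\sum_{i=1}^dd_{J_1}\big)$ with speed $\log^\gamma n$ and rate function $$I^d(\xi_1,\dots,\xi_d)=\sum_{i=1}^dI^{J_1}_{\lambda_i}(\xi_i),\qquad I^{J_1}_{\lambda}(\xi)=\begin{cases}\lambda\sum_{t\in[0,1]}\mathbf 1\{\xi(t)\ne\xi(t-)\}&\text{if }\xi\in\mathbb{D}_{<\infty},\\ \infty&\text{otherwise.}\end{cases}$$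
   Context: Notation: $\log^\gamma x=(\log x)^\gamma$. Lévy process with triplet $(a,b,\nu)$: $X(t)=bt+aB(t)+\int_{|x|<1}x\big(\hat N([0,t]\times dx)-t\nu(dx)\big)+\int_{|x|\ge1}x\,\hat N([0,t]\times dx)$, where $a,b\in\mathbb{R}$, $B$ is a standard Brownian motion, $\nu$ is a Lévy measure ($\sigma$-finite on $\mathbb{R}\setminus\{0\}$ with $\int\min(1,|x|^2)\nu(dx)<\infty$), and $\hat N$ is an independent Poisson random measure on $[0,\infty)\times(0,\infty)$ with mean measure $\mathrm{Leb}\times\nu$. $\mathbb{D}$ is the space of real-valued càdlàg functions on $[0,1]$, with convention $\xi(0-)=0$. The $J_1$ metric is $d_{J_1}(\xi,\zeta)=\inf_{\lambda\in\Lambda}\max(\|\lambda-e\|,\|\xi\circ\lambda-\zeta\|)$, where $\|\cdot\|$ is the sup norm on $[0,1]$, $\Lambda$ is the set of non-decreasing homeomorphisms of $[0,1]$, and $e$ is the identity map. On $\prod_{i=1}^d\mathbb{D}$ the metric is the sum of the coordinatewise $J_1$ distances. $\mathbb{D}_{<\infty}$ is the set of $\xi\in\mathbb{D}$ that are non-decreasing pure jump functions with finitely many jumps, $\xi(0)=0$ and $\xi(1)=\xi(1-)$; i.e. $\xi=\sum_{i=1}^j z_i\mathbf 1_{[t_i,1]}$ with $j\ge0$, $z_i>0$ and distinct $t_i\in(0,1)$. Extended LDP: for a metric space $(S,d)$ and $A\subseteq S$ let $d(x,A)=\inf_{y\in A}d(x,y)$ and $A^\epsilon=\{x\in S:d(x,A)\le\epsilon\}$.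 Random elements $Y_n$ of $S$ satisfy the extended LDP on $(S,d)$ with rate function $I$ and speed $a_n\to\infty$ if $I:S\to[0,\infty]$ is lower semicontinuous and for every open $G$ and every closed $F$, $-\inf_{x\in G}I(x)\le\liminf_{n\to\infty}\frac{\log P(Y_n\in G)}{a_n}$ and $\limsup_{n\to\infty}\frac{\log P(Y_n\in F)}{a_n}\le-\lim_{\epsilon\downarrow0}\inf_{x\in F^\epsilon}I(x)$ (with $\inf\emptyset=+\infty$, $\log 0=-\infty$). *)

(* Defs.v *)
From HB Require Import structures.
From mathcomp Require Import all_boot all_order all_algebra.
From mathcomp Require Import all_classical all_reals all_analysis.
From mathcomp Require Import measurable_realfun lra.

Set Implicit Arguments.
Unset Strict Implicit.
Unset Printing Implicit Defensive.

Import Order.TTheory GRing.Theory Num.Def Num.Theory.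
Import numFieldNormedType.Exports.

Local Open Scope classical_set_scope.
Local Open Scope ring_scope.

Definition cadlag0y (R : realType) (f : R -> R) : Prop :=
  (forall t : R, 0 <= t -> f x @[x --> t^'+] --> f t) /\
  (forall t : R, 0 < t -> cvg (f x @[x --> t^'-])).

(* The values of [cadlag_path] at negative times are irrelevant. *)
Record cadlag_path (R : realType) := CadlagPath {
  cadlag_fun :> R -> R;
  cadlag_funP : cadlag0y cadlag_fun }.

(* A cadlag function on [0, 1] is encoded by its extension by 0 to the real
   line. Equality is then equality on [0, 1], and the left limit at 0 is 0,
   which is the convention xi(0-) = 0. *)
Definition cadlag01 (R : realType) (f : R -> R) : Prop :=
  [/\ (forall t : R, 0 <= t < 1 -> f x @[x --> t^'+] --> f t),
      (forall t : R, 0 < t <= 1 -> cvg (f x @[x --> t^'-])) &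
      (forall t : R, ~ (0 <= t <= 1) -> f t = 0)].

Record skorokhod (R : realType) := Skorokhod {
  skorokhod_fun :> R -> R;
  skorokhodP : cadlag01 skorokhod_fun }.

HB.instance Definition _ (R : realType) := gen_eqMixin (skorokhod R).
HB.instance Definition _ (R : realType) := gen_choiceMixin (skorokhod R).

Definition sup_norm01 (R : realType) (f : R -> R) : R :=
  sup [set `|f t| | t in `[0, 1]].

Definition homeo01 (R : realType) (l m : R -> R) : Prop :=
  [/\ set_fun `[0, 1] `[0, 1] l /\ set_fun `[0, 1] `[0, 1] m,
      {in `[0, 1], cancel l m}, {in `[0, 1], cancel m l},
      {within `[0, 1], continuous l} & {within `[0, 1], continuous m}].

Definition time_change (R : realType) : set (R -> R) :=
  [set l | {in `[0, 1] &, {homo l : s t / s <= t}} /\ exists m, homeo01 l m].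

Definition dJ1 (R : realType) (x y : skorokhod R) : R :=
  inf [set maxr (sup_norm01 (fun t => l t - t))
                (sup_norm01 (fun t => x (l t) - y t)) | l in @time_change R].

Section dJ1_metric.
Variable R : realType.
Implicit Types (x y z : skorokhod R) (l m f g : R -> R) (s t e M : R).

Lemma skorokhod_inj x y : (x : R -> R) = y -> x = y.
Proof.
case: x y => [f Hf] [g Hg] /= e; subst g; congr Skorokhod.
exact: Prop_irrelevance.
Qed.

Let I01 t : (`[0, 1]%classic : set R) t <-> 0 <= t <= 1.
Proof. by rewrite /= in_itv. Qed.

Let cvg_locally_bounded (F : set_system R) (FF : Filter F) f a :
  f t @[t --> F] --> a -> \forall t \near F, `|f t| <= `|a| + 1.
Proof.
move=> /cvgrPdist_lt /(_ 1 ltr01); apply: filterS => t h1.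
have -> : f t = a - (a - f t) by rewrite opprB addrC subrK.
by apply: (le_trans (ler_normB _ _)); rewrite lerD2l ltW.
Qed.

Lemma skorokhod_bounded x : exists M, forall t, 0 <= t <= 1 -> `|x t| <= M.
Proof.
have [xr xl x0] := skorokhodP x.
suff cov (t : R) : `[0, 1]%classic t ->
    \forall u \near t & M \near +oo, `|x u| <= M.
  have /compact_near_coveringP /(_ R (pinfty_nbhs R) (fun M t => `|x t| <= M)
    (@filter_filter R _ _) cov)[M /= [_ HM]] := @segment_compact R 0 1.
  by exists (M + 1) => t ht; apply: (HM (M + 1)); rewrite /= ?in_itv ?ltrDl.
move=> /I01 /andP[t0 t1].
have [a L] : exists a : R, x u @[u --> t^'-] --> a.
  have [tp|tn] := ltP 0 t; first by apply/cvg_ex; apply: xl; rewrite tp.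
  exists 0; apply/cvgrPdist_lt => e e0; near=> u.
  rewrite x0 ?subrr ?normr0 // => /andP[u0 _].
  have : u < t by near: u; exact: nbhs_left_lt.
  by rewrite ltNge (le_trans tn u0).
have [b H] : exists b : R, x u @[u --> t^'+] --> b.
  have [tp|tn] := ltP t 1; first by exists (x t); apply: xr; rewrite t0.
  exists 0; apply/cvgrPdist_lt => e e0; near=> u.
  rewrite x0 ?subrr ?normr0 // => /andP[_ u1].
  have : t < u by near: u; exact: nbhs_right_gt.
  by rewrite ltNge (le_trans u1 tn).
have {}L := cvg_locally_bounded _ L.
have {}H := cvg_locally_bounded _ H.
pose M := maxr `|x t| (maxr (`|a| + 1) (`|b| + 1)).
exists ([set u | `|x u| <= M], [set K | M < K]) => /=.
  split; last by exists M; rewrite num_real.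
  near=> u => /=; rewrite /M !le_max.
  have [ut|tu|->] := ltgtP u t; last by rewrite lexx.
    suff -> : `|x u| <= `|a| + 1 by rewrite orbT.
    by move: ut; near: u; exact: L.
  suff -> : `|x u| <= `|b| + 1 by rewrite !orbT.
  by move: tu; near: u; exact: H.
by move=> [u K] /= [uM MK]; exact: (le_trans uM (ltW MK)).
Unshelve. all: by end_near. Qed.

Let bounded01 f := exists M, forall t, 0 <= t <= 1 -> `|f t| <= M.

Let sup_norm_ub f t : bounded01 f -> 0 <= t <= 1 -> `|f t| <= sup_norm01 f.
Proof.
move=> [M HM] t01; apply: sup_upper_bound; last by exists t => //=; rewrite in_itv.
split; first by exists `|f t|, t => //=; rewrite in_itv.
by exists M => _ /= [u /I01 hu <-]; exact: HM.
Qed.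

Let sup_norm_le f M : (forall t, 0 <= t <= 1 -> `|f t| <= M) ->
  sup_norm01 f <= M.
Proof.
move=> HM; apply: ge_sup.
  by exists `|f 0|, 0 => //=; rewrite in_itv /= lexx ler01.
by move=> _ /= [u /I01 hu <-]; exact: HM.
Qed.

Let sup_norm_ge0 f : bounded01 f -> 0 <= sup_norm01 f.
Proof.
by move=> bf; apply: (le_trans _ (sup_norm_ub (t := 0) bf _));
  rewrite ?normr_ge0 ?lexx ?ler01.
Qed.

Let bounded01B f g : bounded01 f -> bounded01 g ->
  bounded01 (fun t => f t - g t).
Proof.
move=> [M HM] [N HN]; exists (M + N) => t ht.
by apply: (le_trans (ler_normB _ _)); rewrite lerD ?HM ?HN.
Qed.

Let homeo_sym l m : homeo01 l m -> homeo01 m l.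
Proof. by move=> [[h1 h2] h3 h4 h5 h6]. Qed.

Let homeo_map l m t : homeo01 l m -> 0 <= t <= 1 -> 0 <= l t <= 1.
Proof. by move=> [[h1 _] _ _ _ _] /I01 /h1 /I01. Qed.

Let homeoK l m t : homeo01 l m -> 0 <= t <= 1 -> m (l t) = t.
Proof. by move=> [_ h _ _ _] t01; apply: h; rewrite in_itv. Qed.

Let time_change_map l t : time_change l -> 0 <= t <= 1 -> 0 <= l t <= 1.
Proof. by move=> [_ [m lm]]; exact: homeo_map lm. Qed.

Let within_comp f g : set_fun `[0, 1] `[0, 1] g ->
  {within `[0, 1], continuous f} -> {within `[0, 1], continuous g} ->
  {within `[0, 1], continuous (f \o g)}.
Proof.
move=> gI /subspace_continuousP fc /subspace_continuousP gc.
apply/subspace_continuousP => t tI.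
apply: (@cvg_comp _ _ _ g f _ (within `[0, 1] (nbhs (g t)))); last first.
  by apply: fc; exact: gI.
move=> A Ag; have := gc t tI _ Ag; apply: (@filterS _ (nbhs t)) => u H uI.
by apply: H => //; exact: gI.
Qed.

Let time_change_comp l1 l2 : time_change l1 -> time_change l2 ->
  time_change (l1 \o l2).
Proof.
move=> [i1 [m1 h1]] [i2 [m2 h2]]; split.
  move=> s t sI tI st /=; apply: i1; last exact: i2.
    by move: sI; rewrite !in_itv /= => /(homeo_map h2).
  by move: tI; rewrite !in_itv /= => /(homeo_map h2).
exists (m2 \o m1); have [[a1 b1] c1 d1 e1 f1] := h1.
have [[a2 b2] c2 d2 e2 f2] := h2; split.
- by split=> t tI /=; [apply: a1; apply: a2|apply: b2; apply: b1].
- move=> t; rewrite in_itv /= => tI.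
  by rewrite (homeoK h1) ?(homeoK h2) ?(homeo_map h2).
- move=> t; rewrite in_itv /= => tI; have h1' := homeo_sym h1.
  by rewrite (homeoK (homeo_sym h2)) ?(homeoK h1') ?(homeo_map h1').
- exact: within_comp.
- exact: within_comp.
Qed.

Let time_change_inv l m : time_change l -> homeo01 l m -> time_change m.
Proof.
move=> [il _] lm; split; last by exists l; exact: homeo_sym.
move=> s t; rewrite !in_itv /= => sI tI st; rewrite leNgt; apply/negP => ts.
have ml := homeo_sym lm.
have : l (m t) <= l (m s).
  by apply: il; rewrite ?in_itv /= ?(homeo_map ml) // ltW.
rewrite !(homeoK ml) // => ts'.
by move: ts; rewrite (@le_anti _ _ s t) ?ltxx // st ts'.
Qed.

Let time_change_id : time_change (@id R).
Proof.
have idc : {within `[0, 1], continuous (@id R)}.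
  by apply: continuous_subspaceT => t; exact.
by split=> //; exists id; split=> //; split=> ?.
Qed.

Let time_change1 l : time_change l -> l 1 = 1.
Proof.
move=> [il [m lm]]; have ml := homeo_sym lm.
have I1 : 0 <= (1 : R) <= 1 by rewrite ler01 lexx.
apply/le_anti; have /andP[_ -> /=] := homeo_map lm I1.
rewrite -{1}(homeoK ml I1); apply: il; rewrite ?in_itv //=; first exact: homeo_map ml _.
by have /andP[] := homeo_map ml I1.
Qed.

Let cost l x y := maxr (sup_norm01 (fun t => l t - t))
                       (sup_norm01 (fun t => x (l t) - y t)).

Let bounded_time l : time_change l -> bounded01 (fun t => l t - t).
Proof.
move=> tl; apply: bounded01B; exists 1 => t tI; rewrite ger0_norm.
- by have /andP[] := time_change_map tl tI.
- by have /andP[] := time_change_map tl tI.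
- by case/andP: tI.
- by case/andP: tI.
Qed.

Let bounded_path l x y : time_change l -> bounded01 (fun t => x (l t) - y t).
Proof.
move=> tl; apply: bounded01B (skorokhod_bounded y).
by have [M HM] := skorokhod_bounded x; exists M => t tI;
  apply: HM; exact: time_change_map.
Qed.

Let cost_time l x y t : time_change l -> 0 <= t <= 1 ->
  `|l t - t| <= cost l x y.
Proof.
move=> tl tI; rewrite /cost le_max.
by rewrite (sup_norm_ub (f := fun t => l t - t)) //; exact: bounded_time.
Qed.

Let cost_path l x y t : time_change l -> 0 <= t <= 1 ->
  `|x (l t) - y t| <= cost l x y.
Proof.
move=> tl tI; rewrite /cost le_max orbC.
by rewrite (sup_norm_ub (f := fun t => x (l t) - y t)) //; exact: bounded_path.
Qed.

Let cost_ge0 l x y : time_change l -> 0 <= cost l x y.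
Proof.
by move=> tl; rewrite /cost le_max (sup_norm_ge0 (bounded_time tl)).
Qed.

Let cost_le l x y M : (forall t, 0 <= t <= 1 -> `|l t - t| <= M) ->
  (forall t, 0 <= t <= 1 -> `|x (l t) - y t| <= M) -> cost l x y <= M.
Proof. by move=> h1 h2; rewrite /cost ge_max !sup_norm_le. Qed.

Let dJ1_has_inf x y : has_inf [set cost l x y | l in @time_change R].
Proof.
split; first by exists (cost id x y), id.
by exists 0 => _ /= [l tl <-]; exact: cost_ge0.
Qed.

Let dJ1_le l x y : time_change l -> dJ1 x y <= cost l x y.
Proof.
by move=> tl; apply: ge_inf; [case: (dJ1_has_inf x y)|exists l].
Qed.

Let dJ1_lt x y e : dJ1 x y < e -> exists2 l, time_change l & cost l x y < e.
Proof.
move=> /inf_lt -/(_ (dJ1_has_inf x y).1) [_ /= [l tl <-] h].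
by exists l.
Qed.

Lemma dJ1_ge0 x y : 0 <= dJ1 x y.
Proof.
apply: lb_le_inf; first by case: (dJ1_has_inf x y).
by move=> _ /= [l tl <-]; exact: cost_ge0.
Qed.

Lemma dJ1xx x : dJ1 x x = 0.
Proof.
apply/le_anti; rewrite dJ1_ge0 andbT.
apply: (le_trans (dJ1_le x x time_change_id)).
by apply: cost_le => t _; rewrite subrr normr0.
Qed.

Let dJ1_sym_le x y : dJ1 x y <= dJ1 y x.
Proof.
apply/ler_addgt0Pl => e e0.
have /dJ1_lt [l tl] : dJ1 y x < e + dJ1 y x by rewrite ltrDr.
have [_ [m lm]] := tl; move=> /ltW; apply: le_trans.
have ml := homeo_sym lm; have tm := time_change_inv tl lm.
apply: (le_trans (dJ1_le x y tm)); apply: cost_le => t tI.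
  rewrite distrC -{1}(homeoK ml tI); apply: cost_time => //.
  exact: time_change_map.
rewrite distrC -{1}(homeoK ml tI); apply: cost_path => //.
exact: time_change_map.
Qed.

Lemma dJ1_sym x y : dJ1 x y = dJ1 y x.
Proof. by apply/le_anti; rewrite !dJ1_sym_le. Qed.

Lemma dJ1_triangle y x z : dJ1 x z <= dJ1 x y + dJ1 y z.
Proof.
apply/ler_addgt0Pl => e e0.
have e20 : 0 < e / 2 by rewrite divr_gt0.
have /dJ1_lt [l1 t1 /ltW c1] : dJ1 x y < e / 2 + dJ1 x y by rewrite ltrDr.
have /dJ1_lt [l2 t2 /ltW c2] : dJ1 y z < e / 2 + dJ1 y z by rewrite ltrDr.
have -> : e + (dJ1 x y + dJ1 y z) = (e / 2 + dJ1 x y) + (e / 2 + dJ1 y z).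
  by rewrite addrACA -splitr.
apply: (le_trans _ (lerD c1 c2)).
apply: (le_trans (dJ1_le x z (time_change_comp t1 t2))).
apply: cost_le => t tI /=.
  rewrite -(subrKA (l2 t)); apply: (le_trans (ler_normD _ _)).
  by apply: lerD; apply: cost_time => //; exact: time_change_map.
rewrite -(subrKA (y (l2 t))); apply: (le_trans (ler_normD _ _)).
by apply: lerD; apply: cost_path => //; exact: time_change_map.
Qed.

Lemma dJ1_eq0 x y : dJ1 x y = 0 -> x = y.
Proof.
move=> xy0; apply: skorokhod_inj; apply/funext => t.
have [xr _ x0] := skorokhodP x; have [yr _ y0] := skorokhodP y.
have [tI|tI] := pselect (0 <= t <= 1); last by rewrite x0 // y0.
have near0 e : 0 < e -> exists2 l, time_change l & cost l x y < e.
  by move=> e0; apply: dJ1_lt; rewrite xy0.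
suff H e : 0 < e -> `|x t - y t| <= e + e + e.
  apply/eqP; rewrite -subr_eq0 -normr_le0; apply/ler_addgt0Pl => e e0.
  have /H : 0 < e / 3 by rewrite divr_gt0.
  lra.
move=> e0; have [->|t1] := eqVneq t 1.
  have [l tl /ltW cl] := near0 _ e0.
  rewrite -{1}(time_change1 tl); apply: le_trans (cost_path x y tl _) _.
    by rewrite ler01 lexx.
  by apply: (le_trans cl); rewrite -addrA lerDl addr_ge0 ?ltW.
have /andP[t0 t1'] := tI.
have tlt1 : t < 1 by rewrite lt_neqAle t1.
have tJ : 0 <= t < 1 by rewrite t0.
have : \forall u \near t^'+, `|x t - x u| < e /\ `|y t - y u| < e.
  near=> u; split; near: u.
    by have /cvgrPdist_lt := xr t tJ; exact.
  by have /cvgrPdist_lt := yr t tJ; exact.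
move=> [del /= del0 Hdel].
pose h := minr (del / 2) ((1 - t) / 2).
have h0 : 0 < h by rewrite lt_min !divr_gt0 ?subr_gt0.
have hdel : h + h <= del.
  by rewrite [leRHS]splitr lerD // ge_min lexx.
have ht1 : t + h <= 1.
  rewrite -lerBrDl (@le_trans _ _ ((1 - t) / 2)) ?ge_min ?lexx ?orbT //.
  by rewrite ler_pdivrMr // ler_peMr ?ler1n // subr_ge0.
have sI : 0 <= t + h <= 1 by rewrite ht1 andbT addr_ge0 // ltW.
have hin u : t < u -> u < t + h + h -> `|x t - x u| < e /\ `|y t - y u| < e.
  move=> tu uh; apply: Hdel => //=.
  rewrite distrC ger0_norm ?subr_ge0 ?ltW // ltrBlDl.
  by apply: (lt_le_trans uh); rewrite -addrA lerD2l.
have eh0 : 0 < minr e h by rewrite lt_min e0.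
have [l tl] := near0 _ eh0.
rewrite lt_min => /andP[/ltW ce ch].
have := le_lt_trans (cost_time x y tl sI) ch.
rewrite ltr_distl addrK => /andP[la lb].
have [xl _] := hin _ la lb.
have [_ ys] : `|x t - x (t + h)| < e /\ `|y t - y (t + h)| < e.
  by apply: hin; rewrite ltrDl.
have mid := le_trans (cost_path x y tl sI) ce.
rewrite -(subrKA (x (l (t + h)))) -[X in _ + X](subrKA (y (t + h))) addrA.
apply: (le_trans (ler_normD _ _)); apply: lerD; last by rewrite distrC ltW.
by apply: (le_trans (ler_normD _ _)); rewrite lerD // ltW.
Unshelve. all: by end_near. Qed.

End dJ1_metric.

HB.instance Definition _ (R : realType) := @isMetric.Build R (skorokhod R)
  (@dJ1 R) (@dJ1xx R) (@dJ1_eq0 R) (@dJ1_sym R) (@dJ1_triangle R).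

(* An alias, so that the product topology on functions is not inferred. *)
Definition skorokhod_prod (R : realType) (d : nat) := 'I_d -> skorokhod R.

HB.instance Definition _ (R : realType) (d : nat) :=
  gen_eqMixin (skorokhod_prod R d).
HB.instance Definition _ (R : realType) (d : nat) :=
  gen_choiceMixin (skorokhod_prod R d).

Definition dprod (R : realType) (d : nat) (x y : skorokhod_prod R d) : R :=
  \sum_(i < d) mdist (x i) (y i).

Section dprod_metric.
Variables (R : realType) (d : nat).
Implicit Types x y z : skorokhod_prod R d.

Lemma dprodxx x : dprod x x = 0.
Proof. by rewrite /dprod big1 // => i _; exact: dJ1xx. Qed.

Lemma dprod_eq0 x y : dprod x y = 0 -> x = y.
Proof.
move=> xy0; apply/funext => i; apply: dJ1_eq0.
by apply: (psumr_eq0P _ xy0) => // j _; exact: dJ1_ge0.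
Qed.

Lemma dprod_sym x y : dprod x y = dprod y x.
Proof. by apply: eq_bigr => i _; exact: dJ1_sym. Qed.

Lemma dprod_triangle y x z : dprod x z <= dprod x y + dprod y z.
Proof.
by rewrite /dprod -big_split /=; apply: ler_sum => i _; exact: dJ1_triangle.
Qed.

End dprod_metric.

HB.instance Definition _ (R : realType) (d : nat) :=
  @isMetric.Build R (skorokhod_prod R d) (@dprod R d)
    (@dprodxx R d) (@dprod_eq0 R d) (@dprod_sym R d) (@dprod_triangle R d).

(* The infimum is taken in [\bar R], so that the enlargement of [set0] is
   [set0]. *)
Definition enlargement (R : realType) (S : metricType R) (A : set S) (e : R) :
  set S :=
  [set x | (ereal_inf [set (mdist x y)%:E | y in A] <= e%:E)%E].

Section extended_LDP.
Context d (T : measurableType d) (R : realType) (P : probability T R).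
Variable S : metricType R.
Local Open Scope ereal_scope.

(* Borel measurability, tested on the generating open sets *)
Definition random_element (Y : T -> S) : Prop :=
  forall G : set S, open G -> measurable (Y @^-1` G).

Definition rate_function (I : S -> \bar R) : Prop :=
  (forall x, 0 <= I x) /\ lower_semicontinuous I.

Definition extended_LDP (Y : nat -> T -> S) (I : S -> \bar R) (a : nat -> R)
    : Prop :=
  [/\ (forall n, random_element (Y n)) /\ a n @[n --> \oo] --> +oo%R,
      rate_function I,
      (forall G : set S, open G ->
        - ereal_inf (I @` G) <=
        limn_einf (fun n => lne (P (Y n @^-1` G)) / (a n)%:E)) &
      (forall F : set S, closed F ->
        limn_esup (fun n => lne (P (Y n @^-1` F)) / (a n)%:E) <=
        - lim (ereal_inf (I @` enlargement F e) @[e --> 0%R^'+]))].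

End extended_LDP.

Section independence.
Context d (T : measurableType d) (R : realType) (P : probability T R).
Local Open Scope ereal_scope.

Definition generated_sigma d' (U : measurableType d') (K : Type) (D : set K)
    (Z : K -> T -> U) : set (set T) :=
  <<s \bigcup_(k in D) g_sigma_algebra_preimage (Z k) >>.

Definition independent (F G : set (set T)) : Prop :=
  forall A B, F A -> G B -> P (A `&` B) = P A * P B.

Definition mutually_independent (I : finType) (F : I -> set (set T)) : Prop :=
  forall (J : {set I}) (A : I -> set T), (forall i, i \in J -> F i (A i)) ->
    P (\bigcap_(i in [set` J]) A i) = \prod_(i in J) P (A i).

End independence.

Section levy.
Context d (T : measurableType d) (R : realType) (P : probability T R).

Definition standard_brownian_motion (B : R -> T -> R) : Prop :=
  [/\ (forall t : R, 0 <= t -> measurable_fun setT (B t)) /\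
      {ae P, forall w, B 0 w = 0},
      (forall s t : R, 0 <= s < t -> forall A, measurable A ->
        P [set w | A (B t w - B s w)] = normal_prob 0 (Num.sqrt (t - s)) A),
      (forall s t : R, 0 <= s < t -> independent P (generated_sigma `[0, s] B)
        (g_sigma_algebra_preimage (fun w => B t w - B s w))) &
      {ae P, forall w, {within `[0, +oo[, continuous (B ^~ w)}}].

(* The second argument of [poisson_prob] is unused; [poisson_prob 0] is the
   Dirac mass at 0. *)
Definition poisson_random_measure d' (U : measurableType d')
    (m : set U -> \bar R) (N : R.-ker T ~> U) : Prop :=
  [/\ (forall A, measurable A -> (m A < +oo)%E -> forall k : nat,
        P [set w | N w A = (k%:R)%:E] = poisson_prob (fine (m A)) 0 [set k]),
      (forall A, measurable A -> m A = +oo%E ->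
        P [set w | N w A = +oo%E] = 1%E) &
      (forall (k : nat) (A : 'I_k -> set U),
        (forall i, measurable (A i)) -> trivIset setT A ->
        mutually_independent P
          (fun i => g_sigma_algebra_preimage (N ^~ (A i))))].

(* A Levy measure on the punctured line is identified with a measure on the
   line that does not charge 0. *)
Definition levy_measure (nu : {sigma_finite_measure set R -> \bar R}) : Prop :=
  nu [set 0] = 0%E /\
  (\int[nu]_x (minr 1 (`|x| ^+ 2))%:E < +oo)%E.

Definition time_space_intensity (nu : {sigma_finite_measure set R -> \bar R}) :
    set (R * R) -> \bar R :=
  (mrestr lebesgue_measure (measurable_itv `[0%R, +oo[%R) \x nu)%E.

Definition compensated_jumps (nu : {sigma_finite_measure set R -> \bar R})
    (N : R.-ker T ~> (R * R)%type) (t e : R) (w : T) : R :=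
  \int[N w]_(z in `[0, t] `*` [set x | e <= `|x| < 1]) z.2 -
  t * \int[nu]_(x in [set x | e <= `|x| < 1]) x.

(* [M] is the integral of x over {|x| < 1} against the compensated measure
   N([0, t] x dx) - t nu(dx). It only exists in general as the L^2 limit, as
   e decreases to 0, of the integrals over {e <= |x| < 1}. *)
Definition compensated_integral (nu : {sigma_finite_measure set R -> \bar R})
    (N : R.-ker T ~> (R * R)%type) (t : R) (M : T -> R) : Prop :=
  measurable_fun setT M /\
  (\int[P]_w ((M w - compensated_jumps nu N t e w) ^+ 2)%:E)%E
    @[e --> 0^'+] --> 0%E.

(* Levy process with triplet (a, b, nu), through its Levy-Ito decomposition *)
Definition levy_process (a b : R) (nu : {sigma_finite_measure set R -> \bar R})
    (X : T -> cadlag_path R) : Prop :=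
  [/\ levy_measure nu,
      (forall t : R, 0 <= t -> measurable_fun setT (fun w => X w t)) &
      exists (B : R -> T -> R) (N : R.-ker T ~> (R * R)%type),
      [/\ standard_brownian_motion B,
          poisson_random_measure (time_space_intensity nu) N,
          independent P (generated_sigma `[0, +oo[ B)
            (generated_sigma measurable (fun A w => N w A)) &
          forall t : R, 0 <= t -> exists2 M : T -> R,
            compensated_integral nu N t M &
            {ae P, forall w, X w t = b * t + a * B t w + M w +
              \int[N w]_(z in `[0, t] `*` [set x | 1 <= `|x|]) z.2}]].

End levy.

Section scaled.
Variable R : realType.

Definition scaled_fun (b : R) (nu : {sigma_finite_measure set R -> \bar R})
    (n : nat) (x : cadlag_path R) (t : R) : R :=
  if 0 <= t <= 1 then
    n%:R^-1 * (x (n%:R * t) - b * n%:R * t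
               - n%:R * t * \int[nu]_(y in `[1, +oo[) y)
  else 0.

Let cvg_mull_right (r t : R) : 0 < r ->
  r * u @[u --> t^'+] --> (r * t)^'+.
Proof.
move=> r0 A Ar; have rc : r * u @[u --> t] --> r * t.
  by apply: cvgMl_tmp; exact: cvg_id.
by have := rc _ Ar; apply: (@filterS _ (nbhs t)) => u H tu; apply: H;
  rewrite ltr_pM2l.
Qed.

Let cvg_mull_left (r t : R) : 0 < r ->
  r * u @[u --> t^'-] --> (r * t)^'-.
Proof.
move=> r0 A Ar; have rc : r * u @[u --> t] --> r * t.
  by apply: cvgMl_tmp; exact: cvg_id.
by have := rc _ Ar; apply: (@filterS _ (nbhs t)) => u H tu; apply: H;
  rewrite ltr_pM2l.
Qed.

Lemma scaled_fun_cadlag b nu n (x : cadlag_path R) :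
  cadlag01 (scaled_fun b nu n x).
Proof.
have [xr xl] := cadlag_funP x.
have [->|n0] := eqVneq n 0%N.
  have -> : scaled_fun b nu 0 x = cst 0.
    by apply/funext => t; rewrite /scaled_fun invr0 mul0r if_same.
  split=> // t _; first exact: cvg_cst.
  by apply/cvg_ex; exists 0; exact: cvg_cst.
have r0 : 0 < n%:R :> R by rewrite ltr0n lt0n.
set k := \int[nu]_(y in `[1, +oo[) y.
pose g (t : R) := n%:R^-1 * (x (n%:R * t) - b * n%:R * t - n%:R * t * k).
have gE (t : R) : 0 <= t <= 1 -> scaled_fun b nu n x t = g t.
  by rewrite /scaled_fun => ->.
have gcvg (F : set_system R) (FF : Filter F) (t a : R) : F --> t ->
    x (n%:R * u) @[u --> F] --> a ->
    g u @[u --> F] --> n%:R^-1 * (a - b * n%:R * t - n%:R * t * k).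
  move=> Ft xa; apply: cvgMl_tmp; apply: cvgB.
    by apply: cvgB => //; exact: cvgMl_tmp.
  by apply: cvgMr_tmp; exact: cvgMl_tmp.
split.
- move=> t /andP[t0 t1]; have t01 : 0 <= t <= 1 by rewrite t0 ltW.
  rewrite gE //; apply: (@cvg_trans _ (g u @[u --> t^'+])).
    apply: near_eq_cvg; near=> u; rewrite gE //; apply/andP; split.
      by apply: (le_trans t0); apply: ltW; near: u; exact: nbhs_right_gt.
    by near: u; exact: nbhs_right_le.
  apply: gcvg; first by apply: cvg_at_right_filter; exact: cvg_id.
  apply: (@cvg_comp _ _ _ _ x _ _ _ (cvg_mull_right r0)); apply: xr.
  by rewrite mulr_ge0 // ltW.
- move=> t /andP[t0 t1].
  have /cvg_ex [/= a ha] : cvg (x u @[u --> (n%:R * t)^'-]).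
    by apply: xl; rewrite mulr_gt0.
  apply/cvg_ex; exists (n%:R^-1 * (a - b * n%:R * t - n%:R * t * k)).
  apply: (@cvg_trans _ (g u @[u --> t^'-])).
    apply: near_eq_cvg; near=> u; rewrite gE //; apply/andP; split.
      by near: u; exact: nbhs_left_ge.
    by apply: (le_trans _ t1); apply: ltW; near: u; exact: nbhs_left_lt.
  apply: gcvg; first by apply: cvg_at_left_filter; exact: cvg_id.
  exact: (@cvg_comp _ _ _ _ x _ _ _ (cvg_mull_left r0) ha).
- by move=> t /negP/negbTE; rewrite /scaled_fun => ->.
Unshelve. all: by end_near. Qed.

Definition scaled_path b nu n x : skorokhod R :=
  Skorokhod (scaled_fun_cadlag b nu n x).

End scaled.

Definition left_limit (R : realType) (xi : R -> R) (t : R) : R :=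
  lim (xi u @[u --> t^'-]).

Definition D_lt_infty (R : realType) : set (skorokhod R) :=
  [set xi | exists (j : nat) (z t : 'I_j -> R),
    [/\ forall i, 0 < z i, forall i, 0 < t i < 1, injective t &
        forall s : R, 0 <= s <= 1 ->
          xi s = \sum_(i < j) z i * \1_(`[t i, 1]) s]].

Definition I_J1 (R : realType) (lambda : R) (xi : skorokhod R) : \bar R :=
  if xi \in @D_lt_infty R then
    (lambda%:E * \esum_(t in `[0%R, 1%R]) (xi t != left_limit xi t)%:R%:E)%E
  else +oo%E.

Definition I_prod (R : realType) (d : nat) (lambda : 'I_d -> R)
    (xi : skorokhod_prod R d) : \bar R :=
  (\sum_(i < d) I_J1 (lambda i) (xi i))%E.

(* Main.v *)
Require Import Defs.
From HB Require Import structures.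
From mathcomp Require Import all_boot all_order all_algebra.
From mathcomp Require Import all_classical all_reals all_analysis.
From mathcomp Require Import measurable_realfun lra.

Set Implicit Arguments.
Unset Strict Implicit.
Unset Printing Implicit Defensive.

Import Order.TTheory GRing.Theory Num.Def Num.Theory.
Import numFieldNormedType.Exports.

Local Open Scope classical_set_scope.
Local Open Scope ring_scope.

(** At the speed [v_n = (ln n) ^ gamma] only the number of macroscopic jumps of the scaled
path is visible. During [0, n] a jump of size at least [n * y] has probability of order
[n * nu [n * y, +oo[], and since [ln (n * y) ^ gamma] is equivalent to [v_n] for every
[y > 0], this is [exp (- (lambda + o(1)) v_n)] whatever [y] is: [k] macroscopic jumps cost
[k * lambda], their sizes and times cost nothing, and anything that needs no macroscopic
jump is free. Three things turn this heuristic into a proof.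

Reduction to one coordinate ([extended_LDP_of_coordinates]). Let [steps k] be the set of
nondecreasing step paths with at most [k] jumps; these are the sublevel sets of the rate of
one coordinate. It is enough that the probability of being [e]-far from [steps k] is at most
[exp (- (lambda (k + 1) - eta) v_n)], and that an [e]-ball around a path with [j] jumps has
probability at least [exp (- (lambda j + eta) v_n)]; independence multiplies these bounds.
Sublevel sets are not compact, hence the extended form of the upper bound: for a closed set
the event is covered by the finitely many events that coordinate [i] is [e]-far from
[steps (k i - 1)], and minimality of the [k i] yields a point of the [e]-enlargement whose
rate is at most [\sum_i lambda i * k i]. Lower semicontinuity follows from [steps_closed].

Approximation by large jumps ([coordinate_bad_event]). For every [K] and [eps] there is
[delta] such that, outside an event of probability [exp (- K v_n)], the scaled path stays
within [eps] of the sum of its jumps larger than [delta]. The remainder consists of a Brownian part,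
whose deviations cost far more, and of compensated jumps below [c = n * delta]. Chernoff's
bound with tilting [s = theta v_n / n] gives for a deviation of order [n * eps]
  [exp (- s n eps + 2 s^2 n V + exp (s c) n nu [1 / (2 s), +oo[)],
where [V] is the second moment of [nu]: jumps below [1 / (2 s)] are controlled by the
quadratic bound on [expR], the others by their number. The middle term vanishes; as
[1 / (2 s)] exceeds [sqrt n], the last one is at most
[exp ((theta delta - lambda / 2 ^ gamma + o(1)) v_n)] and vanishes too when [delta] is small.
So the deviation costs [theta eps v_n] with [theta] as large as desired. Ottaviani's inequality
makes the bound uniform over a finite grid of times; dyadic grids and right-continuity give
all times.

Counting. With at most [k] large jumps, which fails with probability at most the [k + 1]st
power of the mean number of large jumps ([poisson_tail]), the path of large jumps belongs to
[steps k]; this is [coordinate_upper_bound]. Conversely, prescribing exactly one point of the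
Poisson measure in each of [j] small boxes of times and sizes, and no other large jump, puts
the path in a ball around any given step path, and the boxes are independent
([box_event_probability]); this is [coordinate_lower_bound], in which the gap
[(l + b) ^ gamma - (l + a) ^ gamma], unbounded because [gamma > 1], makes a box
as likely as the whole half-line above it up to a constant factor.

Integrals against the Poisson measure are only used through its counts: they are compared to
Riemann sums over finitely many cells, and all probabilistic estimates are made on counts. *)

(** * The J1 distance and time changes *)

Section skorokhod_basics.
Variable R : realType.
Implicit Types (x y z : skorokhod R) (l m f g : R -> R) (s t e M : R).

Lemma sup_norm01_le f M : (forall t, 0 <= t <= 1 -> `|f t| <= M) ->
  sup_norm01 f <= M.
Proof.
move=> HM; apply: ge_sup.
  by exists `|f 0|, 0 => //=; rewrite in_itv /= lexx ler01.
by move=> _ /= [u hu <-]; apply: HM; move: hu; rewrite in_itv.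
Qed.

Lemma sup_norm01_ub f M t : (forall t, 0 <= t <= 1 -> `|f t| <= M) ->
  0 <= t <= 1 -> `|f t| <= sup_norm01 f.
Proof.
move=> HM t01; apply: sup_upper_bound; last by exists t => //=; rewrite in_itv.
split; first by exists `|f t|, t => //=; rewrite in_itv.
by exists M => _ /= [u hu <-]; apply: HM; move: hu; rewrite in_itv.
Qed.

Lemma sup_norm01_ge0 f : 0 <= sup_norm01 f.
Proof.
have [hs|hs] := pselect (has_sup [set `|f t| | t in `[0, 1]]); last first.
  by rewrite /sup_norm01 sup_out.
apply: (le_trans (normr_ge0 (f 0))); apply: sup_upper_bound => //.
by exists 0 => //=; rewrite in_itv /= lexx ler01.
Qed.

Lemma time_change_itv l t : time_change l -> 0 <= t <= 1 -> 0 <= l t <= 1.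
Proof.
move=> [_ [m [[h1 _] _ _ _ _]]] tI.
by have := h1 t; rewrite /= !in_itv /=; apply.
Qed.

Lemma dJ1_le_time_change l x y M : time_change l ->
  (forall t, 0 <= t <= 1 -> `|l t - t| <= M) ->
  (forall t, 0 <= t <= 1 -> `|x (l t) - y t| <= M) -> dJ1 x y <= M.
Proof.
move=> tl h1 h2; apply: (@le_trans _ _ (maxr (sup_norm01 (fun t => l t - t))
  (sup_norm01 (fun t => x (l t) - y t)))); last first.
  by rewrite ge_max !sup_norm01_le.
apply: ge_inf; last by exists l.
by exists 0 => _ /= [k _ <-]; rewrite le_max sup_norm01_ge0.
Qed.

Lemma time_change_id : time_change (@id R).
Proof.
have idc : {within `[0, 1], continuous (@id R)}.
  by apply: continuous_subspaceT => t; exact.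
by split=> //; exists id; split=> //; split=> ?.
Qed.

Lemma dJ1_le_unif x y M : (forall t, 0 <= t <= 1 -> `|x t - y t| <= M) ->
  dJ1 x y <= M.
Proof.
move=> h; apply: (dJ1_le_time_change time_change_id) => // t tI.
by rewrite subrr normr0 (le_trans _ (h 0 _)) // lexx ler01.
Qed.

Lemma dJ1_lt_time_change x y e : dJ1 x y < e -> exists2 l, time_change l &
  forall t, 0 <= t <= 1 -> `|l t - t| < e /\ `|x (l t) - y t| < e.
Proof.
move=> /inf_lt; case.
  by exists (maxr (sup_norm01 (fun t => id t - t))
    (sup_norm01 (fun t => x (id t) - y t))), id => //; exact: time_change_id.
move=> _ /= [l tl <-]; rewrite gt_max => /andP[h1 h2]; exists l => // t tI.
split.
  apply: le_lt_trans h1.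
  apply: (@sup_norm01_ub (fun t => l t - t) 2) => // u uI.
  have /andP[a b] := time_change_itv tl uI; case/andP: uI => c d.
  rewrite ler_norml; lra.
have [Mx Hx] := skorokhod_bounded x; have [My Hy] := skorokhod_bounded y.
apply: le_lt_trans h2.
apply: (@sup_norm01_ub (fun t => x (l t) - y t) (Mx + My)) => // u uI.
apply: (le_trans (ler_normB _ _)); apply: lerD; last exact: Hy.
by apply: Hx; exact: time_change_itv.
Qed.

Lemma time_change_homo l s t : time_change l -> 0 <= s <= 1 -> 0 <= t <= 1 ->
  s <= t -> l s <= l t.
Proof. by move=> [h _] sI tI; apply: h; rewrite in_itv. Qed.

Lemma time_change_inj l s t : time_change l -> 0 <= s <= 1 -> 0 <= t <= 1 ->
  l s = l t -> s = t.
Proof.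
move=> [_ [m [_ h _ _ _]]] sI tI e.
by rewrite -(h s) ?in_itv // e h ?in_itv.
Qed.

Lemma time_change_mono l s t : time_change l -> 0 <= s <= 1 -> 0 <= t <= 1 ->
  s < t -> l s < l t.
Proof.
move=> tl sI tI st; rewrite lt_neqAle (time_change_homo tl sI tI (ltW st)).
rewrite andbT; apply/eqP => /(time_change_inj tl sI tI) e.
by rewrite e ltxx in st.
Qed.

Lemma time_change_surj l t : time_change l -> 0 <= t <= 1 ->
  exists2 s, 0 <= s <= 1 & l s = t.
Proof.
move=> [_ [m [[_ h1] _ h _ _]]] tI; exists (m t).
  by have := h1 t; rewrite /= !in_itv; apply.
by rewrite h ?in_itv.
Qed.

Lemma time_change0 l : time_change l -> l 0 = 0.
Proof.
move=> tl; have I0 : 0 <= (0 : R) <= 1 by rewrite lexx ler01.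
have [s sI e] := time_change_surj tl I0.
apply/le_anti; have /andP[-> _] := time_change_itv tl I0.
by rewrite andbT -[leRHS]e; apply: time_change_homo => //; case/andP: sI.
Qed.

Lemma time_change1 l : time_change l -> l 1 = 1.
Proof.
move=> tl; have I1 : 0 <= (1 : R) <= 1 by rewrite lexx ler01.
have [s sI e] := time_change_surj tl I1.
apply/le_anti; have /andP[_ ->] := time_change_itv tl I1.
by rewrite -[leLHS]e; apply: time_change_homo => //; case/andP: sI.
Qed.

(** A perturbation of the identity that is contracting with ratio 1/2 cannot break
    monotonicity; this spares the construction of the inverse of an explicit time change. *)
Lemma time_change_Lipschitz l : l 0 = 0 -> l 1 = 1 ->
  (forall s t, `|(l t - t) - (l s - s)| <= 2^-1 * `|t - s|) -> time_change l.
Proof.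
move=> l0 l1 H.
have mono s t : s <= t -> 2^-1 * (t - s) <= l t - l s.
  move=> st; have := H s t; rewrite (ger0_norm (_ : 0 <= t - s)) ?subr_ge0 //.
  rewrite ler_norml => /andP[]; lra.
have lip s t : s <= t -> l t - l s <= 2 * (t - s).
  move=> st; have := H s t; rewrite (ger0_norm (_ : 0 <= t - s)) ?subr_ge0 //.
  rewrite ler_norml => /andP[]; lra.
have lipc f (C : R) : 0 < C -> (forall s t, 0 <= s <= 1 -> 0 <= t <= 1 ->
    s <= t -> 0 <= f t - f s <= C * (t - s)) ->
    {within `[0, 1], continuous f}.
  move=> C0 hf; apply/subspace_continuousP => t; rewrite /= in_itv /= => tI.
  apply/cvgrPdist_lt => e e0; rewrite near_withinE.
  near=> u => /=; rewrite in_itv /= => uI.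
  have d : `|t - u| < e / C.
    near: u; exact: (@cvgr_dist_lt _ _ _ _ _ id t (@cvg_id _ _) _ (divr_gt0 e0 C0)).
  rewrite ltr_pdivlMr // mulrC in d; apply: le_lt_trans d.
  have [tu|/ltW ut] := leP t u.
    have /andP[a b] := hf _ _ tI uI tu.
    rewrite distrC ger0_norm // (le_trans b) // ler_wpM2l ?(ltW C0) //.
    by rewrite distrC ger0_norm ?subr_ge0.
  have /andP[a b] := hf _ _ uI tI ut.
  rewrite ger0_norm // (le_trans b) // ler_wpM2l ?(ltW C0) //.
  by rewrite ger0_norm ?subr_ge0.
have lc : {within `[0, 1], continuous l}.
  apply: (lipc l 2) => // s t _ _ st; rewrite lip // andbT.
  by apply: le_trans (mono _ _ st); rewrite mulr_ge0 ?subr_ge0 // invr_ge0.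
have lmap t : 0 <= t <= 1 -> 0 <= l t <= 1.
  move=> /andP[a b]; have := mono _ _ a; have := mono _ _ b.
  rewrite l0 l1; lra.
have /choice[m mP] t : exists v, 0 <= t <= 1 -> 0 <= v <= 1 /\ l v = t.
  have [tI|/negP tI] := boolP (0 <= t <= 1); last by exists 0 => ?; case: tI.
  have tI' : minr (l 0) (l 1) <= t <= maxr (l 0) (l 1).
    by rewrite l0 l1 min_l ?max_r.
  have [c cI <-] := IVT ler01 lc tI'.
  by exists c => _; split=> //; move: cI; rewrite in_itv.
have lK t : 0 <= t <= 1 -> m (l t) = t.
  move=> tI; have [a b] := mP _ (lmap _ tI).
  have [h|/ltW h] := leP t (m (l t)); have := mono _ _ h; lra.
split.
  move=> s t; rewrite !in_itv /= => sI tI st; have := mono _ _ st; lra.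
exists m; split=> //.
- split=> t; rewrite /= !in_itv /=; first exact: lmap.
  by move=> /mP[].
- by move=> t; rewrite in_itv /= => /mP[].
- apply: (lipc m 2) => // s t sI tI st.
  have [a b] := mP _ sI; have [c d] := mP _ tI.
  have [h|h] := leP (m s) (m t).
    have := mono _ _ h; have := lip _ _ h; lra.
  have := mono _ _ (ltW h); lra.
Unshelve. all: by end_near. Qed.

End skorokhod_basics.

(** * Moving finitely many points by a small time change *)

Section moving_points.
Variable R : realType.
Implicit Types (x y z : skorokhod R) (s t u v e h w : R).

Lemma finite_pos_lower_bound (I : finType) (F : I -> R) :
  (forall i, 0 < F i) -> exists2 g, 0 < g & forall i, g <= F i.
Proof.
move=> F0; exists (\big[minr/1]_i F i); last by move=> i; exact: bigmin_le_cond.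
by apply/bigmin_gtP; split.
Qed.

(** A bump that vanishes at all points but one moves that point independently of the
    others. *)
Definition tent s w u : R := maxr 0 (1 - `|u - s| / w).

Lemma tent_center s w : tent s w s = 1.
Proof. by rewrite /tent subrr normr0 mul0r subr0 max_r. Qed.

Lemma tent_out s w u : 0 < w -> w <= `|u - s| -> tent s w u = 0.
Proof. by move=> w0 h; rewrite /tent max_l // subr_le0 ler_pdivlMr // mul1r. Qed.

Lemma tent_ge0_le1 s w u : 0 < w -> 0 <= tent s w u <= 1.
Proof.
move=> w0; rewrite /tent le_max lexx /= ge_max ler01 /= gerBl.
by rewrite divr_ge0 // ltW.
Qed.

Lemma tent_lipschitz s w u v : 0 < w ->
  `|tent s w u - tent s w v| <= `|u - v| / w.
Proof.
move=> w0; rewrite /tent.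
have maxl (a b : R) : `|maxr 0 a - maxr 0 b| <= `|a - b|.
  have := ler_norm (a - b); have := ler_norm (b - a); rewrite (distrC b a).
  have := normr_ge0 (a - b).
  by have [?|?] := leP 0 a; have [?|?] := leP 0 b;
    rewrite ?subr0 ?sub0r ?normrN ?subrr ?normr0 // => *; rewrite ler_norml; lra.
apply: le_trans (maxl _ _) _.
have -> : 1 - `|u - s| / w - (1 - `|v - s| / w) = (`|v - s| - `|u - s|) / w.
  by rewrite mulrBl; lra.
rewrite normrM (gtr0_norm (_ : 0 < w^-1)) ?invr_gt0 //.
rewrite ler_wpM2r ?invr_ge0 ?(ltW w0) //.
apply: le_trans (ler_dist_dist _ _) _.
by rewrite distrC opprB addrA subrK.
Qed.

(** Near a configuration of distinct points, adding to the identity one small bump per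
    point sends [s i] to [t i]. The time change preserves the position of every time relative
    to the points, which is what step functions see of it. *)
Lemma move_points k (t : 'I_k -> R) :
  (forall i, 0 < t i < 1) -> injective t ->
  exists2 w, 0 < w & forall h (s : 'I_k -> R), h <= w ->
    (forall i, `|s i - t i| <= h) ->
    exists l, [/\ time_change l, forall i, 0 < s i < 1,
      forall i u, 0 <= u <= 1 -> (t i <= l u) = (s i <= u) &
      forall u, 0 <= u <= 1 -> `|l u - u| <= k%:R * h].
Proof.
move=> t01 tinj.
pose F (p : 'I_k * 'I_k) := if p.1 == p.2 then minr (t p.1) (1 - t p.1)
  else `|t p.1 - t p.2|.
have [|g g0 gF] := @finite_pos_lower_bound _ F.
  move=> [i j] /=; rewrite /F /=; case: ifPn => [_|ij].
    by have /andP[a b] := t01 i; rewrite lt_min a subr_gt0.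
  rewrite normr_gt0 subr_eq0; apply: contra ij => /eqP /tinj ->; exact: eqxx.
have gt i : g <= t i /\ t i <= 1 - g.
  have := gF (i, i); rewrite /F /= eqxx le_min => /andP[-> h]; split=> //; lra.
have gd i j : i != j -> g <= `|t i - t j|.
  by move=> ij; have := gF (i, j); rewrite /F /= (negbTE ij).
pose w := g / 2; have w0 : 0 < w by rewrite divr_gt0.
have k0 : 0 < 2 * (k.+1%:R : R) by rewrite mulr_gt0.
exists (w / (2 * k.+1%:R)); first by rewrite divr_gt0.
move=> h s hw sh.
have [k00|kp] := posnP k.
  subst k; exists id; split; [exact: time_change_id|by case|by case|].
  by move=> u _; rewrite subrr normr0 mul0r.
have h0 : 0 <= h by apply: le_trans (sh (Ordinal kp)).
have hw' : h * (2 * k.+1%:R) <= w by rewrite -ler_pdivlMr.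
have k1 : 1 <= (k.+1%:R : R) by rewrite ler1n.
have hw2 : h * 2 <= w.
  apply: le_trans hw'; rewrite ler_wpM2l //; lra.
have sb i : t i - h <= s i <= t i + h by rewrite -ler_distl.
have wg : w + w = g by rewrite /w -splitr.
(* The points [s i] are at distance at least [2 * w - 2 * h >= w] from one another, so
   each bump vanishes at the centres of the others. *)
pose l u := u + \sum_(j < k) (t j - s j) * tent (s j) w u.
have s01 i : w <= s i <= 1 - w by have [? ?] := gt i; have := sb i; lra.
have lE u : l u - u = \sum_(j < k) (t j - s j) * tent (s j) w u.
  by rewrite /l addrC addKr.
have l0 : l 0 = 0.
  rewrite /l add0r big1 // => j _; rewrite tent_out ?mulr0 //.
  have := s01 j; rewrite sub0r normrN ler_normr; lra.
have l1 : l 1 = 1.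
  rewrite /l big1 ?addr0 // => j _; rewrite tent_out ?mulr0 //.
  have := s01 j; rewrite ler_normr; lra.
have ls i : l (s i) = t i.
  rewrite /l (bigD1 i) //= tent_center mulr1 big1 ?addr0 ?subrKC //.
  move=> j ji; rewrite tent_out ?mulr0 //.
  have := gd _ _ ji; rewrite !ler_normr; have := sb i; have := sb j.
  move: hw2 w0; rewrite -wg => *; apply/orP.
  have [?|?] := leP (t j) (t i); [left|right]; lra.
have tl : time_change l.
  apply: time_change_Lipschitz => // u v; rewrite !lE -sumrB.
  apply: (le_trans (ler_norm_sum _ _ _)).
  apply: (@le_trans _ _ (\sum_(j < k) h * (`|v - u| / w))).
    apply: ler_sum => j _; rewrite -mulrBr normrM ler_pM //.
      by rewrite distrC; exact: sh.
    exact: tent_lipschitz.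
  rewrite sumr_const card_ord -[leLHS]mulr_natl !mulrA mulrAC.
  rewrite ler_wpM2r // ler_pdivrMr // [leRHS]mulrC.
  by move: hw'; rewrite -(natr1 k) => ?; lra.
exists l; split=> //.
- by move=> i; have := s01 i; lra.
- move=> i u uI; rewrite -ls.
  have sI : 0 <= s i <= 1 by have := s01 i; lra.
  have [su|us] := leP (s i) u; first exact: time_change_homo.
  by apply/negbTE; rewrite -ltNge; exact: time_change_mono.
- move=> u uI; rewrite lE; apply: (le_trans (ler_norm_sum _ _ _)).
  apply: (@le_trans _ _ (\sum_(j < k) h)); last first.
    by rewrite sumr_const card_ord mulr_natl.
  apply: ler_sum => j _; rewrite normrM -[leRHS]mulr1 ler_pM //.
    by rewrite distrC; exact: sh.
  by have /andP[a b] := tent_ge0_le1 (s j) u w0; rewrite ger0_norm.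
Qed.

(** Finitely many cells suffice by the supremum argument for compactness of [0, 1]: the left
    limit at the supremum of the good endpoints makes that supremum good, and
    right-continuity there pushes it to 1. The endpoint 1 is not included, since a path may
    jump there. *)
Lemma skorokhod_cells x e : 0 < e ->
  exists k (t : 'I_k -> R), [/\ forall i, 0 < t i < 1, injective t &
    forall u v, 0 <= u < 1 -> 0 <= v < 1 ->
    (forall i, (t i <= u) = (t i <= v)) -> `|x u - x v| <= e].
Proof.
move=> e0; have [xr xl _] := skorokhodP x.
pose P c := exists2 l : seq R, {in l, forall s, 0 < s < 1} &
  forall u v, 0 <= u < c -> 0 <= v < c ->
  {in l, forall s, (s <= u) = (s <= v)} -> `|x u - x v| <= e.
suff [l l01 Pl] : P 1.
  exists (size (undup l)), (fun i => (undup l)`_i); split.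
  - by move=> i; apply: l01; rewrite -mem_undup mem_nth.
  - by move=> i j /eqP; rewrite nth_uniq ?undup_uniq // => /eqP/val_inj.
  - move=> u v uI vI H; apply: Pl => // s; rewrite -mem_undup => sl.
    have si : (index s (undup l) < size (undup l))%N by rewrite index_mem.
    by have := H (Ordinal si); rewrite /= nth_index.
(* The good endpoints: those before which finitely many cells suffice *)
pose S := [set c | 0 <= c <= 1 /\ P c].
have S0 : S 0.
  split; first by rewrite lexx ler01.
  by exists [::] => // u v /andP[a b]; have := le_lt_trans a b; rewrite ltxx.
have supS : has_sup S.
  by split; [exists 0|exists 1 => c [/andP[]]].
pose c := sup S.
have c0 : 0 <= c by apply: sup_upper_bound.
have c1 : c <= 1 by apply: ge_sup; [exists 0|move=> y [/andP[]]].
have Pc : P c.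
  have [cp|cn] := ltP 0 c; last first.
    by have -> : c = 0 by [apply/le_anti; rewrite cn c0]; case: S0.
  have /cvg_ex[/= a xa] : cvg (x u @[u --> c^'-]) by apply: xl; rewrite cp.
  have e2 : 0 < e / 2 by rewrite divr_gt0.
  have /cvgrPdist_lt /(_ _ e2) := xa.
  move=> [eta /= eta0 Heta].
  have [s Ss cs] : exists2 s, S s & maxr 0 (c - eta) < s.
    by apply: sup_gt; [exists 0|rewrite gt_max cp gtrBl].
  move: cs; rewrite gt_max => /andP[s0 cs].
  have sc : s <= c by apply: sup_upper_bound.
  move: Ss => [_ [l l01 Pl]].
  have [->//|sc'] := eqVneq c s; first by exists l.
  have {}sc : s < c by rewrite lt_neqAle eq_sym sc'.
  exists (s :: l).
    by move=> r; rewrite inE => /orP[/eqP ->|/l01 //]; rewrite s0; lra.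
  move=> u v /andP[u0 uc] /andP[v0 vc] H.
  have Hs : (s <= u) = (s <= v) by apply: H; rewrite inE eqxx.
  have close r : s <= r < c -> `|a - x r| < e / 2.
    move=> /andP[sr rc]; apply: Heta => //=.
    by rewrite gtr0_norm ?subr_gt0 //; lra.
  have [su|us] := leP s u.
    have h1 : `|a - x u| < e / 2 by apply: close; rewrite su.
    have h2 : `|a - x v| < e / 2 by apply: close; rewrite -Hs su.
    move: h1 h2; rewrite ler_norml !ltr_norml; lra.
  have vs : v < s by rewrite ltNge -Hs -ltNge.
  apply: Pl; rewrite ?u0 ?v0 // => r rl; apply: H.
  by rewrite inE rl orbT.
have [c1e|cn] := eqVneq c 1; first by rewrite -c1e.
have {cn}c1' : c < 1 by rewrite lt_neqAle cn.
exfalso.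
have e2 : 0 < e / 2 by rewrite divr_gt0.
have /cvgrPdist_lt /(_ _ e2) [eta /= eta0 Heta] : x u @[u --> c^'+] --> x c.
  by apply: xr; rewrite c0.
pose c' := minr (c + eta / 2) 1.
have cc' : c < c' by rewrite lt_min c1' andbT ltrDl divr_gt0.
suff : S c' by move=> /(sup_upper_bound supS); rewrite leNgt cc'.
have c'1 : c' <= 1 by rewrite ge_min lexx orbT.
have c'e : c' <= c + eta / 2 by rewrite ge_min lexx.
split; first by lra.
have close r : c <= r < c' -> `|x c - x r| < e / 2.
  move=> /andP[cr rc]; have [->|rc'] := eqVneq r c; first by rewrite subrr normr0.
  have {}cr : c < r by rewrite lt_neqAle eq_sym rc'.
  by apply: Heta => //=; rewrite ltr0_norm ?subr_lt0 //; lra.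
have [l l01 Pl] := Pc.
exists (if 0 < c then c :: l else l).
  case: ifPn => // cp r; rewrite inE => /orP[/eqP ->|/l01 //].
  by rewrite cp c1'.
move=> u v /andP[u0 uc] /andP[v0 vc] H.
have Hc : (c <= u) = (c <= v).
  move: H; case: ifPn => [cp|]; first by apply; rewrite inE eqxx.
  by rewrite -leNgt => cn _; rewrite (le_trans cn u0) (le_trans cn v0).
have [cu|uc'] := leP c u.
  have h1 : `|x c - x u| < e / 2 by apply: close; rewrite cu.
  have h2 : `|x c - x v| < e / 2 by apply: close; rewrite -Hc cu.
  move: h1 h2; rewrite ler_norml !ltr_norml; lra.
have vc' : v < c by rewrite ltNge -Hc -ltNge.
apply: Pl; rewrite ?u0 ?v0 // => r rl; apply: H.
by case: ifPn; rewrite ?inE rl ?orbT.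
Qed.

End moving_points.

(** * Step paths and sampling on a grid *)

Section step_paths.
Variable R : realType.
Implicit Types (x y : skorokhod R) (s u v e : R).

Definition stepf n (z t : 'I_n -> R) u : R :=
  \sum_(i < n) z i * \1_(`[t i, 1]) u.

Lemma indic_itv1 s u : 0 <= u <= 1 -> \1_(`[s, 1]) u = (s <= u)%R%:R :> R.
Proof.
by move=> /andP[_ u1]; rewrite indicE mem_setE in_itv /= u1 andbT.
Qed.

Lemma stepfE n (z t : 'I_n -> R) u : 0 <= u <= 1 ->
  stepf z t u = \sum_(i < n) z i * (t i <= u)%R%:R.
Proof. by move=> uI; apply: eq_bigr => i _; rewrite indic_itv1. Qed.

Lemma cadlag01_indic s : 0 <= s -> cadlag01 (\1_(`[s, 1]) : R -> R).
Proof.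
move=> s0; split.
- move=> u /andP[u0 u1]; have uI : 0 <= u <= 1 by rewrite u0 ltW.
  have [su|us] := leP s u; apply: cvg_near_cst; near=> x;
    have xI : 0 <= x <= 1 by (apply/andP; split;
      [apply: (le_trans u0); near: x; exact: nbhs_right_ge
      |near: x; exact: nbhs_right_le]).
    rewrite (indic_itv1 _ uI) (indic_itv1 _ xI) su.
    suff -> : s <= x by [].
    by apply: (le_trans su); near: x; exact: nbhs_right_ge.
  rewrite (indic_itv1 _ uI) (indic_itv1 _ xI) (leNgt s u) us /=.
  suff -> : (s <= x) = false by [].
  by apply/negbTE; rewrite -ltNge; near: x; exact: nbhs_right_lt.
- move=> u /andP[u0 u1].
  have [su|us] := ltP s u.
    apply/cvg_ex; exists 1; apply: cvg_near_cst; near=> x.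
    rewrite indic_itv1.
      suff -> : s <= x by []; near: x; exact: nbhs_left_ge.
    apply/andP; split; first by near: x; exact: nbhs_left_ge.
    by apply: le_trans u1; near: x; exact: nbhs_left_le.
  apply/cvg_ex; exists 0; apply: cvg_near_cst; near=> x.
  have xu : x < u by near: x; exact: nbhs_left_lt.
  rewrite indicE mem_setE in_itv /=.
  suff -> : (s <= x) = false by [].
  by apply/negbTE; rewrite -ltNge (lt_le_trans xu).
- move=> u uI; rewrite indicE mem_setE in_itv /=.
  have -> // : (s <= u <= 1) = false.
  apply/negP => /andP[a b]; apply: uI; rewrite b andbT; lra.
Unshelve. all: by end_near. Qed.

Lemma cadlag01D (f g : R -> R) : cadlag01 f -> cadlag01 g ->
  cadlag01 (fun u => f u + g u).
Proof.
move=> [f1 f2 f3] [g1 g2 g3]; split=> u uI.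
- by apply: cvgD; [exact: f1|exact: g1].
- by apply: is_cvgD; [exact: f2|exact: g2].
- by rewrite f3 // g3 // addr0.
Qed.

Lemma cadlag01Ml (r : R) (f : R -> R) : cadlag01 f ->
  cadlag01 (fun u => r * f u).
Proof.
move=> [f1 f2 f3]; split=> u uI.
- by apply: cvgMl_tmp; exact: f1.
- by apply: is_cvgMl_tmp; exact: f2.
- by rewrite f3 // mulr0.
Qed.

Lemma cadlag01_cst0 : cadlag01 (fun _ : R => 0 : R).
Proof. by split=> u uI //; [exact: cvg_cst|exact: is_cvg_cst]. Qed.

Lemma stepf_cadlag n (z t : 'I_n -> R) : (forall i, 0 <= t i) ->
  cadlag01 (stepf z t).
Proof.
elim: n z t => [|n IH] z t t0.
  have -> : stepf z t = fun=> 0 by apply/funext => u; rewrite /stepf big_ord0.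
  exact: cadlag01_cst0.
have -> : stepf z t = fun u => stepf (fun i => z (widen_ord (leqnSn n) i))
    (fun i => t (widen_ord (leqnSn n) i)) u + z ord_max * \1_(`[t ord_max, 1]) u.
  by apply/funext => u; rewrite /stepf big_ord_recr.
apply: cadlag01D; first by apply: IH => i; exact: t0.
by apply: cadlag01Ml; exact: cadlag01_indic.
Qed.

Definition step_path n (t : 'I_n -> R) (t0 : forall i, 0 <= t i)
  (z : 'I_n -> R) : skorokhod R := Skorokhod (stepf_cadlag z t0).

Lemma grid_ge0 m (i : 'I_m.+2) : 0 <= (i%:R / m.+1%:R : R).
Proof. by rewrite divr_ge0. Qed.

Definition grid_coef m (f : R -> R) (i : 'I_m.+2) : R :=
  f (i%:R / m.+1%:R) - (if i == 0%N :> nat then 0 else f (i.-1%:R / m.+1%:R)).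

(** The path sampled on the grid of mesh 1/(m+1) *)
Definition grid_path m x : skorokhod R :=
  step_path (@grid_ge0 m) (grid_coef x).

Lemma grid_pathE m x u : 0 <= u <= 1 ->
  grid_path m x u = x ((Num.truncn (m.+1%:R * u))%:R / m.+1%:R).
Proof.
move=> uI; have m0 : 0 < m.+1%:R :> R by [].
have mu0 : 0 <= m.+1%:R * u by case/andP: uI => *; rewrite mulr_ge0.
set r := Num.truncn _.
have rm : (r < m.+2)%N.
  rewrite ltnS -(ler_nat R); apply: (@le_trans _ _ (m.+1%:R * u)).
    by rewrite -truncn_ge_nat.
  by rewrite -[leRHS]mulr1 ler_wpM2l //; case/andP: uI.
rewrite /= stepfE //.
transitivity (\sum_(i < r.+1) (x (i%:R / m.+1%:R) -
    (if i == 0%N :> nat then 0 else x (i.-1%:R / m.+1%:R)))); last first.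
  rewrite big_ord_recl /= mul0r subr0.
  rewrite (eq_bigr (fun i : 'I_r => x (i.+1%:R / m.+1%:R) - x (i%:R / m.+1%:R))).
    rewrite -(big_mkord xpredT (fun i => x (i.+1%:R / m.+1%:R) - x (i%:R / m.+1%:R))).
    by rewrite telescope_sumr // mul0r subrKC.
  by move=> i _.
rewrite (big_ord_widen _ (fun i => x (i%:R / m.+1%:R) -
    (if i == 0%N :> nat then 0 else x (i.-1%:R / m.+1%:R))) rm) [RHS]big_mkcond.
apply: eq_bigr => i _; rewrite ler_pdivrMr // mulrC [u * _]mulrC.
by rewrite -truncn_ge_nat // -/r ltnS; case: leqP => _; rewrite ?mul1r ?mul0r.
Qed.

Lemma nat_ceiling (c : R) : 0 < c ->
  exists2 q : nat, (forall r : nat, (q <= r)%N = (c <= r%:R)) & q%:R < c + 1.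
Proof.
move=> c0; have ex : exists n : nat, c <= n%:R.
  by exists (Num.truncn c).+1; exact/ltW/truncnS_gt.
exists (ex_minn ex); case: ex_minnP => q cq qmin.
  move=> r; apply/idP/idP; last exact: qmin.
  by move=> qr; apply: (le_trans cq); rewrite ler_nat.
case: q cq qmin => [|q] cq qmin; first by rewrite ltr_wpDl // ltW.
rewrite -natr1 ltrD2r ltNge; apply/negP => /qmin.
by rewrite ltnn.
Qed.

(** Sampling moves the cell boundaries of [skorokhod_cells] to the next grid points, and
    the time change of [move_points] moves them back. *)
Lemma grid_path_cvg x e : 0 < e ->
  exists M, forall m, (M <= m)%N -> dJ1 x (grid_path m x) <= e.
Proof.
move=> e0; have [k [t [t01 tinj Ht]]] := skorokhod_cells x e0.
have [w w0 Hw] := move_points t01 tinj.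
pose a := minr w (e / k.+1%:R).
have a0 : 0 < a by rewrite lt_min w0 divr_gt0.
exists (Num.truncn a^-1) => m Mm.
have m0 : 0 < m.+1%:R :> R by [].
have ma : m.+1%:R^-1 <= a.
  rewrite -[leRHS]invrK lef_pV2 ?posrE ?invr_gt0 //; apply: ltW.
  by apply: lt_le_trans (truncnS_gt _) _; rewrite ler_nat ltnS.
have /choice[q qP] (i : 'I_k) : exists q : nat,
    (forall r : nat, (q <= r)%N = (m.+1%:R * t i <= r%:R)) /\
    q%:R < m.+1%:R * t i + 1.
  have [|q q1 q2] := @nat_ceiling (m.+1%:R * t i); last by exists q.
  by rewrite mulr_gt0 //; case/andP: (t01 i).
pose s i := (q i)%:R / m.+1%:R : R.
have [||l [tl s01 lE lu]] := Hw m.+1%:R^-1 s.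
- by apply: le_trans ma _; rewrite ge_min lexx.
- move=> i; have [q1 q2] := qP i; rewrite ler_distl; apply/andP; split.
    rewrite (@le_trans _ _ (t i)) // ?gerBl // /s ler_pdivlMr // mulrC.
    by rewrite -q1.
  rewrite /s ler_pdivrMr // mulrDl mulVf ?gt_eqF // mulrC; exact: ltW.
apply: (dJ1_le_time_change tl) => u uI.
  apply: (le_trans (lu _ uI)).
  apply: (@le_trans _ _ (k%:R * (e / k.+1%:R))).
    by rewrite ler_wpM2l // (le_trans ma) // ge_min lexx orbT.
  rewrite mulrCA ger_pMr // ler_pdivrMr // mul1r ler_nat; exact: leqnSn.
rewrite grid_pathE //.
have mu0 : 0 <= m.+1%:R * u by case/andP: uI => *; rewrite mulr_ge0.
have [->|u1] := eqVneq u 1.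
  by rewrite (time_change1 tl) mulr1 natrK divff ?gt_eqF // subrr normr0 ltW.
set r := Num.truncn _.
have {}u1 : u < 1 by rewrite lt_neqAle u1; case/andP: uI.
have u0 : 0 <= u by case/andP: uI.
have I1 : 0 <= (1 : R) <= 1 by rewrite lexx ler01.
apply: Ht.
- have /andP[-> _] := time_change_itv tl uI.
  by rewrite -[ltRHS](time_change1 tl) (time_change_mono tl).
- rewrite divr_ge0 //= ltr_pdivrMr // mul1r.
  apply: (@le_lt_trans _ _ (m.+1%:R * u)); first by rewrite -truncn_ge_nat.
  by rewrite -[ltRHS]mulr1 ltr_pM2l.
- move=> i; rewrite lE // /s.
  rewrite ler_pdivrMr // mulrC -truncn_ge_nat // -/r.
  by have [-> _] := qP i; rewrite ler_pdivlMr // mulrC.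
Qed.

Lemma dist_stepf n (t z z' : 'I_n -> R) h u : (forall i, `|z i - z' i| <= h) ->
  `|stepf z t u - stepf z' t u| <= n%:R * h.
Proof.
move=> zh; rewrite /stepf -sumrB; apply: le_trans (ler_norm_sum _ _ _) _.
apply: (@le_trans _ _ (\sum_(i < n) h)); last by rewrite sumr_const card_ord mulr_natl.
apply: ler_sum => i _; rewrite -mulrBl normrM -[leRHS]mulr1 ler_pM //.
by rewrite indicE; case: (_ \in _); rewrite ?normr1 ?normr0.
Qed.

End step_paths.

(** * Measurability of random paths *)

Section metric_open.
Variables (R : realType) (S : metricType R).

Lemma nbhs_mdistP (x : S) (A : set S) :
  nbhs x A <-> exists2 e, 0 < e & forall y, mdist x y < e -> A y.
Proof.
split=> [/nbhs_ballP[e /= e0 h]|[e e0 h]].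
  by exists e => // y xy; apply: h; rewrite ballEmdist.
by apply/nbhs_ballP; exists e => //= y; rewrite ballEmdist; exact: h.
Qed.

Lemma open_mdistP (A : set S) :
  open A <-> forall x, A x -> exists2 e, 0 < e & forall y, mdist x y < e -> A y.
Proof.
rewrite openE; split=> [h x /h /nbhs_mdistP //|h x /h ?].
exact/nbhs_mdistP.
Qed.

Lemma open_mball (x : S) (e : R) : open [set y | mdist x y < e].
Proof.
apply/open_mdistP => y /= xy; exists (e - mdist x y); first by rewrite subr_gt0.
move=> z yz; apply: le_lt_trans (metric_triangle x y z) _.
by rewrite -ltrBrDl.
Qed.

End metric_open.

Section borel_measurability.
Variables (R : realType) (d : nat).
Local Notation S := (skorokhod_prod R d).
Implicit Types x y : S.

Lemma mdist_prod_le x y (M : R) : (forall i, dJ1 (x i) (y i) <= M) ->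
  mdist x y <= d%:R * M.
Proof.
move=> h; apply: (@le_trans _ _ (\sum_(i < d) M)).
  by apply: ler_sum => i _; exact: h.
by rewrite sumr_const card_ord mulr_natl.
Qed.

Let I (m : nat) : finType := ('I_d * 'I_m.+2)%type.

Let coef_path m (c : I m -> R) : S :=
  fun i => step_path (@grid_ge0 R m) (fun j => c (i, j)).

Let coef_path_dist m (c c' : I m -> R) h : (forall p, `|c p - c' p| <= h) ->
  mdist (coef_path c) (coef_path c') <= d%:R * (m.+2%:R * h).
Proof.
move=> H; apply: mdist_prod_le => i; apply: dJ1_le_unif => t _.
by apply: dist_stepf => j; exact: H.
Qed.

Context d0 (T0 : measurableType d0).

(** Step paths on a fixed grid depend on finitely many coefficients, continuously; an open
    condition on them is a countable union of conditions on balls with rational centres. *)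
Let coef_path_measurable m (C : I m -> T0 -> R) :
  (forall p, measurable_fun setT (C p)) ->
  forall G : set S, open G -> measurable [set w | G (coef_path (C ^~ w))].
Proof.
move=> mC G /open_mdistP oG.
(* Balls with rational centre and radius 1/(r+1) on which the path stays in [G] *)
pose good (qr : {ffun I m -> rat} * nat) := forall c : I m -> R,
  (forall p, `|c p - ratr (qr.1 p)| < qr.2.+1%:R^-1) -> G (coef_path c).
pose A (qr : {ffun I m -> rat} * nat) : set T0 :=
  \bigcap_(p in [set: I m]) [set w | `|C p w - ratr (qr.1 p)| < qr.2.+1%:R^-1].
rewrite (_ : [set w | _] = \bigcup_qr (if `[< good qr >] then A qr else set0)).
  apply: countable_bigcupT_measurable; first exact: countableP.
  move=> qr; case: ifPn => // _; apply: fin_bigcap_measurable.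
    exact: finite_finset.
  move=> p _; rewrite -[X in measurable X]setTI.
  apply: (measurable_fun_ltr _ (measurable_cst _)) => //.
  apply: measurableT_comp => //; apply: measurable_funB => //.
apply/seteqP; split=> w /=; last first.
  move=> [qr _]; case: ifPn => // /asboolP gq Aw.
  by apply: gq => p; exact: Aw.
move=> /oG[e e0 He].
have K0 : 0 < d%:R * (m.+2%:R * 2) + 1 :> R.
  by rewrite ltr_wpDl // !mulr_ge0.
pose r := Num.truncn ((d%:R * (m.+2%:R * 2) + 1) / e).
have r0 : 0 < r.+1%:R :> R by [].
have /choice[q qP] p : exists q : rat, `|C p w - ratr q| < r.+1%:R^-1.
  have [|q] := @rat_in_itvoo R (C p w - r.+1%:R^-1) (C p w + r.+1%:R^-1).
    have : 0 < r.+1%:R^-1 :> R by rewrite invr_gt0.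
    move: (_^-1) => h h0.
    lra.
  rewrite in_itv /= => /andP[a b]; exists q.
  move: a b; move: (r.+1%:R^-1) => h a b.
  rewrite ltr_distl; apply/andP; split; lra.
exists ([ffun p => q p], r) => //.
have gq : good ([ffun p => q p], r).
  move=> c /= Hc; apply: He.
  apply: (@le_lt_trans _ _ (d%:R * (m.+2%:R * (2 * r.+1%:R^-1)))).
    apply: coef_path_dist => p; have := Hc p; have := qP p; rewrite ffunE.
    move: (r.+1%:R^-1) => h; rewrite !ltr_norml ler_norml; lra.
  rewrite !mulrA ltr_pdivrMr // -ltr_pdivrMl //.
  apply: (@lt_trans _ _ ((d%:R * (m.+2%:R * 2) + 1) / e)).
    by rewrite [ltLHS]mulrC ltr_pM2r ?invr_gt0 // !mulrA ltrDl.
  exact: truncnS_gt.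
rewrite asboolT // => p _ /=; rewrite ffunE; exact: qP.
Qed.

(** The sampled paths are measurable by [coef_path_measurable] and converge to the path. The
    domain is arbitrary in order to cover the sub-sigma-algebra generated by the paths of one
    coordinate. *)
Lemma skorokhod_prod_measurable (Y : T0 -> S) :
  (forall i t, 0 <= t <= 1 -> measurable_fun setT (fun w => Y w i t)) ->
  forall G : set S, open G -> measurable (Y @^-1` G).
Proof.
move=> mY G oG.
pose Z m w : S := fun i => grid_path m (Y w i).
have mZ m (H : set S) : open H -> measurable [set w | H (Z m w)].
  move=> oH; pose C (p : I m) w := grid_coef (Y w p.1) p.2.
  apply: (@coef_path_measurable m C) => // -[i j].
  have gI (k : nat) : (k <= m.+1)%N -> 0 <= (k%:R / m.+1%:R : R) <= 1.
    by move=> km; rewrite divr_ge0 //= ler_pdivrMr // mul1r ler_nat.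
  have ji : (j <= m.+1)%N by rewrite -ltnS.
  rewrite /C /grid_coef /=; case: eqVneq => j0.
    apply: measurable_funB => //; first by apply: mY; exact: gI.
  apply: measurable_funB; apply: mY; apply: gI => //.
  exact: leq_trans (leq_pred _) _.
(* Points at distance more than 1/(r+1) from the complement of [G], so that eventual
   membership of the approximations can be transferred to the limit *)
pose Gr r := [set x | exists2 e, r.+1%:R^-1 < e & forall y, mdist x y < e -> G y].
have oGr r : open (Gr r).
  apply/open_mdistP => x [e re He]; exists (e - r.+1%:R^-1).
    by rewrite subr_gt0.
  move=> y xy.
  exists (e - mdist x y); first by rewrite ltrBrDl -ltrBrDr.
  move=> z yz; apply: He; apply: le_lt_trans (metric_triangle x y z) _.
  by rewrite -ltrBrDl.
have Zcvg w e : 0 < e -> exists M, forall m, (M <= m)%N -> mdist (Y w) (Z m w) < e.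
  move=> e0; pose e' := e / d.+1%:R; have e'0 : 0 < e' by rewrite divr_gt0.
  have /choice[M HM] (i : 'I_d) := grid_path_cvg (Y w i) e'0.
  exists (\max_i M i)%N => m Mm.
  apply: (@le_lt_trans _ _ (d%:R * e')).
    by apply: mdist_prod_le => i; apply: HM; apply: leq_trans Mm; exact: leq_bigmax.
  by rewrite /e' mulrCA gtr_pMr // ltr_pdivrMr // mul1r ltr_nat.
rewrite (_ : _ @^-1` G = \bigcup_r \bigcup_M \bigcap_(m in [set m | (M <= m)%N])
    [set w | Gr r (Z m w)]).
  apply: bigcup_measurable => r _; apply: bigcup_measurable => M _.
  by apply: bigcap_measurable => [|m _]; [exists M => /=|exact: mZ].
apply/seteqP; split=> w /=.
  have /open_mdistP oG' := oG.
  move=> /oG'[e e0 He].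
  have e20 : 0 < e / 2 by rewrite divr_gt0.
  have [M HM] := Zcvg w _ e20.
  exists (Num.truncn (e / 2)^-1) => //; exists M => // m Mm.
  exists (e / 2).
    by rewrite invf_plt ?posrE // truncnS_gt.
  move=> y Zy; apply: He; apply: le_lt_trans (metric_triangle _ (Z m w) _) _.
  by have := HM m Mm; lra.
move=> [r _ [M _ HM]].
have [|M' HM'] := Zcvg w r.+1%:R^-1; first by rewrite invr_gt0.
have [|e re] := HM (maxn M M'); first exact: leq_maxl.
apply; apply: lt_trans re; rewrite metric_sym; apply: HM'; exact: leq_maxr.
Qed.

End borel_measurability.

(** * Paths with a bounded number of jumps *)

Section step_space.
Variable R : realType.
Implicit Types (xi zeta : skorokhod R) (u v e : R).

(** Null heights and repeated times are allowed, which makes [steps k] increasing in [k] and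
    closed. *)
Definition steps k : set (skorokhod R) := [set xi |
  exists z s : 'I_k -> R, [/\ forall i, 0 <= z i, forall i, 0 < s i < 1 &
    forall u, 0 <= u <= 1 -> xi u = \sum_(i < k) z i * (s i <= u)%R%:R]].

(** A monotone path that only moves when a bounded counter moves is a step path. The value
    [l i] reached while the counter is at most [i] plays the role of the path after [i]
    jumps, and the infimum of the times with counter above [i] is the jump time. The
    regularity assumptions place these times inside the open interval. This serves both for
    the closedness of [steps k] and for the paths of large jumps. *)
Lemma counting_representation (L : R -> R) (C : R -> nat) k :
  (forall u v, 0 <= u -> u <= v -> v <= 1 -> L u <= L v) ->
  (forall u v, 0 <= u -> u <= v -> v <= 1 -> (C u <= C v)%N) ->
  (forall u, 0 <= u <= 1 -> (C u <= k)%N) ->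
  (forall u v, 0 <= u -> u <= v -> v <= 1 -> C u = C v -> L u = L v) ->
  L 0 = 0 ->
  (forall u e, 0 <= u < 1 -> 0 < e -> exists2 v, u < v <= 1 & L v <= L u + e) ->
  (forall e, 0 < e -> exists2 v, 0 <= v < 1 & L 1 <= L v + e) ->
  exists z s : 'I_k -> R, [/\ forall i, 0 <= z i, forall i, 0 < s i < 1 &
    forall u, 0 <= u <= 1 -> L u = \sum_(i < k) z i * (s i <= u)%R%:R].
Proof.
move=> Lm Cm Ck CL L0 Lr L1.
have CLle u v : 0 <= u <= 1 -> 0 <= v <= 1 -> (C u <= C v)%N -> L u <= L v.
  move=> /andP[u0 u1] /andP[v0 v1] uv; have [h|/ltW h] := leP u v; first exact: Lm.
  by rewrite (CL _ _ v0 h u1) //; apply/eqP; rewrite eqn_leq uv Cm.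
(* The value 0 is added so that the supremum is over a nonempty set even if the counter
   starts above [i]. *)
pose A i := [set y | y = 0 \/ exists2 u, 0 <= u <= 1 /\ (C u <= i)%N & y = L u].
have I1 : 0 <= (1 : R) <= 1 by rewrite lexx ler01.
have I0 : 0 <= (0 : R) <= 1 by rewrite lexx ler01.
have Ab i : has_sup (A i).
  split; first by exists 0; left.
  exists (L 1) => y [->|[u [/andP[u0 u1] _] ->]]; last exact: Lm.
  by rewrite -L0; apply: Lm.
pose l i := sup (A i).
have lub u i : 0 <= u <= 1 -> (C u <= i)%N -> L u <= l i.
  by move=> uI ui; apply: sup_upper_bound => //; right; exists u.
have l_ge0 i : 0 <= l i by apply: sup_upper_bound => //; left.
have lle u i : 0 <= u <= 1 -> (i <= C u)%N -> l i <= L u.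
  move=> uI iu; apply: ge_sup; first by exists 0; left.
  move=> y [->|[v [vI vi] ->]]; first by rewrite -L0; apply: Lm; case/andP: uI.
  by apply: CLle => //; exact: leq_trans iu.
have l0 : l 0%N = 0.
  by apply/le_anti; rewrite l_ge0 andbT -L0; apply: lle.
have lm i : l i <= l i.+1.
  apply: ge_sup; first by exists 0; left.
  move=> y [->//|[u [uI ui] ->]]; apply: lub => //; exact: leqW.
have key i : l i < l i.+1 -> exists2 s, 0 < s < 1 &
    forall u, 0 <= u <= 1 -> (s <= u) = (i < C u)%N.
  move=> li; pose S := [set u | 0 <= u <= 1 /\ (i < C u)%N].
  have big u : 0 <= u <= 1 -> l i < L u -> (i < C u)%N.
    by move=> uI h; rewrite ltnNge; apply/negP => /(lub _ _ uI); rewrite leNgt h.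
  have [u0 Su0] : S !=set0.
    apply/set0P/negP => /eqP S0.
    have : l i.+1 <= l i.
      apply: ge_sup; first by exists 0; left.
      move=> y [->//|[u [uI ui] ->]]; apply: lub => //; rewrite leqNgt.
      by apply/negP => iu; have : S u by []; rewrite S0.
    by rewrite leNgt li.
  have S1 : S 1.
    split=> //; case: Su0 => /andP[h0 h1] h; apply: leq_trans h _; exact: Cm.
  have infS : has_inf S by split; [exists 1|exists 0 => u [/andP[]]].
  pose s := inf S.
  have sle u : S u -> s <= u by move=> Su; apply: ge_inf => //; case: infS.
  have s0 : 0 <= s by apply: lb_le_inf; [exists 1|move=> u [/andP[]]].
  have e0 : 0 < (l i.+1 - l i) / 2 by rewrite divr_gt0 // subr_gt0.
  have s1 : s < 1.
    have [v /andP[v0 v1] hv] := L1 _ e0.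
    apply: le_lt_trans (v1); apply: sle; split; first by rewrite v0 ltW.
    apply: big; first by rewrite v0 ltW.
    have := lle 1 i.+1 I1 S1.2; lra.
  have sI : 0 <= s <= 1 by rewrite s0 ltW.
  have Ss : S s.
    split=> //; apply: big => //.
    have s01 : 0 <= s < 1 by rewrite s0.
    have [v /andP[sv v1] hv] := Lr _ _ s01 e0.
    have [u Su uv] := inf_lt infS.1 sv.
    have [/andP[u0' u1'] iu] := Su.
    have := lle u i.+1 Su.1 iu; have := Lm _ _ u0' (ltW uv) v1; lra.
  exists s.
    rewrite s1 andbT lt_neqAle s0 andbT; apply/eqP => s00.
    have := lle _ i.+1 sI Ss.2; rewrite -s00 L0; have := l_ge0 i; lra.
  move=> u uI; apply/idP/idP => [su|iu]; last exact: sle.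
  apply: leq_trans Ss.2 _; apply: Cm => //; case/andP: uI => //.
have /choice[s sP] (i : 'I_k) : exists s, 0 < s < 1 /\ (l i < l i.+1 ->
    forall u, 0 <= u <= 1 -> (s <= u) = (i < C u)%N).
  have [h|h] := boolP (l i < l i.+1).
    by have [s s1 s2] := key _ h; exists s; split.
  by exists 2^-1; split=> //; rewrite invr_gt0 ltr0n invf_lt1 // ltr1n.
exists (fun i => l i.+1 - l i), s; split.
- by move=> i; rewrite subr_ge0.
- by move=> i; have [] := sP i.
move=> u uI; transitivity (l (C u)).
  by apply/le_anti; rewrite lub // lle.
transitivity (\sum_(i < C u) (l i.+1 - l i)).
  by rewrite -(big_mkord xpredT (fun i => l i.+1 - l i)) telescope_sumr // l0 subr0.
rewrite (big_ord_widen _ (fun i => l i.+1 - l i) (Ck _ uI)) big_mkcond /=.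
apply: eq_bigr => i _; have [_ h] := sP i.
have := lm i; rewrite le_eqVlt => /orP[/eqP ->|/h ->//].
  by rewrite subrr mul0r if_same.
by case: ifP; rewrite ?mulr1 ?mulr0.
Qed.

Lemma steps_homo k xi u v : steps k xi -> 0 <= u -> u <= v -> v <= 1 ->
  xi u <= xi v.
Proof.
move=> [z [s [z0 s01 E]]] u0 uv v1.
rewrite !E ?u0 ?v1 ?(le_trans uv) ?(le_trans u0) //; apply: ler_sum => i _.
rewrite ler_wpM2l // ler_nat; case: (leP (s i) u) => // su.
by rewrite (le_trans su uv).
Qed.

Lemma steps0 k xi : steps k xi -> xi 0 = 0.
Proof.
move=> [z [s [z0 s01 E]]]; rewrite E ?lexx ?ler01 // big1 // => i _.
by case/andP: (s01 i) => a _; rewrite leNgt a mulr0.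
Qed.

(** Along a strictly increasing chain of values of a step path the number of
    past steps increases strictly, so chains have at most k+1 elements. *)
Lemma steps_chain k xi (f : nat -> R) c : steps k xi ->
  (forall i, (i <= c)%N -> 0 <= f i <= 1) ->
  (forall i, (i < c)%N -> xi (f i) < xi (f i.+1)) -> (c <= k)%N.
Proof.
move=> sxi fI fl; have [z [s [z0 s01 E]]] := sxi.
pose N u := (\sum_(i < k) (s i <= u)%R)%N.
suff H i : (i <= c)%N -> (i <= N (f i))%N.
  apply: leq_trans (H c (leqnn c)) _; rewrite /N -[leqRHS]card_ord -sum1_card.
  by apply: leq_sum => i _; case: (_ <= _).
elim: i => [//|i IH] ic.
apply: leq_ltn_trans (IH (ltnW ic)) _.
have fl' := fl _ ic; have fIi := fI _ (ltnW ic); have fIi1 := fI _ ic.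
have fif : f i <= f i.+1.
  rewrite leNgt; apply/negP => /ltW h; move: fl'; rewrite ltNge.
  by rewrite (steps_homo sxi) //; [case/andP: fIi1|case/andP: fIi].
rewrite ltn_neqAle; apply/andP; split; last first.
  apply: leq_sum => j _; case: (leP (s j) (f i)) => // h.
  by rewrite (le_trans h fif).
apply/negP => /eqP e; move: fl'; rewrite !E //.
rewrite (eq_bigr (fun j => z j * (s j <= f i.+1)%R%:R)) ?ltxx // => j _.
suff -> : (s j <= f i) = (s j <= f i.+1) by [].
have := e; rewrite /N (bigD1 j) //= [RHS](bigD1 j) //=.
have h : (\sum_(a < k | a != j) (s a <= f i)%R <= \sum_(a < k | a != j) (s a <= f i.+1)%R)%N.
  apply: leq_sum => a _; case: (leP (s a) (f i)) => // h.
  by rewrite (le_trans h fif).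
case: (leP (s j) (f i)) => [h'|h']; first by rewrite (le_trans h' fif).
case: (s j <= f i.+1) => //.
by rewrite add0n add1n => e'; rewrite e' ltnn in h.
Qed.

(** The counter for a limit path is the maximal length of a strictly increasing chain of
    values up to the current time: chains survive small uniform perturbations and time
    changes, so the bound of [steps_chain] passes to the limit. *)
Lemma steps_closed k xi :
  (forall e, 0 < e -> exists2 zeta, steps k zeta & dJ1 zeta xi < e) ->
  steps k xi.
Proof.
move=> H.
have app e : 0 < e -> exists zeta l, [/\ steps k zeta, time_change l &
    forall u, 0 <= u <= 1 -> `|zeta (l u) - xi u| < e].
  move=> /H[zeta sz /dJ1_lt_time_change[l tl lP]]; exists zeta, l; split=> //.
  by move=> u uI; have [] := lP _ uI.
have I1 : 0 <= (1 : R) <= 1 by rewrite lexx ler01.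
have I0 : 0 <= (0 : R) <= 1 by rewrite lexx ler01.
have mono u v : 0 <= u -> u <= v -> v <= 1 -> xi u <= xi v.
  move=> u0 uv v1; apply/ler_addgt0Pl => e e0.
  have [|zeta [l [sz tl lP]]] := app (e / 2); first by rewrite divr_gt0.
  have uI : 0 <= u <= 1 by rewrite u0 (le_trans uv).
  have vI : 0 <= v <= 1 by rewrite v1 (le_trans u0).
  have : zeta (l u) <= zeta (l v).
    apply: (steps_homo sz); last by case/andP: (time_change_itv tl vI).
      by case/andP: (time_change_itv tl uI).
    exact: time_change_homo.
  have := lP _ uI; have := lP _ vI; rewrite !ltr_norml; lra.
have xi0 : xi 0 = 0.
  apply/eqP; rewrite -normr_le0; apply/ler_addgt0Pl => e e0.
  have [zeta [l [sz tl lP]]] := app _ e0.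
  have := lP _ I0; rewrite (time_change0 tl) (steps0 sz) sub0r normrN.
  by rewrite addr0 => /ltW.
(* There is a strictly increasing chain of [c + 1] values before time [u]. *)
pose chain c u := exists f : nat -> R, (forall i, (i <= c)%N -> 0 <= f i <= u) /\
  forall i, (i < c)%N -> xi (f i) < xi (f i.+1).
have nochain c u : u <= 1 -> chain c u -> (c <= k)%N.
  move=> u1 [f [fI fl]].
  have [g g0 gP] := @finite_pos_lower_bound R 'I_c
    (fun i => xi (f i.+1) - xi (f i)) (fun i => eq_ind_r is_true (fl i (ltn_ord i)) (subr_gt0 _ _)).
  have [|zeta [l [sz tl lP]]] := app (g / 2); first by rewrite divr_gt0.
  have fI' i : (i <= c)%N -> 0 <= f i <= 1.
    by move=> /fI /andP[-> h]; rewrite (le_trans h).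
  apply: (@steps_chain k zeta (l \o f) c sz) => i ic /=.
    by apply: time_change_itv => //; exact: fI'.
  have := lP _ (fI' _ (ltnW ic)); have := lP _ (fI' _ ic).
  by have := gP (Ordinal ic); rewrite /= !ltr_norml; lra.
have chain0 u : 0 <= u -> chain 0%N u.
  by move=> u0; exists (fun=> 0); split=> // i _; rewrite lexx.
pose C u := (\max_(c < k.+1 | `[< chain c u >]) c)%N.
have Cchain u : 0 <= u -> chain (C u) u.
  move=> u0; rewrite /C; elim/big_rec: _ => [|i n /asboolP ci cn]; first exact: chain0.
  by rewrite /maxn; case: ifP.
have chainC c u : u <= 1 -> chain c u -> (c <= C u)%N.
  move=> u1 cu; have ck := nochain _ _ u1 cu; rewrite -ltnS in ck.
  exact: (@leq_bigmax_cond _ (fun i : 'I_k.+1 => `[< chain i u >])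
    (fun i : 'I_k.+1 => i : nat) (Ordinal ck) (asboolT cu)).
apply: (@counting_representation xi C k) => //.
- move=> u v u0 uv v1; apply: chainC => //; have [f [fI fl]] := Cchain _ u0.
  by exists f; split=> // i /fI/andP[-> h]; rewrite (le_trans h).
- move=> u /andP[u0 u1]; apply: (nochain _ _ u1); exact: Cchain.
- move=> u v u0 uv v1 Cuv; apply/le_anti; rewrite mono //= leNgt.
  apply/negP => xuv; have [f [fI fl]] := Cchain _ u0.
  suff : chain (C u).+1 v by move=> /(chainC _ _ v1); rewrite -Cuv ltnn.
  exists (fun i => if (i <= C u)%N then f i else v); split=> i.
    case: ifP => [/fI/andP[-> h] _|_ _]; first by rewrite (le_trans h).
    by rewrite lexx (le_trans u0).
  rewrite ltnS => iC; rewrite iC; case: ifP => [h|_]; first exact: fl.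
  apply: le_lt_trans xuv; apply: mono; last by rewrite (le_trans uv).
    by case/andP: (fI _ iC).
  by case/andP: (fI _ iC).
- move=> u e uI e0; have [xr _ _] := skorokhodP xi.
  have /cvgrPdist_lt /(_ _ e0) [eta /= eta0 Heta] := xr _ uI.
  case/andP: uI => u0 u1.
  pose v := minr (u + eta / 2) 1.
  have uv : u < v by rewrite lt_min u1 andbT ltrDl divr_gt0.
  have v1 : v <= 1 by rewrite ge_min lexx orbT.
  have ve : v <= u + eta / 2 by rewrite ge_min lexx.
  exists v; first by rewrite uv.
  have := Heta v; rewrite /= ltr0_norm ?subr_lt0 // => /(_ _ uv).
  rewrite ltr_norml => h; have : - (u - v) < eta by lra.
  by move=> /h; lra.
- move=> e e0; have [|zeta [l [sz tl lP]]] := app (e / 2); first by rewrite divr_gt0.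
  have [z [s [z0 s01 E]]] := sz.
  have [|g g0 gP] := @finite_pos_lower_bound R 'I_k (fun i => 1 - s i).
    by move=> i; rewrite subr_gt0; case/andP: (s01 i).
  pose p := 1 - minr g 1.
  have p1 : p < 1 by rewrite gtrBl lt_min g0 ltr01.
  have pI : 0 <= p <= 1 by rewrite (ltW p1) andbT subr_ge0 ge_min lexx orbT.
  have [v vI lv] := time_change_surj tl pI.
  exists v.
    case/andP: vI => -> v1 /=; rewrite lt_neqAle v1 andbT; apply/eqP => ve.
    by move: lv; rewrite ve (time_change1 tl) => h; rewrite -h ltxx in p1.
  have := lP _ vI; have := lP _ I1; rewrite lv (time_change1 tl) !E //.
  rewrite (eq_bigr (fun j => z j * (s j <= p)%R%:R)).
    rewrite !ltr_norml; lra.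
  move=> j _; suff [-> ->] : (s j <= 1) /\ (s j <= p) by [].
  split; first by case/andP: (s01 j) => _ /ltW.
  have := gP j; rewrite /p.
  have : minr g 1 <= g by rewrite ge_min lexx.
  lra.
Qed.

End step_space.

(** * The rate function *)

Section step_rate.
Variable R : realType.
Implicit Types (xi zeta : skorokhod R) (u v e lambda : R).

Definition strict_steps j xi (z t : 'I_j -> R) :=
  [/\ forall i, 0 < z i, forall i, 0 < t i < 1, injective t &
    forall u, 0 <= u <= 1 -> xi u = \sum_(i < j) z i * \1_(`[t i, 1]) u].

(** Merging equal jump times and dropping null jumps *)
Lemma steps_strict k xi : steps k xi ->
  exists j (z t : 'I_j -> R), (j <= k)%N /\ strict_steps xi z t.
Proof.
move=> [z [s [z0 s01 E]]].
pose l := undup [seq s i | i <- enum 'I_k & 0 < z i].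
exists (size l), (fun a => \sum_(i < k | s i == l`_a) z i), (fun a => l`_a).
have lP (a : 'I_(size l)) : exists2 i, 0 < z i & l`_a = s i.
  have : l`_a \in l by rewrite mem_nth.
  by rewrite mem_undup => /mapP[i]; rewrite mem_filter => /andP[zi _] ->; exists i.
split.
  apply: leq_trans (size_undup _) _; rewrite size_map size_filter.
  by apply: leq_trans (count_size _ _) _; rewrite size_enum_ord.
split.
- move=> a; have [i zi ->] := lP a.
  rewrite (bigD1 i) //= ltr_pwDl // sumr_ge0 // => b _; exact: z0.
- by move=> a; have [i zi ->] := lP a.
- by move=> a b /eqP; rewrite nth_uniq ?undup_uniq // => /eqP/val_inj.
- move=> u uI; rewrite E //.
  under [RHS]eq_bigr do rewrite indic_itv1 // mulr_suml.
  transitivity (\sum_(a < size l) \sum_(i < k) (s i == l`_a)%:R * (z i * (s i <= u)%R%:R)).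
    rewrite exchange_big /=; apply: eq_bigr => i _; rewrite -mulr_suml.
    have := z0 i; rewrite le_eqVlt => /orP[/eqP <-|zi]; first by rewrite !(mul0r, mulr0).
    have sl : s i \in l.
      by rewrite mem_undup; apply/mapP; exists i => //; rewrite mem_filter zi mem_enum.
    have il : (index (s i) l < size l)%N by rewrite index_mem.
    rewrite (bigD1 (Ordinal il)) //= nth_index // eqxx big1 ?addr0 ?mul1r //.
    move=> a ai; case: eqP => // sa; case/eqP: ai; apply: val_inj => /=.
    by rewrite sa index_uniq // undup_uniq.
  apply: eq_bigr => a _; rewrite [RHS]big_mkcond /=; apply: eq_bigr => i _.
  by case: eqP => [->|_]; rewrite ?mul1r ?mul0r.
Qed.

Lemma strict_steps_steps j xi (z t : 'I_j -> R) : strict_steps xi z t ->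
  steps j xi.
Proof.
move=> [z0 t0 _ E]; exists z, t; split=> //; first by move=> i; exact: ltW.
by move=> u uI; rewrite E //; apply: eq_bigr => i _; rewrite indic_itv1.
Qed.

Lemma left_limit_steps j xi (z t : 'I_j -> R) u : strict_steps xi z t ->
  0 <= u <= 1 -> left_limit xi u = \sum_(i < j) z i * (t i < u)%R%:R.
Proof.
move=> [z0 t0 _ E] /andP[u0 u1].
have [|g g0 gP] := @finite_pos_lower_bound R 'I_j
  (fun i => if t i < u then u - t i else 1).
  by move=> i; case: ifP => // h; rewrite subr_gt0.
rewrite /left_limit; apply/cvg_lim => //; apply: cvg_near_cst.
have [up|un] := ltP 0 u; near=> v.
  have vu : v < u by near: v; exact: nbhs_left_lt.
  rewrite E; last first.
    rewrite (le_trans (ltW vu) u1) andbT; near: v; exact: nbhs_left_ge.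
  apply: eq_bigr => i _; rewrite indic_itv1; last first.
    rewrite (le_trans (ltW vu) u1) andbT; near: v; exact: nbhs_left_ge.
  have := gP i; case: ltP => [tu ge|ut _].
    suff -> : t i <= v by [].
    apply: (@le_trans _ _ (u - g)); first by lra.
    near: v; apply: nbhs_left_ge; lra.
  by rewrite leNgt (lt_le_trans vu ut).
have [_ _ x0] := skorokhodP xi.
rewrite x0; last first.
  move/andP => [v0 _]; have : v < u by near: v; exact: nbhs_left_lt.
  by rewrite ltNge (le_trans un v0).
rewrite big1 // => i _; have /andP[ti _] := t0 i.
by rewrite ltNge (le_trans un (ltW ti)) mulr0.
Unshelve. all: by end_near. Qed.

Lemma strict_steps_jump j xi (z t : 'I_j -> R) u : strict_steps xi z t ->
  0 <= u <= 1 -> (xi u != left_limit xi u) = [exists i, t i == u].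
Proof.
move=> sx uI; rewrite (left_limit_steps sx uI).
have [z0 t0 tinj E] := sx; rewrite E //.
rewrite -subr_eq0 -sumrB.
rewrite (eq_bigr (fun i => z i * (t i == u)%:R)); last first.
  move=> i _; rewrite indic_itv1 // -mulrBr; congr (_ * _).
  by case: ltgtP => _; rewrite ?subr0 ?subrr.
apply/idP/existsP => [h|].
  apply: contrapT => /forallNP hn; case/eqP: h; rewrite big1 // => i _.
  by case: eqP => [/eqP e|_]; [case: (hn i)|rewrite mulr0].
move=> [i /eqP e]; rewrite (bigD1 i) //= e eqxx mulr1 gt_eqF // ltr_pwDl //.
by apply: sumr_ge0 => k _; rewrite mulr_ge0 // ltW.
Qed.

Lemma I_J1_strict_steps lambda j xi (z t : 'I_j -> R) : strict_steps xi z t ->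
  I_J1 lambda xi = (lambda * j%:R)%:E.
Proof.
move=> sx; have [z0 t0 tinj E] := sx.
rewrite /I_J1 ifT; last first.
  by rewrite inE; exists j, z, t.
rewrite EFinM; congr (_ * _)%E.
transitivity (\esum_(u in t @` [set: 'I_j]) (1%E : \bar R)).
  rewrite esum_mkcond [RHS]esum_mkcond; apply: eq_esum => u _.
  case: ifPn => [/[!inE] /=|/negP h]; last first.
    have uI : ~ (0 <= u <= 1) by move=> uI; apply: h; rewrite inE /= in_itv.
    rewrite ifF //; apply/negP; rewrite inE.
    by move=> [i _ e]; apply: uI; rewrite -e; case/andP: (t0 i) => *; rewrite !ltW.
  rewrite in_itv /= => uI; rewrite (strict_steps_jump sx uI).
  case: ifPn => [/[!inE] -[i _ e]|/negP h].
    suff -> : [exists i, t i == u] by [].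
    by apply/existsP; exists i; apply/eqP.
  suff /negbTE -> : ~~ [exists i, t i == u] by [].
  by apply/existsPn => i; apply/negP => /eqP e; apply: h; rewrite inE; exists i.
rewrite esum_image //; last by move=> a b _ _; exact: tinj.
rewrite esum_fset //; last exact: finite_finset.
rewrite (_ : [set: 'I_j] = [set` enum 'I_j]); last first.
  by apply/seteqP; split=> i //= _; rewrite mem_enum.
rewrite -fsbig_seq ?enum_uniq // big_enum /= sumEFin sumr_const card_ord.
by [].
Qed.

Lemma I_J1_steps_le lambda k xi : 0 <= lambda -> steps k xi ->
  (I_J1 lambda xi <= (lambda * k%:R)%:E)%E.
Proof.
move=> l0 /steps_strict[j [z [t [jk sx]]]].
by rewrite (I_J1_strict_steps lambda sx) lee_fin ler_wpM2l // ler_nat.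
Qed.

Lemma I_J1_notsteps lambda k xi : 0 <= lambda -> ~ steps k xi ->
  ((lambda * k.+1%:R)%:E <= I_J1 lambda xi)%E.
Proof.
move=> l0 nx; have [xD|xD] := boolP (xi \in @D_lt_infty R); last first.
  by rewrite /I_J1 (negbTE xD) leey.
move: xD; rewrite inE => -[j [z [t sx]]].
have {}sx : strict_steps xi z t by [].
rewrite (I_J1_strict_steps lambda sx) lee_fin ler_wpM2l // ler_nat ltnNge.
apply/negP => jk; apply: nx; have [zs [ts [z0 s01 E]]] := strict_steps_steps sx.
exists (fun i : 'I_k => if insub (val i) is Some a then zs a else 0).
exists (fun i : 'I_k => if insub (val i) is Some a then ts a else 2^-1).
split.
- by move=> i; case: insub.
- by move=> i; case: insub => //; lra.
- move=> u uI; rewrite E //.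
  pose F n := (if insub n is Some a then zs a else 0) *
    ((if insub n is Some a then ts a else 2^-1) <= u)%R%:R.
  rewrite (eq_bigr (fun i : 'I_j => F i)); last by move=> i _; rewrite /F valK.
  rewrite (big_ord_widen _ F jk) big_mkcond /=; apply: eq_bigr => i _.
  case: ifP => // /negbT ij; rewrite insubN ?mul0r //.
Qed.

Lemma I_J1_cases lambda xi : I_J1 lambda xi = +oo%E \/
  exists j (z t : 'I_j -> R), strict_steps xi z t /\ I_J1 lambda xi = (lambda * j%:R)%:E.
Proof.
have [xD|xD] := boolP (xi \in @D_lt_infty R); last first.
  by left; rewrite /I_J1 (negbTE xD).
right; move: xD; rewrite inE => -[j [z [t sx]]].
have {}sx : strict_steps xi z t by [].
by exists j, z, t; rewrite (I_J1_strict_steps lambda sx).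
Qed.

Lemma I_J1_infty_notsteps lambda k xi : I_J1 lambda xi = +oo%E -> ~ steps k xi.
Proof.
move=> h /steps_strict[j [z [t [jk sx]]]].
by move: h; rewrite (I_J1_strict_steps lambda sx).
Qed.

Lemma I_J1_ge0 lambda xi : 0 <= lambda -> (0 <= I_J1 lambda xi)%E.
Proof.
move=> l0; have [->|[j [z [t [_ ->]]]]] := I_J1_cases lambda xi; first exact: leey.
by rewrite lee_fin mulr_ge0.
Qed.

(** Lower semicontinuity in one coordinate: the rate takes discrete values and
    its sublevel sets [steps k] are closed, so it cannot drop near [xi] *)
Lemma I_J1_near lambda xi (a : R) : 0 < lambda ->
  exists2 e, 0 < e & forall zeta, dJ1 zeta xi < e ->
    (I_J1 lambda xi <= I_J1 lambda zeta)%E \/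
    (I_J1 lambda xi = +oo%E /\ (a%:E < I_J1 lambda zeta)%E).
Proof.
move=> l0.
have key k : ~ steps k xi -> exists2 e, 0 < e & forall zeta, dJ1 zeta xi < e ->
    ((lambda * k.+1%:R)%:E <= I_J1 lambda zeta)%E.
  move=> nx; apply: contrapT => /forall2NP H; apply: nx; apply: steps_closed.
  move=> e e0; have [//|/existsNP[zeta /not_implyP[d h]]] := H e.
  exists zeta => //; apply: contrapT => nz; apply: h.
  by apply: I_J1_notsteps => //; exact: ltW.
have [xoo|[j [z [t [sx xj]]]]] := I_J1_cases lambda xi.
  have [e e0 He] := key (Num.truncn (a / lambda)) (@I_J1_infty_notsteps _ _ _ xoo).
  exists e => // zeta /He h; right; split=> //; apply: lt_le_trans h.
  by rewrite lte_fin mulrC -ltr_pdivrMr // truncnS_gt.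
have [j0|jp] := posnP j.
  by exists 1 => // zeta _; left; rewrite xj j0 mulr0; apply: I_J1_ge0; exact: ltW.
have [|e e0 He] := key j.-1.
  move=> /(I_J1_steps_le (ltW l0)); rewrite xj lee_fin ler_pM2l // ler_nat.
  by rewrite leqNgt prednK // leqnn.
by exists e => // zeta /He; rewrite prednK // -xj; left.
Qed.

Lemma I_prod_rate_function d (lambda : 'I_d -> R) : (forall i, 0 < lambda i) ->
  rate_function (I_prod lambda).
Proof.
move=> l0; have I0 i zeta : (0 <= I_J1 (lambda i) zeta)%E.
  by apply: I_J1_ge0; exact: ltW.
split; first by move=> x; apply: sume_ge0 => i _.
move=> x a ax.
have /choice[e eP] i : exists e, 0 < e /\ forall zeta, dJ1 zeta (x i) < e ->
    (I_J1 (lambda i) (x i) <= I_J1 (lambda i) zeta)%E \/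
    (I_J1 (lambda i) (x i) = +oo%E /\ (a%:E < I_J1 (lambda i) zeta)%E).
  by have [e e0 He] := I_J1_near (x i) a (l0 i); exists e; split.
have [|g g0 gP] := @finite_pos_lower_bound R 'I_d e.
  by move=> i; case: (eP i).
exists [set y | mdist x y < g].
  by apply/nbhs_mdistP; exists g.
move=> y /= xy.
have dxy i : dJ1 (y i) (x i) < e i.
  apply: lt_le_trans (gP i); apply: le_lt_trans xy; rewrite dJ1_sym.
  rewrite [leRHS](_ : _ = \sum_(k < d) dJ1 (x k) (y k)) // (bigD1 i) //= lerDl.
  by apply: sumr_ge0 => k _; exact: dJ1_ge0.
have [[i ai]|/forallNP na] := pselect (exists i, (a%:E < I_J1 (lambda i) (y i))%E).
  apply: lt_le_trans ai _; rewrite /I_prod (bigD1 i) //= leeDl //.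
  by apply: sume_ge0.
apply: lt_le_trans ax _; apply: lee_sum => i _.
by have [_ /(_ _ (dxy i))[//|[_ h]]] := eP i; case: (na i).
Qed.

End step_rate.

(** * Large deviations from estimates on the coordinates *)

Section limits_of_log_probabilities.
Variable R : realType.
Implicit Types (u : nat -> \bar R).
Local Open Scope ereal_scope.

Lemma limn_esup_le u c : (\forall n \near \oo, u n <= c) -> limn_esup u <= c.
Proof.
move=> h; apply: (@le_trans _ _ (ereal_sup (u @` [set n | u n <= c]))).
  by apply: ereal_inf_lbound; exists [set n | u n <= c].
by apply: ge_ereal_sup => _ [n /= un <-].
Qed.

Lemma limn_einf_ge u c : (\forall n \near \oo, c <= u n) -> c <= limn_einf u.
Proof.
move=> h; rewrite /limn_einf leeNr; apply: limn_esup_le.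
by apply: filterS h => n /= h; rewrite leeN2.
Qed.

Lemma lne_div_le (p : \bar R) (c v : R) : (0 < v)%R -> p <= (expR (c * v))%:E ->
  0 <= p -> lne p / v%:E <= c%:E.
Proof.
move=> v0 pe p0; rewrite inver gt_eqF // lee_pdivrMr // -EFinM.
rewrite -[(c * v)%R]expRK -lne_EFin ?expR_gt0 //.
by rewrite lee_lne ?in_itv /= ?p0 ?leey // lee_fin expR_ge0.
Qed.

Lemma lne_div_ge (p : \bar R) (c v : R) : (0 < v)%R -> (expR (c * v))%:E <= p ->
  c%:E <= lne p / v%:E.
Proof.
move=> v0 pe; rewrite inver gt_eqF // lee_pdivlMr // -EFinM.
rewrite -[(c * v)%R]expRK -lne_EFin ?expR_gt0 //.
have p0 : 0 <= p by apply: le_trans pe; rewrite lee_fin expR_ge0.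
by rewrite lee_lne ?in_itv /= ?p0 ?leey // lee_fin expR_ge0.
Qed.

End limits_of_log_probabilities.

Section ldp_from_coordinates.
Context d0 (T : measurableType d0) (R : realType) (P : probability T R).
Variables (d : nat) (lambda : 'I_d -> R) (v : nat -> R).
Variables (Y : 'I_d -> nat -> T -> skorokhod R) (F : 'I_d -> set (set T)).
Hypothesis lambda0 : forall i, 0 < lambda i.
Hypothesis v_infty : v n @[n --> \oo] --> +oo.
Hypothesis indepF : mutually_independent P F.
Hypothesis F_sigma : forall i, sigma_algebra setT (F i).
Hypothesis F_measurable : forall i, F i `<=` measurable.
Hypothesis Y_F : forall i n (G : set (skorokhod R)), open G -> F i (Y i n @^-1` G).

Let Z n w : skorokhod_prod R d := fun i => Y i n w.

Hypothesis upper : forall i k (e eta : R), 0 < e -> 0 < eta -> \forall n \near \oo,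
  (P [set w | ~ exists2 zeta, steps k zeta & (dJ1 zeta (Y i n w) < e)%R]
     <= (expR (- ((lambda i * k.+1%:R - eta) * v n)))%:E)%E.

Hypothesis lower : forall i j xi (z t : 'I_j -> R) (e eta : R), strict_steps xi z t ->
  0 < e -> 0 < eta -> \forall n \near \oo,
  ((expR (- ((lambda i * j%:R + eta) * v n)))%:E <=
     P [set w | (dJ1 xi (Y i n w) < e)%R])%E.

Let open_ball i xi e n : F i [set w | dJ1 xi (Y i n w) < e].
Proof. exact: (Y_F i n (open_mball xi e)). Qed.

Let P_bigcap (A : 'I_d -> set T) : (forall i, F i (A i)) ->
  P (\bigcap_(i in [set: 'I_d]) A i) = (\prod_(i < d) P (A i))%E.
Proof.
move=> FA; have := @indepF [set: 'I_d]%SET A (fun i _ => FA i).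
rewrite (eq_bigl xpredT) /=; last by move=> i; rewrite finset.inE.
move=> <-; congr (P _); apply/seteqP.
by split=> w h i _; apply: h => //=; rewrite finset.inE.
Qed.

Let v_pos : \forall n \near \oo, 0 < v n.
Proof. by have /cvgryPgt := v_infty; apply. Qed.

Let mdist_prodE (x y : skorokhod_prod R d) : mdist x y = \sum_(i < d) dJ1 (x i) (y i).
Proof. by []. Qed.

(** Around a point of finite rate each coordinate is a step path, and the product of
    the balls of the coordinates lies in the open set. *)
Lemma ldp_lower_of_coordinates (G : set (skorokhod_prod R d)) : open G ->
  (forall n, measurable (Z n @^-1` G)) ->
  (- ereal_inf (I_prod lambda @` G) <=
    limn_einf (fun n => lne (P (Z n @^-1` G)) / (v n)%:E))%E.
Proof.
move=> /open_mdistP oG mG; rewrite leeNl; apply: le_ereal_inf_tmp => _ [x Gx <-].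
have [xoo|xfin] := pselect (exists i, I_J1 (lambda i) (x i) = +oo%E).
  case: xoo => i xi; apply: le_trans (leey _) _; rewrite /I_prod (bigD1 i) //= xi.
  have : (0 <= \sum_(k < d | k != i) I_J1 (lambda k) (x k))%E.
    by apply: sume_ge0 => k _; apply: I_J1_ge0; exact: ltW.
  by case: (\sum_(k < d | k != i) _)%E.
have /choice[j jP] i : exists j, exists (z t : 'I_j -> R), strict_steps (x i) z t /\
    I_J1 (lambda i) (x i) = (lambda i * j%:R)%:E.
  have [h|//] := I_J1_cases (lambda i) (x i); case: xfin; by exists i.
rewrite /I_prod; rewrite (eq_bigr (fun i => (lambda i * (j i)%:R)%:E)); last first.
  by move=> i _; have [z [t []]] := jP i.
rewrite sumEFin leeNl -EFinN; apply/lee_subgt0Pr => eta eta0.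
have [e e0 He] := oG _ Gx.
pose e' := e / d.+1%:R; have e'0 : 0 < e' by rewrite divr_gt0.
pose eta' := eta / d.+1%:R; have eta'0 : 0 < eta' by rewrite divr_gt0.
have dle (a : R) : 0 < a -> d%:R * (a / d.+1%:R) < a.
  by move=> a0; rewrite mulrCA gtr_pMr // ltr_pdivrMr // mul1r ltr_nat.
rewrite -EFinB; apply: limn_einf_ge.
have H : \forall n \near \oo, forall i : 'I_d,
   ((expR (- ((lambda i * (j i)%:R + eta') * v n)))%:E <=
     P [set w | (dJ1 (x i) (Y i n w) < e')%R])%E.
  apply: filter_forall => i; have [z [t [sx _]]] := jP i.
  exact: lower sx e'0 eta'0.
near=> n; have Hn : forall i : 'I_d, ((expR (- ((lambda i * (j i)%:R + eta') * v n)))%:E <=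
     P [set w | (dJ1 (x i) (Y i n w) < e')%R])%E by near: n.
have vn0 : 0 < v n by near: n.
apply: lne_div_ge => //.
apply: (@le_trans _ _ (P (\bigcap_(i in [set: 'I_d]) [set w | (dJ1 (x i) (Y i n w) < e')%R]))).
  rewrite P_bigcap; last by move=> i; exact: open_ball.
  apply: (@le_trans _ _ (\prod_(i < d) (expR (- ((lambda i * (j i)%:R + eta') * v n)))%:E)%E); last first.
    suff /andP[] : (0 <= \prod_(i < d) (expR (- ((lambda i * (j i)%:R + eta') * v n)))%:E <=
      \prod_(i < d) P [set w | (dJ1 (x i) (Y i n w) < e')%R])%E by [].
    apply: (big_ind2 (fun a b => (0 <= a <= b)%E)) => //.
    - by rewrite lexx lee_fin ler01.
    - move=> a b a' b' /andP[a0 ab] /andP[a'0 ab']; rewrite mule_ge0 //=.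
      exact: lee_pmul.
    - by move=> i _; rewrite lee_fin expR_ge0 /=.
  rewrite prodEFin lee_fin -expR_sum ler_expR sumrN -mulr_suml -mulNr.
  rewrite ler_wpM2r ?(ltW vn0) // big_split /= sumr_const card_ord -[eta' *+ d]mulr_natl.
  by have := dle _ eta0; rewrite -/eta'; lra.
apply: le_measure.
- rewrite inE; apply: fin_bigcap_measurable; first exact: finite_finset.
  by move=> i _; apply: F_measurable; exact: open_ball.
- by rewrite inE.
- move=> w Hw; apply: He; rewrite mdist_prodE.
  apply: (@le_lt_trans _ _ (\sum_(i < d) e')).
    by apply: ler_sum => i _; apply: ltW; exact: Hw.
  by rewrite sumr_const card_ord -[_ *+ d]mulr_natl dle.
Unshelve. all: by end_near. Qed.

Let near_steps i n e k := [set w | exists2 zeta, steps k zeta & (dJ1 zeta (Y i n w) < e)%R].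

Let near_steps_F i n e k : F i (near_steps i n e k).
Proof.
have := @Y_F i n [set xi | exists2 zeta, steps k zeta & (dJ1 zeta xi < e)%R].
apply; rewrite (_ : [set xi | _] = \bigcup_(zeta in steps k) [set xi | dJ1 zeta xi < e]).
  by apply: bigcup_open => zeta _; exact: open_mball.
by apply/seteqP; split=> xi [zeta a b]; exists zeta.
Qed.

(** The event that at least [k] jumps are needed to come [e]-close to the path *)
Let far_steps i n e k := if k is k'.+1 then ~` near_steps i n e k' else setT.

Let far_steps_F i n e k : F i (far_steps i n e k).
Proof.
have [F0 FC FU] := F_sigma i.
case: k => [|k] /=; last by rewrite -setTD; apply: FC; exact: near_steps_F.
by rewrite -(setD0 setT); apply: FC.
Qed.

(** The event is covered by the events that coordinate [i] needs at least [k i] jumps, over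
    the finitely many tuples [k] cut off at [K] whose total cost is at least [c]. A path
    whose minimal tuple is not cut off is close to a step path with these numbers of jumps,
    which then lies in the enlargement, so that its rate exceeds [c]; a coordinate that
    is cut off costs [c] by itself. *)
Lemma ldp_upper_of_coordinates (H : set (skorokhod_prod R d)) e : closed H ->
  (forall n, measurable (Z n @^-1` H)) -> 0 < e ->
  (limn_esup (fun n => lne (P (Z n @^-1` H)) / (v n)%:E) <=
   - ereal_inf (I_prod lambda @` enlargement H e))%E.
Proof.
move=> cH mH e0; set q := ereal_inf _.
have q0 : (0 <= q)%E.
  apply: le_ereal_inf_tmp => _ [x _ <-]; apply: sume_ge0 => i _.
  by apply: I_J1_ge0; exact: ltW.
suff main (c : R) : (c%:E < q)%E ->
    (limn_esup (fun n => lne (P (Z n @^-1` H)) / (v n)%:E) <= (- c)%:E)%E.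
  move: main; move: (limn_esup _) => L main; rewrite leeNr leNgt; apply/negP.
  case: L main => [r||] main; rewrite ?oppeK.
  - move: q0 main; case: q => [q||] // q0 main; rewrite -EFinN ?lte_fin.
      move=> rq; have := main ((q - r) / 2); rewrite lte_fin lee_fin; lra.
    by move=> _; have := main (1 - r) (ltry _); rewrite lee_fin; lra.
  - move=> _; have := main (-1); rewrite leNgt ltry /=.
    have -> // : ((-1)%:E < q)%E by apply: lt_le_trans q0; rewrite lte_fin; lra.
    by move=> /(_ isT).
  - by rewrite ltNge leey.
move=> cq; apply/lee_addgt0Pr => eta eta0.
have [l l_gt0 l_le] := finite_pos_lower_bound lambda0.
(* Needing [K] jumps in one coordinate already costs at least [c]. *)
pose K := (Num.truncn (c / l)).+1.
have KP i : c <= lambda i * K%:R.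
  apply: (@le_trans _ _ (l * K%:R)); last by rewrite ler_wpM2r.
  by rewrite mulrC -ler_pdivrMr // ltW // truncnS_gt.
pose e' := e / d.+1%:R; have e'0 : 0 < e' by rewrite divr_gt0.
have dle (a : R) : 0 < a -> d%:R * (a / d.+1%:R) <= a.
  by move=> a0; rewrite mulrCA ger_pMr // ler_pdivrMr // mul1r ler_nat.
pose eta' := eta / 2 / d.+1%:R; have eta'0 : 0 < eta' by rewrite !divr_gt0.
pose good (k : {ffun 'I_d -> 'I_K.+1}) := c <= \sum_(i < d) lambda i * (k i)%:R.
pose E n (k : {ffun 'I_d -> 'I_K.+1}) := \bigcap_(i in [set: 'I_d]) far_steps i n e' (k i).
have EF n k : measurable (E n k).
  apply: fin_bigcap_measurable; first exact: finite_finset.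
  by move=> i _; apply: F_measurable; exact: far_steps_F.
have cover n : Z n @^-1` H `<=` \big[setU/set0]_(k | good k) E n k.
  move=> w Hw; rewrite -bigcup_seq_cond.
  have /choice[k kP] i : exists k : 'I_K.+1, far_steps i n e' k w /\
      (k = K :> nat \/ near_steps i n e' k w).
    have ex : exists k, (k == K) || `[< near_steps i n e' k w >] by exists K; rewrite eqxx.
    have kK : (ex_minn ex < K.+1)%N.
      by case: ex_minnP => k _ kmin; rewrite ltnS; apply: kmin; rewrite eqxx.
    exists (Ordinal kK) => /=; case: ex_minnP => k kP kmin; split.
      case: k kP kmin => // k _ kmin /= nk.
      have := kmin k; rewrite ltnn; move/(_ _)/Bool.diff_false_true; apply.
      by apply/orP; right; apply/asboolP.
    by move/orP: kP => [/eqP|/asboolP]; [left|right].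
  exists [ffun i => k i] => /=; last by move=> i _; rewrite ffunE; exact: (kP i).1.
  rewrite mem_index_enum /good /=.
  under eq_bigr do rewrite ffunE.
  have [[i ki]|/forallNP nK] := pselect (exists i, k i = K :> nat).
    rewrite (bigD1 i) //= ki; apply: (le_trans (KP i)); rewrite lerDl.
    by apply: sumr_ge0 => j _; rewrite mulr_ge0 // ltW.
  have /choice[zeta zP] i : exists zeta, steps (k i) zeta /\ dJ1 zeta (Y i n w) < e'.
    by have [_ [/nK//|[zeta a b]]] := kP i; exists zeta.
  rewrite -lee_fin; apply: (le_trans (ltW cq)).
  apply: (@le_trans _ _ (I_prod lambda zeta)).
    apply: ereal_inf_lbound; exists zeta => //=.
    apply: ge_ereal_inf; exists (mdist (zeta : skorokhod_prod R d) (Z n w))%:E.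
      by exists (Z n w).
    rewrite lee_fin mdist_prodE; apply: (le_trans _ (dle _ e0)).
    apply: (@le_trans _ _ (\sum_(i < d) e')).
      by apply: ler_sum => i _; apply: ltW; exact: (zP i).2.
    by rewrite sumr_const card_ord mulr_natl.
  rewrite /I_prod -sumEFin; apply: lee_sum => i _.
  apply: I_J1_steps_le; first exact: ltW.
  exact: (zP i).1.
have PE n : (P (Z n @^-1` H) <= \sum_(k | good k) P (E n k))%E.
  suff [mU PU] : measurable (\big[setU/set0]_(k | good k) E n k) /\
      (P (\big[setU/set0]_(k | good k) E n k) <= \sum_(k | good k) P (E n k))%E.
    by apply: le_trans PU; apply: le_measure; rewrite ?inE.
  apply: (big_ind2 (fun A s => measurable A /\ (P A <= s)%E)).
  - by rewrite measure0.
  - move=> A s B s' [mA As] [mB Bs]; split; first exact: measurableU.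
    by apply: (@le_trans _ _ (P A + P B)%E); [exact: measureU2|exact: leeD].
  - by move=> k _.
have far : \forall n \near \oo, forall ik : 'I_d * 'I_K.+1,
    (P (far_steps ik.1 n e' ik.2) <=
    (expR (- ((lambda ik.1 * ik.2%:R - eta') * v n)))%:E)%E.
  apply: filter_forall => -[i [[|k] kK]] /=.
    near=> n; rewrite probability_setT lee_fin -expR0 ler_expR mulr0 sub0r.
    have vn0 : 0 < v n by near: n.
    by rewrite mulNr opprK mulr_ge0 // ltW.
  exact: (@upper i k e' eta' e'0 eta'0).
(* The number of tuples, a constant factor that is negligible at the scale of [v n] *)
pose N := (\sum_(k | good k) (1 : R)).
rewrite -EFinD; apply: limn_esup_le; near=> n.
have vn0 : 0 < v n by near: n.
have vN : 2 / eta * ln (N + 1) < v n.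
  by near: n; have /cvgryPgt := v_infty; apply.
have far_n (ik : 'I_d * 'I_K.+1) : (P (far_steps ik.1 n e' ik.2) <=
    (expR (- ((lambda ik.1 * ik.2%:R - eta') * v n)))%:E)%E.
  by move: ik; near: n.
apply: lne_div_le => //.
apply: (le_trans (PE n)).
have N0 : 0 <= N by apply: sumr_ge0.
apply: (@le_trans _ _ (\sum_(k | good k) (expR ((- c + eta / 2) * v n))%:E)%E).
  apply: lee_sum => k gk; rewrite P_bigcap; last by move=> i; exact: far_steps_F.
  apply: (@le_trans _ _ (\prod_(i < d) (expR (- ((lambda i * (k i)%:R - eta') * v n)))%:E)%E).
    suff /andP[] : (0 <= \prod_(i < d) P (far_steps i n e' (k i)) <=
      \prod_(i < d) (expR (- ((lambda i * (k i)%:R - eta') * v n)))%:E)%E by [].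
    apply: (big_ind2 (fun a b => (0 <= a <= b)%E)) => //.
    - by rewrite lexx lee_fin ler01.
    - move=> a b a' b' /andP[a0 ab] /andP[a'0 ab']; rewrite mule_ge0 //=.
      exact: lee_pmul.
    - by move=> i _; rewrite measure_ge0 /=; exact: (far_n (i, k i)).
  rewrite prodEFin lee_fin -expR_sum ler_expR sumrN -mulr_suml -mulNr.
  rewrite ler_wpM2r ?(ltW vn0) // sumrB sumr_const card_ord -[eta' *+ d]mulr_natl.
  have eta20 : 0 < eta / 2 by rewrite divr_gt0.
  by have := dle _ eta20; rewrite -/eta'; move: gk; rewrite /good; lra.
rewrite sumEFin lee_fin -[X in (\sum_(_ | _) X)]mul1r -mulr_suml -/N.
apply: (@le_trans _ _ (expR (ln (N + 1)) * expR ((- c + eta / 2) * v n))).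
  by rewrite ler_wpM2r ?expR_ge0 // lnK ?posrE; lra.
rewrite -expRD ler_expR.
have : ln (N + 1) <= eta / 2 * v n.
  by rewrite -ler_pdivrMl ?divr_gt0 // invf_div ltW.
by rewrite !mulrDl; lra.
Unshelve. all: by end_near. Qed.

Lemma enlargement_inf_cvg (I : skorokhod_prod R d -> \bar R) H :
  cvg (ereal_inf (I @` enlargement H e) @[e --> 0^'+]).
Proof.
apply: nonincreasing_at_right_is_cvge; near=> x => e1 e2 _ _ e12.
apply: ereal_inf_le_tmp; apply: image_subset => y /= /le_trans; apply.
by rewrite lee_fin.
Unshelve. all: by end_near. Qed.

Theorem extended_LDP_of_coordinates :
  (forall n, random_element (Z n)) -> extended_LDP P Z (I_prod lambda) v.
Proof.
move=> mZ; split => //.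
- exact: I_prod_rate_function.
- by move=> G oG; apply: ldp_lower_of_coordinates => // n; exact: mZ.
- move=> H cH; rewrite leeNr; apply: lime_le; first exact: enlargement_inf_cvg.
  near=> e; rewrite leeNr; apply: ldp_upper_of_coordinates => //.
  move=> n; rewrite -[H]setCK preimage_setC; apply: measurableC.
  by have := mZ n (~` H); apply; rewrite openC.
Unshelve. all: by end_near. Qed.

End ldp_from_coordinates.

(** * Independent families *)

Section independence_of_generated.
Context d (T : measurableType d) (R : realType) (P : probability T R).
Implicit Types (A B : set T) (C D : set (set T)).
Local Open Scope ereal_scope.

Lemma sigma_algebra_setI C : sigma_algebra setT C -> setI_closed C.
Proof.
move=> sC A B; rewrite -(sigma_algebra_id sC) => CA CB.
exact: (@measurableI _ (g_sigma_algebraType C)).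
Qed.

Lemma generated_measurable C : C `<=` measurable -> <<s C >> `<=` measurable.
Proof. by move=> CM; apply: smallest_sub => //; exact: sigma_algebra_measurable. Qed.

Lemma product_rule_generated C B : C `<=` measurable -> setI_closed C ->
  measurable B -> (forall A, C A -> P (A `&` B) = P A * P B) ->
  forall A, <<s C >> A -> P (A `&` B) = P A * P B.
Proof.
move=> CM CI mB CB A sA.
suff: <<s C >> `<=` [set A | measurable A /\ P (A `&` B) = P A * P B].
  by move=> /(_ _ sA)[].
apply: lambda_system_subset => //; last by move=> E CE; split; [exact: CM|exact: CB].
apply/dynkin_lambda_system; split.
- by split=> //; rewrite setTI probability_setT mul1e.
- move=> E [mE EB]; split; first exact: measurableC.
  have h : P B = P (B `\` E) + P (B `&` E) by exact: measureDI.
  rewrite probability_setC // setIC -setDE.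
  move: h; rewrite (setIC B E) EB.
  have fin X : measurable X -> exists x, P X = x%:E.
    by move=> mX; exists (fine (P X)); rewrite fineK // fin_num_measure.
  have [b ->] := fin _ mB; have [e ->] := fin _ mE.
  have [x ->] := fin _ (measurableD mB mE).
  rewrite -EFinM -EFinD -EFinB -EFinM => -[h].
  by congr (_%:E); lra.
- move=> F tF FE; split; first by apply: bigcup_measurable => k _; exact: (FE k).1.
  rewrite setI_bigcupl measure_bigcup //; last first.
  + by apply: trivIset_setIr.
  + by move=> k _; apply: measurableI => //; exact: (FE k).1.
  rewrite measure_bigcup //; last by move=> k _; exact: (FE k).1.
  have bE : P B = (fine (P B))%:E by rewrite fineK // fin_num_measure.
  rewrite muleC bE -nneseriesZl //.
  by apply: eq_eseriesr => k _ /=; rewrite (FE k).2 muleC bE.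
Qed.

Lemma independent_generated C D : C `<=` measurable -> D `<=` measurable ->
  setI_closed C -> setI_closed D ->
  (forall A B, C A -> D B -> P (A `&` B) = P A * P B) ->
  independent P <<s C >> <<s D >>.
Proof.
move=> CM DM CI DI H A B sA sB.
apply: (product_rule_generated CM CI) => //; first exact: generated_measurable sB.
move=> A' CA'; rewrite setIC muleC.
apply: (product_rule_generated DM DI) => //; first exact: CM.
by move=> B' DB'; rewrite setIC muleC; exact: H.
Qed.

Lemma independent_sub C C' D D' : C' `<=` C -> D' `<=` D ->
  independent P C D -> independent P C' D'.
Proof. by move=> CC DD H A B /CC hA /DD hB; exact: H. Qed.

Variables (I : finType) (F : I -> set (set T)).
Hypothesis indF : mutually_independent P F.
Hypothesis F_sigma : forall i, sigma_algebra setT (F i).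
Hypothesis F_meas : forall i, F i `<=` measurable.

Definition joint (J : {set I}) : set (set T) := <<s \bigcup_(i in [set` J]) F i >>.

Let cyl (J : {set I}) : set (set T) := [set A | exists2 E : I -> set T,
  (forall i, F i (E i)) & A = \bigcap_(i in [set` J]) E i].

Let FT i : F i setT.
Proof. by have [F0 FC FU] := F_sigma i; rewrite -(setD0 setT); apply: FC. Qed.

Let cyl_meas J : cyl J `<=` measurable.
Proof.
move=> _ [E FE ->]; apply: fin_bigcap_measurable; first exact: finite_finset.
by move=> i _; exact/F_meas/FE.
Qed.

Let cyl_setI J : setI_closed (cyl J).
Proof.
move=> _ _ [E FE ->] [E' FE' ->]; exists (fun i => E i `&` E' i).
  by move=> i; apply: (sigma_algebra_setI (F_sigma i)).
by apply/seteqP; split=> w; [move=> [h h'] i Ji; split; [exact: h|exact: h']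
  |move=> h; split=> i Ji; case: (h i Ji)].
Qed.

Let joint_cyl J : joint J `<=` <<s cyl J >>.
Proof.
apply: smallest_sub; first exact: smallest_sigma_algebra.
move=> A [i Ji FA]; apply: sub_sigma_algebra.
exists (fun k => if k == i then A else setT).
  by move=> k; case: eqP => [->|_].
apply/seteqP; split=> w h; first by move=> k _; case: eqP.
by have := h i Ji; rewrite /= eqxx.
Qed.

(** The cylinders [cyl J] form a pi-system generating [joint J], and the product rule holds
    for them by definition of mutual independence. *)
Lemma independent_joint (J J' : {set I}) : (forall i, i \in J -> i \notin J') ->
  independent P (joint J) (joint J').
Proof.
move=> JJ'; apply: (independent_sub (@joint_cyl J) (@joint_cyl J')).
apply: independent_generated => //.
move=> _ _ [E FE ->] [E' FE' ->].
rewrite !indF //.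
pose G i := if i \in J then E i else E' i.
have -> : \bigcap_(i in [set` J]) E i `&` \bigcap_(i in [set` J']) E' i =
    \bigcap_(i in [set` (finset.setU J J')]) G i.
  apply/seteqP; split=> w.
    move=> [h h'] i /=; rewrite /G finset.in_setU.
    by case: ifP => [Ji _|_ J'i]; [exact: h|exact: h'].
  move=> h; split=> i /= Ji; have := h i; rewrite /= finset.in_setU Ji ?orbT /G.
    by rewrite Ji; exact.
  case: ifPn => [Ji'|_]; last exact.
  by move: (JJ' _ Ji'); rewrite Ji.
rewrite indF; last by move=> i _; rewrite /G; case: ifP.
rewrite (eq_bigl (fun i => (i \in J) || (i \in J'))); last by move=> i; rewrite finset.in_setU.
rewrite [LHS](bigID (fun i => i \in J)) /=; congr (_ * _); apply: eq_big => i.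
- by case: (i \in J); rewrite ?andbF.
- by move=> /andP[_ Ji]; rewrite /G Ji.
- by case: (boolP (i \in J)) => [/JJ'/negbTE ->|_]; rewrite ?andbF ?andbT.
- by move=> /andP[_ /negbTE Ji]; rewrite /G Ji.
Qed.

Lemma sub_joint (J : {set I}) i : i \in J -> F i `<=` joint J.
Proof. by move=> Ji A FA; apply: sub_sigma_algebra; exists i. Qed.

End independence_of_generated.

Section independent_expectation.
Context d (T : measurableType d) (R : realType) (P : probability T R).
Local Open Scope ereal_scope.

Lemma expectation_product_of_independent (f g : T -> R) :
  measurable_fun setT f -> measurable_fun setT g ->
  (forall w, 0 <= f w)%R -> (forall w, 0 <= g w)%R ->
  (forall A B, measurable A -> measurable B ->
    P (f @^-1` A `&` g @^-1` B) = P (f @^-1` A) * P (g @^-1` B)) ->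
  \int[P]_w (f w * g w)%:E = (\int[P]_w (f w)%:E) * (\int[P]_w (g w)%:E).
Proof.
move=> mf mg f0 g0 ind.
have mfg : measurable_fun setT (fun w => (f w, g w)) by exact: measurable_fun_pair.
pose F : {mfun T >-> R} := mfun_Sub (mem_set mf).
pose G : {mfun T >-> R} := mfun_Sub (mem_set mg).
pose H : {mfun T >-> (R * R)%type} := mfun_Sub (mem_set mfg).
pose mu1 : {sigma_finite_measure set _ -> \bar R} := distribution P F.
pose mu2 : {sigma_finite_measure set _ -> \bar R} := distribution P G.
pose mu : {measure set _ -> \bar R} := distribution P H.
pose abs2 (z : R * R) := (`|z.1| * `|z.2|)%:E : \bar R.
have mabs2 : measurable_fun setT abs2.
  apply/measurable_EFinP; apply: measurable_funM.
    exact: (measurableT_comp (@normr_measurable _ _) measurable_fst).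
  exact: (measurableT_comp (@normr_measurable _ _) measurable_snd).
transitivity (\int[mu]_z abs2 z).
  rewrite ge0_integral_distribution //; last by move=> z; rewrite lee_fin mulr_ge0.
  by apply: eq_integral => w _ /=; rewrite /abs2 /= !ger0_norm.
transitivity (\int[(mu1 \x mu2)%E]_z abs2 z).
  apply: eq_measure_integral => A mA _; apply/esym.
  by apply: product_measure_unique.
have nn (x : R) : 0 <= `|x|%:E by rewrite lee_fin.
have mabs : measurable_fun setT (fun x : R => `|x|%:E).
  by apply/measurable_EFinP; exact: normr_measurable.
have intE (h : T -> R) (mh : measurable_fun setT h) : (forall w, 0 <= h w)%R ->
    \int[distribution P (mfun_Sub (mem_set mh) : {mfun T >-> R})]_x `|x|%:E = \int[P]_w (h w)%:E.
  move=> h0; rewrite ge0_integral_distribution //.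
  by apply: eq_integral => w _ /=; rewrite ger0_norm.
rewrite fubini_tonelli1 //; last by move=> z; rewrite lee_fin mulr_ge0.
rewrite /fubini_F /abs2 /=.
under eq_integral => x _.
  under eq_integral => y _ do rewrite EFinM.
  rewrite ge0_integralZl //.
  over.
rewrite ge0_integralZr //; last by apply: integral_ge0.
by rewrite (intE _ mf) // (intE _ mg).
Qed.

End independent_expectation.

Section measurable_bigops.
Context d (T : measurableType d) (R : realType) (I : eqType).

Lemma measurable_fun_bigprod (r : seq I) (h : I -> T -> R) :
  {in r, forall i, measurable_fun setT (h i)} ->
  measurable_fun setT (fun w => \prod_(i <- r) h i w).
Proof.
elim: r => [_|i r IH mh].
  rewrite (_ : (fun w => _) = cst 1) //; last by apply/funext => w; rewrite big_nil.
rewrite (_ : (fun w => _) = (fun w => h i w * \prod_(i <- r) h i w)); last first.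
  by apply/funext => w; rewrite big_cons.
apply: measurable_funM; first by apply: mh; rewrite inE eqxx.
by apply: IH => k kr; apply: mh; rewrite inE kr orbT.
Qed.

Lemma measurable_fun_bigsum (r : seq I) (h : I -> T -> R) :
  {in r, forall i, measurable_fun setT (h i)} ->
  measurable_fun setT (fun w => \sum_(i <- r) h i w).
Proof.
elim: r => [_|i r IH mh].
  rewrite (_ : (fun w => _) = cst 0) //; last by apply/funext => w; rewrite big_nil.
rewrite (_ : (fun w => _) = (fun w => h i w + \sum_(i <- r) h i w)); last first.
  by apply/funext => w; rewrite big_cons.
apply: measurable_funD; first by apply: mh; rewrite inE eqxx.
by apply: IH => k kr; apply: mh; rewrite inE kr orbT.
Qed.

End measurable_bigops.

Section independent_family.
Context d (T : measurableType d) (R : realType) (P : probability T R).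
Variables (I : finType) (F : I -> set (set T)).
Hypothesis indF : mutually_independent P F.
Hypothesis F_sigma : forall i, sigma_algebra setT (F i).
Hypothesis F_meas : forall i, F i `<=` measurable.
Local Open Scope ereal_scope.

Lemma preimage_measurable_fun (G : set (set T)) (f : T -> R) :
  measurable_fun setT (f : g_sigma_algebraType G -> R) ->
  forall B, measurable B -> <<s G >> (f @^-1` B).
Proof. by move=> mf B mB; have := mf measurableT B mB; rewrite setTI. Qed.

Lemma measurable_fun_preimage (G : set (set T)) (f : T -> R) :
  (forall B, measurable B -> <<s G >> (f @^-1` B)) ->
  measurable_fun setT (f : g_sigma_algebraType G -> R).
Proof. by move=> h _ B mB; rewrite setTI; exact: h. Qed.

Lemma expectation_prod_of_mutually_independent (f : I -> T -> R) :
  (forall i w, 0 <= f i w)%R ->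
  (forall i B, measurable B -> F i (f i @^-1` B)) ->
  forall r : seq I, uniq r ->
  \int[P]_w (\prod_(i <- r) f i w)%:E = \prod_(i <- r) \int[P]_w (f i w)%:E.
Proof.
move=> f0 Ff; have mf i : measurable_fun setT (f i).
  by move=> _ B mB; rewrite setTI; apply: F_meas; exact: Ff.
elim=> [_|i r IH /= /andP[ir ur]].
  under eq_integral do rewrite big_nil.
  by rewrite big_nil (@integral_cst _ _ _ P _ _ 1%E) // mul1e; exact: probability_setT.
under eq_integral do rewrite big_cons.
rewrite big_cons -IH //.
pose J := [set k in r]%SET.
pose G := \bigcup_(k in [set` J]) F k.
have mr : measurable_fun setT (fun w : g_sigma_algebraType G => \prod_(k <- r) f k w)%R.
  apply: (@measurable_fun_bigprod _ (g_sigma_algebraType G)) => k kr.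
  apply: measurable_fun_preimage => B mB; apply: sub_sigma_algebra.
  by exists k; [rewrite /= finset.inE|exact: Ff].
apply: (expectation_product_of_independent (mf i) _ (f0 i)).
- by apply: measurable_fun_bigprod => k _; exact: mf.
- by move=> w; apply: prodr_ge0.
- move=> A B mA mB.
  apply: (@independent_joint _ _ _ P I F indF F_sigma F_meas [set i]%SET J).
  + by move=> k; rewrite finset.inE => /eqP ->; rewrite finset.inE.
  + by apply: sub_joint; [rewrite finset.inE|exact: Ff].
  + exact: (preimage_measurable_fun mr).
Qed.

End independent_family.

(** * Ottaviani's inequality *)

Section ottaviani.
Context d (T : measurableType d) (R : realType) (P : probability T R).
Local Open Scope ereal_scope.

(** At the first index where the partial sums exceed [2 * x], the remaining increment is
    independent of the past and stays below [x] with probability at least 1/2, which leaves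
    the final sum above [x]. Independence is stated between each
    first-passage event and the increment that follows it, the form shared by Poisson sums
    and Brownian motion. *)
Lemma ottaviani m (S : nat -> T -> R) (x : R) :
  (forall k, measurable_fun setT (S k)) ->
  (forall k, (k <= m)%N ->
    let A := seqDU (fun k => [set w | 2 * x < `|S k w|]%R) k in
    let B := [set w | `|S m w - S k w| <= x]%R in
    P (A `&` B) = P A * P B) ->
  (forall k, (k <= m)%N -> P [set w | x < `|S m w - S k w|]%R <= (2^-1)%:E) ->
  P (\bigcup_(k < m.+1) [set w | 2 * x < `|S k w|]%R) <=
    2%:E * P [set w | x < `|S m w|]%R.
Proof.
move=> mS ind half.
pose E k := [set w | 2 * x < `|S k w|]%R.
have mltS (f : T -> R) (c : R) : measurable_fun setT f -> measurable [set w | c < `|f w|]%R.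
  move=> mf; rewrite -[X in measurable X]setTI.
  by apply: (measurable_fun_ltr (measurable_cst _)) => //; exact: measurableT_comp.
have mE k : measurable (E k) by exact: mltS.
pose A := seqDU E.
have mA k : measurable (A k) by exact: seqDU_measurable.
pose B k := [set w | `|S m w - S k w| <= x]%R.
have BC k : B k = ~` [set w | x < `|S m w - S k w|]%R.
  by apply/seteqP; split=> w; rewrite /B /= leNgt => /negP.
have mB k : measurable (B k).
  by rewrite BC; apply: measurableC; apply: mltS; exact: measurable_funB.
have -> : \bigcup_(k < m.+1) E k = \big[setU/set0]_(k < m.+1) A k.
  by rewrite -bigsetU_seqDU bigcup_mkord.
have tA : trivIset setT A by exact: trivIset_seqDU.
rewrite measure_semi_additive_ord //; last 2 first.
- by move=> i j _ _ h; apply: val_inj; exact: (tA i j I I h).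
- by apply: bigsetU_measurable => k _.
apply: (@le_trans _ _ (2%:E * \sum_(k < m.+1) P (A k `&` B k))).
  rewrite ge0_sume_distrr //; apply: lee_sum => k _.
  have km : (k <= m)%N by rewrite -ltnS.
  rewrite (ind k km) muleCA -[leLHS]mule1; apply: lee_wpmul2l => //.
  have := half k km.
  rewrite -/(B k) BC probability_setC; last by apply: mltS; exact: measurable_funB.
  have [p ->] : exists p, P [set w | x < `|S m w - S k w|]%R = p%:E.
    exists (fine (P [set w | x < `|S m w - S k w|]%R)).
    by rewrite fineK // fin_num_measure //; apply: mltS; exact: measurable_funB.
  by rewrite -EFinB -EFinM !lee_fin; lra.
apply: lee_wpmul2l => //.
rewrite -measure_semi_additive_ord //.
- apply: le_measure; rewrite ?inE.
  + by apply: bigsetU_measurable => k _; exact: measurableI.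
  + exact: mltS.
  + rewrite -(bigcup_mkord _ (fun k => A k `&` B k)) => w [k /= _ [[Ek _] Bk]].
    move: Ek Bk; rewrite /E /B /= => Ek Bk.
    have := ler_normD (S m w) (S k w - S m w)%R; rewrite subrKC (distrC (S k w)); lra.
- by move=> k; exact: measurableI.
- by apply: trivIset_setIr; move=> i j _ _ h; apply: val_inj; exact: (tA i j I I h).
- by apply: bigsetU_measurable => k _; exact: measurableI.
Qed.

End ottaviani.

(** * Poisson variables and their compensated sums *)

Section poisson_weights.
Variable R : realType.
Implicit Types (mu : R).

Definition poisson_weight mu k : R := mu ^+ k / k`!%:R * expR (- mu).

Lemma poisson_weight_ge0 mu k : 0 <= mu -> 0 <= poisson_weight mu k.
Proof. by move=> mu0; rewrite !mulr_ge0 ?exprn_ge0 ?invr_ge0 ?expR_ge0. Qed.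

Lemma poisson_prob_set1 mu k : 0 <= mu ->
  poisson_prob mu 0 [set k] = (poisson_weight mu k)%:E.
Proof.
rewrite le_eqVlt /poisson_prob /poisson_weight => /orP[/eqP <-|mu0].
  rewrite ltxx diracE oppr0 expR0 mulr1; congr (_%:E).
  case: k => [|k]; first by rewrite mem_set // expr0 fact0 divr1.
  by rewrite memNset //= expr0n mul0r.
rewrite mu0 esum_set1; last by rewrite lee_fin poisson_pmf_ge0.
by rewrite /poisson_pmf mu0.
Qed.

Lemma poisson_weight_sum mu : 0 <= mu ->
  (\sum_(k <oo) (poisson_weight mu k)%:E = 1)%E.
Proof.
move=> mu0; rewrite -(@probability_setT _ _ _ (poisson_prob mu 0)).
have -> : [set: nat] = \bigcup_k [set k].
  by apply/seteqP; split=> k // _; exists k.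
rewrite measure_bigcup //; last by move=> i j _ _ [k [-> ->]].
rewrite [RHS](eq_eseriesl _ (Q := xpredT)); last by move=> i; rewrite in_setT.
by apply: eq_eseriesr => k _; apply/esym; exact: poisson_prob_set1.
Qed.

Lemma poisson_weight_shift mu i k : 0 <= mu ->
  poisson_weight mu (i + k) <= mu ^+ k * poisson_weight mu i.
Proof.
move=> mu0; rewrite /poisson_weight mulrA ler_wpM2r ?expR_ge0 // exprD [mu ^+ i * _]mulrC -mulrA.
rewrite ler_wpM2l ?exprn_ge0 // ler_wpM2l ?exprn_ge0 //.
rewrite lef_pV2 ?posrE ?ltr0n ?fact_gt0 // ler_nat.
elim: k => [|k IH]; first by rewrite addn0.
by rewrite addnS factS (leq_trans IH) // leq_pmull.
Qed.

(** Exponential tilting turns a Poisson law into another one; summing over [k] gives the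
    moment generating function. *)
Lemma poisson_weight_tilt mu u k :
  expR (u * k%:R) * poisson_weight mu k =
  expR (mu * (expR u - 1)) * poisson_weight (mu * expR u) k.
Proof.
rewrite /poisson_weight exprMn.
have -> : expR (- mu) = expR (mu * (expR u - 1)) * expR (- (mu * expR u)).
  by rewrite -expRD; congr expR; lra.
have -> : expR (u * k%:R) = expR u ^+ k by rewrite mulrC expRM_natl.
move: (expR (mu * _)) (expR (- _)) (expR u ^+ k) (mu ^+ k) (k`!%:R^-1) => a b c e f.
lra.
Qed.

End poisson_weights.

Section poisson_variables.
Context d (T : measurableType d) (R : realType) (P : probability T R).
Variables (K : T -> \bar R) (mu : R).
Hypothesis mK : measurable_fun setT K.
Hypothesis mu0 : 0 <= mu.
Hypothesis K_poisson : forall k : nat, P [set w | K w = (k%:R)%:E] = poisson_prob mu 0 [set k].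
Local Open Scope ereal_scope.

Let level (k : nat) := [set w | K w = (k%:R)%:E].

Let mlevel k : measurable (level k).
Proof.
have := mK measurableT (emeasurable_set1 (k%:R%:E : \bar R)).
by rewrite setTI.
Qed.

Let tlevel : trivIset setT level.
Proof.
move=> i j _ _ [w [Ki Kj]]; have := Ki; rewrite /level /= (Kj : K w = _) => -[] /eqP.
by rewrite eqr_nat eq_sym => /eqP.
Qed.

Let P_level k : P (level k) = (poisson_weight mu k)%:E.
Proof. by rewrite K_poisson poisson_prob_set1. Qed.

Definition integer_valued := \bigcup_k level k.

Lemma integer_valued_measurable : measurable integer_valued.
Proof. exact: bigcupT_measurable. Qed.

Lemma poisson_integer_valued : P (~` integer_valued) = 0.
Proof.
rewrite probability_setC; last exact: integer_valued_measurable.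
rewrite measure_bigcup // (eq_eseriesl _ (Q := xpredT)); last by move=> i; rewrite in_setT.
rewrite (eq_eseriesr (fun k _ => P_level k)) poisson_weight_sum // subee //.
Qed.

(** The weight at [i + k] is at most [mu ^ k] times the weight at [i], and the latter sum
    to 1. *)
Lemma poisson_tail k : P [set w | forall i, (i < k)%N -> K w <> (i%:R)%:E] <= (mu ^+ k)%:E.
Proof.
have mA : measurable [set w | forall i, (i < k)%N -> K w <> (i%:R)%:E].
  rewrite (_ : [set w | _] = ~` \bigcup_(i < k) level i).
    by apply: measurableC; apply: bigcup_measurable.
  apply/seteqP; split=> w h; first by move=> [i /= ik Ki]; exact: h ik Ki.
  by move=> i ik Ki; apply: h; exists i.
have mB : measurable (\bigcup_i level (i + k)%N) by exact: bigcupT_measurable.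
apply: (@le_trans _ _ (P (~` integer_valued `|` \bigcup_i level (i + k)%N))).
  apply: le_measure; rewrite ?inE //.
    by apply: measurableU => //; apply: measurableC; exact: integer_valued_measurable.
  move=> w h; have [[i _ Ki]|] := pselect (integer_valued w); last by left.
  right; have [ik|ki] := ltnP i k; first by case: (h i ik).
  by exists (i - k)%N => //; rewrite subnK.
apply: (@le_trans _ _ (P (~` integer_valued) + P (\bigcup_i level (i + k)%N))).
  by apply: measureU2 => //; apply: measurableC; exact: integer_valued_measurable.
rewrite [X in X + _]poisson_integer_valued add0e measure_bigcup //; last first.
  by move=> i j _ _ /tlevel h; apply/eqP; rewrite -(eqn_add2r k); apply/eqP; exact: h.
rewrite (eq_eseriesl _ (Q := xpredT)); last by move=> i; rewrite in_setT.
apply: (@le_trans _ _ (\sum_(i <oo) (mu ^+ k)%:E * (poisson_weight mu i)%:E)).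
  apply: lee_nneseries => // i _; rewrite [X in (X <= _)%E]P_level -EFinM lee_fin.
  exact: poisson_weight_shift.
rewrite nneseriesZl ?poisson_weight_sum ?mule1 // => i _.
by rewrite lee_fin poisson_weight_ge0.
Qed.

Lemma poisson_mgf u :
  \int[P]_w (expR (u * fine (K w)))%:E = (expR (mu * (expR u - 1)))%:E.
Proof.
have mf : measurable_fun setT (fun w => (expR (u * fine (K w)))%:E).
  apply/measurable_EFinP; apply: measurableT_comp => //.
  by apply: measurable_funM => //; apply: measurableT_comp.
have mI := integer_valued_measurable.
rewrite (@ge0_negligible_integral _ _ _ P setT (~` integer_valued)) //.
- rewrite setTD setCK ge0_integral_bigcup //; last exact: measurable_funTS.
  transitivity (\sum_(k <oo) (expR (mu * (expR u - 1)))%:E *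
      (poisson_weight (mu * expR u) k)%:E); last first.
    rewrite nneseriesZl; last by move=> k _; rewrite lee_fin poisson_weight_ge0 // mulr_ge0 // expR_ge0.
    by rewrite poisson_weight_sum ?mule1 // mulr_ge0 // expR_ge0.
  apply: eq_eseriesr => k _; rewrite -EFinM -poisson_weight_tilt.
  rewrite (eq_integral (fun=> (expR (u * k%:R))%:E)); last first.
    by move=> w; rewrite inE => ->.
  by rewrite integral_cst // EFinM -P_level.
- exact: measurableC.
- exact: poisson_integer_valued.
Qed.

End poisson_variables.

Section exponential_bounds.
Variable R : realType.
Implicit Types (z : R).

Lemma expR_quadratic z : z <= 2^-1 -> expR z - 1 - z <= 2 * z ^+ 2.
Proof.
move=> z1; have h : 1 - z <= expR (- z) by have := expR_ge1Dx (- z).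
have p : 0 < 1 - z by lra.
have : expR z <= (1 - z)^-1.
  by rewrite -[expR z]invrK -expRN lef_pV2 // posrE expR_gt0.
have : (1 - z)^-1 <= 1 + z + 2 * z ^+ 2.
  rewrite -[leLHS]mul1r ler_pdivrMr //.
  suff : 0 <= z ^+ 2 * (1 - 2 * z) by rewrite !expr2; lra.
  by rewrite mulr_ge0 ?sqr_ge0 //; lra.
lra.
Qed.

End exponential_bounds.

Section poisson_chernoff.
Context d (T : measurableType d) (R : realType) (P : probability T R).
Variables (I : finType) (K : I -> T -> \bar R) (mu : I -> R).
Hypothesis mK : forall i, measurable_fun setT (K i).
Hypothesis mu0 : forall i, 0 <= mu i.
Hypothesis K_poisson : forall i (k : nat),
  P [set w | K i w = (k%:R)%:E] = poisson_prob (mu i) 0 [set k].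
Hypothesis indK : mutually_independent P (fun i => g_sigma_algebra_preimage (K i)).

Definition compensated_sum (y : I -> R) w := \sum_i y i * (fine (K i w) - mu i).

Lemma compensated_sum_measurable y : measurable_fun setT (compensated_sum y).
Proof.
apply: measurable_fun_bigsum => i _; apply: measurable_funM => //.
by apply: measurable_funB => //; exact: measurableT_comp.
Qed.

Lemma preimage_sigma_algebra (X : T -> \bar R) :
  sigma_algebra setT (g_sigma_algebra_preimage X).
Proof. by apply: sigma_algebra_preimage; exact: sigma_algebra_measurable. Qed.

Lemma preimage_sigma_measurable (X : T -> \bar R) : measurable_fun setT X ->
  g_sigma_algebra_preimage X `<=` measurable.
Proof. by move=> mX _ [B mB <-]; exact: mX. Qed.

(** Markov's inequality for the exponential, whose expectation factorizes. *)
Lemma chernoff_compensated_sum y x :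
  (P [set w | (x <= compensated_sum y w)%R] <=
   (expR (- x + \sum_i mu i * (expR (y i) - 1 - y i)))%:E)%E.
Proof.
pose f i w := expR (y i * (fine (K i w) - mu i)).
have mfi i : measurable_fun setT (fun t : \bar R => expR (y i * (fine t - mu i))).
  apply: measurableT_comp => //; apply: measurable_funM => //.
  by apply: measurable_funB => //; exact: fine_measurable.
have Ef : (\int[P]_w (\prod_i f i w)%:E =
    (expR (\sum_i mu i * (expR (y i) - 1 - y i)))%:E)%E.
  rewrite (expectation_prod_of_mutually_independent indK) ?index_enum_uniq //.
  - rewrite expR_sum -prodEFin; apply: eq_bigr => i _.
    transitivity ((expR (- (y i * mu i)))%:E * \int[P]_w (expR (y i * fine (K i w)))%:E)%E.
      rewrite -ge0_integralZl //.
      + by apply: eq_integral => w _; rewrite /f mulrBr -EFinM -expRD addrC.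
      + apply/measurable_EFinP; apply: measurableT_comp => //.
        by apply: measurable_funM => //; exact: measurableT_comp.
    rewrite (poisson_mgf (mK i) (mu0 i) (@K_poisson i)) -EFinM -expRD.
    by congr (expR _)%:E; rewrite mulrBr mulrC; lra.
  - by move=> i; exact: preimage_sigma_algebra.
  - by move=> i; exact: preimage_sigma_measurable.
  - by move=> i w; exact: expR_ge0.
  - move=> i B mB; exists ((fun t : \bar R => expR (y i * (fine t - mu i))) @^-1` B).
      by have := mfi i measurableT B mB; rewrite setTI.
    by rewrite setTI.
have fE w : \prod_i f i w = expR (compensated_sum y w) by rewrite /f -expR_sum.
have mS := compensated_sum_measurable y.
have mA : measurable [set w | x <= compensated_sum y w].
  rewrite -[X in measurable X]setTI.
  by apply: (measurable_fun_ler (measurable_cst _)).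
have mF : measurable_fun setT (fun w => (\prod_i f i w)%:E).
  apply/measurable_EFinP; rewrite (_ : (fun w => _) = expR \o compensated_sum y).
    exact: measurableT_comp.
  by apply/funext => w; exact: fE.
have F0 w : (0 <= (\prod_i f i w)%:E)%E by rewrite fE lee_fin expR_ge0.
rewrite expRD EFinM -Ef expRN lee_pdivlMl ?expR_gt0 //.
apply: (@le_trans _ _ (\int[P]_(w in [set w | (x <= compensated_sum y w)%R]) (expR x)%:E)%E).
  by rewrite integral_cst.
apply: (@le_trans _ _ (\int[P]_(w in [set w | (x <= compensated_sum y w)%R]) (\prod_i f i w)%:E)%E).
  apply: ge0_le_integral => //.
  - exact: measurable_funTS.
  - by move=> w /= xS; rewrite fE lee_fin ler_expR.
exact: ge0_subset_integral.
Qed.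

(** Terms with [s * y i <= 1/2] enter the exponent through the quadratic bound; the
    remaining ones, few in mean, through the crude bound [expR (s * b)] on the tilting. *)
Lemma compensated_sum_deviation (y : I -> R) s b V Q x :
  0 < s -> (forall i, 0 <= y i <= b) ->
  \sum_i mu i * y i ^+ 2 <= V -> \sum_(i | 2^-1 < s * y i) mu i <= Q ->
  (P [set w | (x <= `|compensated_sum y w|)%R] <=
   (2 * expR (- (s * x) + 2 * s ^+ 2 * V + expR (s * b) * Q))%:E)%E.
Proof.
move=> s0 yb yV yQ.
have V0 : 0 <= V by apply: le_trans yV; apply: sumr_ge0 => i _; rewrite mulr_ge0 ?sqr_ge0.
have Q0 : 0 <= Q by apply: le_trans yQ; apply: sumr_ge0.
have cE r w : compensated_sum (fun i => r * y i) w = r * compensated_sum y w.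
  by rewrite /compensated_sum mulr_sumr; apply: eq_bigr => i _; rewrite mulrA.
have half1 (r : R) : (forall i, mu i * (expR (r * y i) - 1 - r * y i) <=
    2 * s ^+ 2 * (mu i * y i ^+ 2) + (if 2^-1 < s * y i then expR (s * b) * mu i else 0)) ->
  (P [set w | (s * x <= r * compensated_sum y w)%R] <=
    (expR (- (s * x) + 2 * s ^+ 2 * V + expR (s * b) * Q))%:E)%E.
  move=> h; have := chernoff_compensated_sum (fun i => r * y i) (s * x).
  under [X in (P X <= _)%E -> _]eq_set do rewrite cE.
  move=> /le_trans; apply; rewrite lee_fin ler_expR -addrA lerD2l.
  apply: (le_trans (ler_sum _ (fun i _ => h i))).
  rewrite big_split /= -big_mkcond /= -!mulr_sumr lerD //.
    by rewrite ler_wpM2l // mulr_ge0 // sqr_ge0.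
  by rewrite ler_wpM2l // expR_ge0.
have mS := compensated_sum_measurable y.
have mA (r : R) : measurable [set w | s * x <= r * compensated_sum y w].
  rewrite -[X in measurable X]setTI.
  by apply: (measurable_fun_ler (measurable_cst _)) => //; exact: measurable_funM.
have mB : measurable [set w | x <= `|compensated_sum y w|].
  rewrite -[X in measurable X]setTI.
  by apply: (measurable_fun_ler (measurable_cst _)) => //; exact: measurableT_comp.
apply: (@le_trans _ _ (P ([set w | (s * x <= s * compensated_sum y w)%R] `|`
    [set w | (s * x <= (- s) * compensated_sum y w)%R]))).
  apply: le_measure; rewrite ?inE //; first by apply: measurableU.
  move=> w /=; rewrite ler_normr => /orP[h|h]; [left|right].
    by rewrite /= ler_pM2l.
  by rewrite /= mulNr -mulrN ler_pM2l.
apply: (@le_trans _ _ (P [set w | (s * x <= s * compensated_sum y w)%R] +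
   P [set w | (s * x <= (- s) * compensated_sum y w)%R])%E).
  exact: measureU2.
rewrite mulrDl mul1r EFinD; apply: leeD; apply: half1 => i.
  case: ifPn => [h|]; last first.
    rewrite -leNgt => /expR_quadratic h; rewrite addr0.
    rewrite mulrCA -mulrA ler_wpM2l //; apply: (le_trans h).
    by rewrite exprMn mulrA mulrC.
  rewrite -[leLHS]add0r lerD //; first by apply: mulr_ge0; apply: mulr_ge0; rewrite ?sqr_ge0.
  rewrite [leRHS]mulrC ler_wpM2l //.
  have /andP[y0 yb'] := yb i.
  apply: (@le_trans _ _ (expR (s * y i))); first by have := mulr_ge0 (ltW s0) y0; lra.
  by rewrite ler_expR ler_wpM2l // ltW.
have : - s * y i <= 2^-1.
  by have /andP[y0 _] := yb i; have := mulr_ge0 (ltW s0) y0; rewrite mulNr; lra.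
move=> /expR_quadratic h; apply: (@le_trans _ _ (2 * s ^+ 2 * (mu i * y i ^+ 2))).
  rewrite mulrCA -mulrA ler_wpM2l //; apply: (le_trans h).
  by rewrite exprMn sqrrN mulrA mulrC.
by rewrite lerDl; case: ifP => // _; rewrite mulr_ge0 // expR_ge0.
Qed.

End poisson_chernoff.

Section poisson_grid.
Context d (T : measurableType d) (R : realType) (P : probability T R).
Variables (m : nat) (J : finType).
Local Notation I := ('I_m.+1 * J)%type.
Variables (K : I -> T -> \bar R) (mu : I -> R).
Hypothesis mK : forall i, measurable_fun setT (K i).
Hypothesis mu0 : forall i, 0 <= mu i.
Hypothesis K_poisson : forall i (k : nat),
  P [set w | K i w = (k%:R)%:E] = poisson_prob (mu i) 0 [set k].
Hypothesis indK : mutually_independent P (fun i => g_sigma_algebra_preimage (K i)).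

Definition grid_sum (y : J -> R) (k : nat) : T -> R :=
  compensated_sum K mu (fun p => if (p.1 <= k)%N then y p.2 else 0).

Let F i := g_sigma_algebra_preimage (K i).

Let compensated_sum_joint (A : {set I}) (y : I -> R) :
  (forall i, i \notin A -> y i = 0) ->
  measurable_fun setT
    (compensated_sum K mu y : g_sigma_algebraType (\bigcup_(i in [set` A]) F i) -> R).
Proof.
move=> yA; rewrite (_ : compensated_sum K mu y =
    (fun w => \sum_(i in A) y i * (fine (K i w) - mu i))); last first.
  apply/funext => w; rewrite /compensated_sum [RHS]big_mkcond; apply: eq_bigr => i _.
  by case: ifPn => // /yA ->; rewrite mul0r.
rewrite (_ : (fun w => _) = fun w => \sum_(i <- enum A) y i * (fine (K i w) - mu i)); last first.
  by apply/funext => w; rewrite big_enum.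
apply: (@measurable_fun_bigsum _ (g_sigma_algebraType (\bigcup_(i in [set` A]) F i))).
move=> i; rewrite mem_enum => iA.
apply: measurable_funM => //; apply: measurable_funB => //.
apply: measurableT_comp => // _ B mB.
by apply: sub_sigma_algebra; exists i => //; exists B.
Qed.

(** Ottaviani's inequality applies because past and future cells are independent; increments
    of [grid_sum] are again compensated sums with coefficients between 0 and [y], hence obey
    the same deviation bound. *)
Lemma poisson_grid_maximal (y : J -> R) (s b V Q x : R) :
  0 < s -> (forall l, 0 <= y l <= b) ->
  \sum_i mu i * y i.2 ^+ 2 <= V -> \sum_(i : I | 2^-1 < s * y i.2) mu i <= Q ->
  2 * expR (- (s * x) + 2 * s ^+ 2 * V + expR (s * b) * Q) <= 2^-1 ->
  (P (\bigcup_(k < m.+1) [set w | (2 * x < `|grid_sum y k w|)%R]) <=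
   (4 * expR (- (s * x) + 2 * s ^+ 2 * V + expR (s * b) * Q))%:E)%E.
Proof.
move=> s0 yb yV yQ half.
pose yc (c : nat -> bool) (p : I) := if c p.1 then y p.2 else 0.
have ycb c i : 0 <= yc c i <= b.
  by rewrite /yc; case: ifP => // _; have /andP[a e] := yb i.2; rewrite lexx (le_trans a).
have ycy c i : yc c i <= y i.2.
  by rewrite /yc; case: ifP => // _; have /andP[] := yb i.2.
have dev c : (P [set w | (x <= `|compensated_sum K mu (yc c) w|)%R] <=
    (2 * expR (- (s * x) + 2 * s ^+ 2 * V + expR (s * b) * Q))%:E)%E.
  apply: compensated_sum_deviation => //.
    apply: le_trans yV; apply: ler_sum => i _; rewrite ler_wpM2l //.
    by have /andP[a e] := ycb c i; rewrite lerXn2r // nnegrE // (le_trans a).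
  apply: le_trans yQ; rewrite big_mkcond [leRHS]big_mkcond; apply: ler_sum => i _ /=.
  case: ifPn => [h|_]; last by case: ifP.
  by rewrite ifT // (lt_le_trans h) // ler_wpM2l // ltW.
have mS (c : nat -> bool) : measurable_fun setT (compensated_sum K mu (yc c)).
  exact: compensated_sum_measurable.
have diff k w : (k <= m)%N -> grid_sum y m w - grid_sum y k w =
    compensated_sum K mu (yc (fun j => k < j)%N) w.
  move=> km; rewrite /grid_sum /compensated_sum -sumrB; apply: eq_bigr => i _.
  rewrite /yc -ltnS ltn_ord; case: leqP => _; first by rewrite mul0r subrr.
  by rewrite mul0r subr0.
have mlt c : measurable [set w | x <= `|compensated_sum K mu (yc c) w|].
  rewrite -[X in measurable X]setTI.
  by apply: (measurable_fun_ler (measurable_cst _)) => //; exact: measurableT_comp.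
have mlt' c : measurable [set w | x < `|compensated_sum K mu (yc c) w|].
  rewrite -[X in measurable X]setTI.
  by apply: (measurable_fun_ltr (measurable_cst _)) => //; exact: measurableT_comp.
have dev' c : (P [set w | (x < `|compensated_sum K mu (yc c) w|)%R] <=
    (2 * expR (- (s * x) + 2 * s ^+ 2 * V + expR (s * b) * Q))%:E)%E.
  by apply: le_trans (dev c); apply: le_measure; rewrite ?inE // => w /ltW.
apply: (@le_trans _ _ (2%:E * P [set w | (x < `|grid_sum y m w|)%R])%E); last first.
  rewrite (_ : 4 = 2 * 2 :> R); last by rewrite -natrM.
  rewrite -mulrA EFinM lee_wpmul2l ?lee_fin //.
  exact: (dev' (fun j => j <= m)%N).
apply: (@ottaviani _ _ _ P m (grid_sum y) x).
- by move=> k; exact: (mS (fun j => j <= k)%N).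
- move=> k km.
  pose A0 : {set I} := [set i : I | (i.1 <= k)%N]%SET.
  pose A1 : {set I} := [set i : I | (k < i.1)%N]%SET.
  have Fs i : sigma_algebra setT (F i) by exact: preimage_sigma_algebra.
  have Fm i : F i `<=` measurable by exact: preimage_sigma_measurable.
  apply: (@independent_joint _ _ _ P I F indK Fs Fm A0 A1).
  + by move=> i; rewrite !finset.inE ltnNge => ->.
  + pose G0 := \bigcup_(i in [set` A0]) F i.
    have mG j : (j <= k)%N -> @measurable _ (g_sigma_algebraType G0)
        [set w | 2 * x < `|grid_sum y j w|].
      move=> jk; rewrite -[X in measurable X]setTI.
      apply: (@measurable_fun_ltr _ (g_sigma_algebraType G0)) => //.
      apply: measurableT_comp => //; apply: (@compensated_sum_joint A0).
      by move=> i; rewrite finset.inE; case: ifP => // /leq_trans/(_ jk) ->.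
    apply: (@measurableD _ (g_sigma_algebraType G0)); first exact: mG.
    apply: (@bigsetU_measurable _ (g_sigma_algebraType G0)) => j _.
    by apply: mG; exact: ltnW.
  + pose G1 := \bigcup_(i in [set` A1]) F i.
    rewrite (_ : [set w | _] = [set w | `|compensated_sum K mu (yc (fun j => k < j)%N) w| <= x]); last first.
      by apply/seteqP; split=> w /=; rewrite diff.
    rewrite -[X in joint _ _ X]setTI.
    apply: (@measurable_fun_ler _ (g_sigma_algebraType G1)) => //.
    apply: measurableT_comp => //; apply: (@compensated_sum_joint A1).
    by move=> i; rewrite finset.inE /yc; case: ifP.
- move=> k km; rewrite (_ : [set w | _] = [set w | x < `|compensated_sum K mu (yc (fun j => k < j)%N) w|]); last first.
    by apply/seteqP; split=> w /=; rewrite diff.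
  by apply: le_trans (dev' _) _; rewrite lee_fin.
Qed.

End poisson_grid.

(** * Poisson random measures *)

Section reindexing_independence.
Context d (T : measurableType d) (R : realType) (P : probability T R).

Lemma mutually_independent_reindex (I I' : finType) (f : I -> I')
    (F : I' -> set (set T)) : injective f ->
  mutually_independent P F -> mutually_independent P (fun i => F (f i)).
Proof.
move=> finj indF J A AF.
have [J0|[i0 i0J]] := set_0Vmem J.
  by rewrite J0 big_set0 (_ : \bigcap_(i in _) A i = setT) ?probability_setT //;
    apply/seteqP; split=> // w _ i; rewrite /= finset.inE.
pose g (i' : I') := odflt i0 [pick i | f i == i'].
have fK i : g (f i) = i.
  by rewrite /g; case: pickP => [j /eqP/finj //|/(_ i)]; rewrite eqxx.
have := @indF [set f x | x in J]%SET (fun i' => A (g i')).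
rewrite big_imset /=; last by move=> i j _ _; exact: finj.
under eq_bigr do rewrite fK.
move=> <-.
  congr (P _); apply/seteqP; split=> w h.
    by move=> i' /= /imsetP[i iJ ->]; rewrite fK; exact: h.
  by move=> i iJ; rewrite -(fK i); apply: (h (f i)); exact: imset_f.
by move=> i' /imsetP[i iJ ->]; rewrite fK; exact: AF.
Qed.

End reindexing_independence.

Section poisson_random_measure_facts.
Context d (T : measurableType d) (R : realType) (P : probability T R).
Variables (nu : {sigma_finite_measure set R -> \bar R}) (N : R.-ker T ~> (R * R)%type).
Hypothesis prmN : poisson_random_measure P (time_space_intensity nu) N.
Local Open Scope ereal_scope.

Lemma intensity_rectangle (A E : set R) : measurable A -> measurable E ->
  A `<=` `[0%R, +oo[%classic ->
  time_space_intensity nu (A `*` E) = lebesgue_measure A * nu E.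
Proof.
move=> mA mE A0; rewrite /time_space_intensity product_measure1E //.
transitivity (lebesgue_measure (A `&` `[0%R, +oo[%classic) * nu E) => //.
by rewrite setIidl.
Qed.

Lemma prm_measurable A : measurable A -> measurable_fun setT (fun w => N w A).
Proof. by move=> mA; exact: measurable_kernel. Qed.

(** The definition asks for independence over index types ['I_k]; the general case follows
    by enumerating the index type. *)
Lemma prm_independent (I : finType) (A : I -> set (R * R)) :
  (forall i, measurable (A i)) -> trivIset setT A ->
  mutually_independent P (fun i => g_sigma_algebra_preimage (fun w => N w (A i))).
Proof.
move=> mA tA; have [_ _ ind] := prmN.
rewrite (_ : (fun i => _) = (fun i => g_sigma_algebra_preimage
    (fun w => N w (A (enum_val (enum_rank i)))))); last first.
  by apply/funext => i; rewrite enum_rankK.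
apply: (@mutually_independent_reindex _ _ _ P I 'I_#|I| (@enum_rank I)
  (fun j => g_sigma_algebra_preimage (fun w => N w (A (enum_val j)))) (@enum_rank_inj I)).
apply: (ind #|I| (fun j => A (enum_val j))) => //.
by move=> i j _ _ /(tA _ _ Logic.I Logic.I); exact: enum_val_inj.
Qed.

Lemma prm_poisson A : measurable A -> time_space_intensity nu A < +oo ->
  forall k : nat, P [set w | N w A = (k%:R)%:E] =
    poisson_prob (fine (time_space_intensity nu A)) 0 [set k].
Proof. by move=> mA Afin; have [+ _ _] := prmN; apply. Qed.

Lemma prm_null A : measurable A -> time_space_intensity nu A = 0 ->
  P [set w | N w A <> 0] = 0.
Proof.
move=> mA A0; have mN := prm_measurable mA.
have mE : measurable [set w | N w A = 0].
  by have := mN measurableT _ (emeasurable_set1 (0 : \bar R)); rewrite setTI.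
have PE : P [set w | N w A = 0] = 1.
  have := @prm_poisson A mA _ 0%N; rewrite A0 => ->; last exact: ltry.
  by rewrite poisson_prob_set1 // /poisson_weight expr0 fact0 divr1 oppr0 expR0 mulr1.
rewrite (_ : [set w | _] = ~` [set w | N w A = 0]) // probability_setC //.
by rewrite PE subee.
Qed.

Lemma prm_integer A : measurable A -> time_space_intensity nu A < +oo ->
  measurable (~` integer_valued (fun w => N w A)) /\
  P (~` integer_valued (fun w => N w A)) = 0.
Proof.
move=> mA Afin; have mN := prm_measurable mA.
split; first by apply: measurableC; exact: integer_valued_measurable.
apply: (@poisson_integer_valued _ _ _ P _ (fine (time_space_intensity nu A))) => //.
- by rewrite fine_ge0.
- exact: prm_poisson.
Qed.

End poisson_random_measure_facts.

Section step_approximation.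
Context d (X : measurableType d) (R : realType) (mu : {measure set X -> \bar R}).
Local Open Scope ereal_scope.

(** Replacing the integrand by constants on cells on which it varies by at most [h] *)
Lemma integral_step_approx (J : finType) (F : J -> set X) (phi : X -> R) (y : J -> R) (h : R) :
  (0 <= h)%R -> measurable_fun setT phi ->
  (forall j, measurable (F j)) -> trivIset setT F ->
  (forall j, mu (F j) < +oo) -> (forall j, 0 <= y j)%R ->
  (forall j x, F j x -> y j <= phi x <= y j + h)%R ->
  (`| \int[mu]_(x in \big[setU/set0]_(j : J) F j) phi x - \sum_(j : J) y j * fine (mu (F j))|
    <= h * \sum_(j : J) fine (mu (F j)))%R.
Proof.
move=> h0 mphi mF tF Ffin y0 yphi.
have Fp j x : F j x -> (0 <= phi x)%R.
  by move=> /yphi/andP[a _]; exact: le_trans (y0 j) a.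
have mFj j : (0 <= fine (mu (F j)))%R by rewrite fine_ge0.
have FfE j : mu (F j) = (fine (mu (F j)))%:E.
  by rewrite fineK // ge0_fin_numE.
have mphiE D : measurable_fun D (EFin \o phi).
  by apply/measurable_EFinP; exact: measurable_funTS.
have lo j : (y j * fine (mu (F j)))%:E <= \int[mu]_(x in F j) (phi x)%:E.
  rewrite EFinM -FfE -integral_cst //; apply: ge0_le_integral => //.
  - by move=> x _; rewrite lee_fin.
  - by move=> x /yphi/andP[a _]; rewrite lee_fin.
have hi j : \int[mu]_(x in F j) (phi x)%:E <= ((y j + h) * fine (mu (F j)))%:E.
  rewrite EFinM -FfE -integral_cst //; apply: ge0_le_integral => //.
  - by move=> x /Fp; rewrite lee_fin.
  - by move=> x /yphi/andP[_ a]; rewrite lee_fin.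
have fin j : \int[mu]_(x in F j) (phi x)%:E =
    (fine (\int[mu]_(x in F j) (phi x)%:E))%:E.
  rewrite fineK // ge0_fin_numE; last first.
    by apply: integral_ge0 => x /Fp; rewrite lee_fin.
  by apply: le_lt_trans (hi j) _; exact: ltry.
rewrite /Rintegral ge0_integral_bigsetU //=; last 3 first.
- exact: index_enum_uniq.
- by move=> i j _ _; exact: tF.
- move=> x; rewrite -bigcup_seq => -[j _ /Fp]; by rewrite lee_fin.
rewrite (eq_bigr (fun j => (fine (\int[mu]_(x in F j) (phi x)%:E))%:E)); last by move=> j _; exact: fin.
rewrite sumEFin /= -sumrB mulr_sumr.
apply: (le_trans (ler_norm_sum _ _ _)); apply: ler_sum => j _.
have := lo j; have := hi j; rewrite fin !lee_fin mulrDl => a b.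
by rewrite ger0_norm; lra.
Qed.

End step_approximation.

(** * Compensated jumps in a bounded range of sizes *)

Section cells.
Variable R : realType.
Implicit Types (a : nat -> R).

Definition space_cell a (l : nat) : set R := `[a l, a l.+1[%classic.

(** Half-open on the left, as the increments of a right-continuous process, except for the
    first cell, which contains 0. *)
Definition time_cell a (k : nat) : set R :=
  if k is k'.+1 then `]a k', a k]%classic else `[0, a 0]%classic.

Lemma space_cell_union a L : {homo a : i j / (i <= j)%N >-> i <= j} ->
  \big[setU/set0]_(l < L) space_cell a l = `[a 0%N, a L[%classic.
Proof.
move=> am; elim: L => [|L IH].
  rewrite big_ord0; apply/seteqP; split=> x //=; rewrite in_itv /=.
  by move=> /andP[h1 h2]; have := le_lt_trans h1 h2; rewrite ltxx.
rewrite big_ord_recr /= IH; apply/seteqP; split=> x /=; rewrite /space_cell /= !in_itv /=.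
  move=> [|] /andP[h1 h2]; apply/andP; split=> //.
    by apply: lt_le_trans h2 _; exact: am.
  by apply: le_trans h1; exact: am.
move=> /andP[h1 h2]; by have [h|h] := ltP x (a L); [left|right]; rewrite ?h1 ?h2.
Qed.

Lemma space_cell_triv a : {homo a : i j / (i <= j)%N >-> i <= j} ->
  trivIset setT (space_cell a).
Proof.
move=> am i j _ _ [x []]; rewrite /space_cell /= !in_itv /= => /andP[i1 i2] /andP[j1 j2].
case: (ltngtP i j) => // h.
  by have := le_lt_trans (am _ _ h) (le_lt_trans j1 i2); rewrite ltxx.
by have := le_lt_trans (am _ _ h) (le_lt_trans i1 j2); rewrite ltxx.
Qed.

Lemma time_cell_union a k : 0 <= a 0%N -> {homo a : i j / (i <= j)%N >-> i <= j} ->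
  \big[setU/set0]_(j < k.+1) time_cell a j = `[0, a k]%classic.
Proof.
move=> a0 am; elim: k => [|k IH]; first by rewrite big_ord_recr big_ord0 /= set0U.
rewrite big_ord_recr /= IH; apply/seteqP; split=> x /=; rewrite !in_itv /=.
  move=> [|] /andP[h1 h2]; apply/andP; split=> //.
    by apply: le_trans h2 _; exact: am.
  by apply: ltW; apply: le_lt_trans h1; apply: (le_trans a0); exact: am.
move=> /andP[h1 h2]; by have [h|h] := leP x (a k); [left|right]; rewrite ?h1 ?h2.
Qed.

Lemma time_cell_triv a : {homo a : i j / (i <= j)%N >-> i <= j} ->
  trivIset setT (time_cell a).
Proof.
move=> am.
have H i j x : (i < j)%N -> time_cell a i x -> time_cell a j x -> False.
  case: j => // j; rewrite ltnS => ij hi /=; rewrite in_itv /= => /andP[h _].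
  have : x <= a i by case: i hi {ij} => [|i] /=; rewrite in_itv /= => /andP[].
  by move=> /le_trans/(_ (am _ _ ij)); rewrite leNgt h.
move=> i j _ _ [x [xi xj]]; case: (ltngtP i j) => // ij.
  by case: (H _ _ _ ij xi xj).
by case: (H _ _ _ ij xj xi).
Qed.

Lemma time_cell_measurable a k : measurable (time_cell a k).
Proof. by case: k => [|k] /=; exact: measurable_itv. Qed.

Lemma time_cell_length a k : 0 <= a 0%N -> {homo a : i j / (i <= j)%N >-> i <= j} ->
  lebesgue_measure (time_cell a k) = (a k - (if k is k'.+1 then a k' else 0))%:E.
Proof.
move=> a0 am; case: k => [|k] /=; rewrite lebesgue_measure_itv /= lte_fin.
  by move: a0; rewrite le_eqVlt => /orP[/eqP <-|->]; rewrite ?ltxx ?subr0 ?sube0.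
by have := am _ _ (leqnSn k); rewrite le_eqVlt => /orP[/eqP ->|->]; rewrite ?ltxx ?subrr // EFinB.
Qed.

End cells.

Section finite_unions.
Context d (X : measurableType d) (R : realType) (mu : {measure set X -> \bar R}).

Lemma mem_bigsetU (J : finType) (F : J -> set X) x :
  (\big[setU/set0]_(j : J) F j) x <-> exists j, F j x.
Proof.
rewrite -bigcup_seq; split=> [[j _ Fj]|[j Fj]]; first by exists j.
by exists j => //=; rewrite mem_index_enum.
Qed.

Lemma measure_bigsetU_fin (J : finType) (F : J -> set X) :
  (forall j, measurable (F j)) -> trivIset setT F ->
  mu (\big[setU/set0]_(j : J) F j) = (\sum_(j : J) mu (F j))%E.
Proof.
move=> mF tF.
have mU : measurable (\big[setU/set0]_(j : J) F j).
  by apply: bigsetU_measurable => j _.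
have E A : measurable A -> mu A = (\int[mu]_(x in A) 1)%E.
  by move=> mA; rewrite integral_cst // mul1e.
rewrite E // ge0_integral_bigsetU //.
- by apply: eq_bigr => j _; rewrite -E.
- exact: index_enum_uniq.
- by move=> i j _ _; exact: tF.
Qed.

End finite_unions.

Section tightness.
Context d (T : measurableType d) (R : realType) (P : probability T R).

Lemma probability_tail_small (f : T -> R) (eta : R) : measurable_fun setT f -> 0 < eta ->
  exists K : nat, (P [set w | (K%:R < f w)%R] <= eta%:E)%E.
Proof.
move=> mf eta0; pose F (k : nat) := [set w | k%:R < f w].
have mF k : measurable (F k).
  by rewrite -[X in measurable X]setTI; exact: (measurable_fun_ltr (measurable_cst _)).
have F0 : \bigcap_k F k = set0.
  apply/seteqP; split=> // w h; have := h (Num.truncn (f w)).+1 I.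
  by rewrite /F /= ltNge ltW // truncnS_gt.
have := @nonincreasing_cvg_mu _ _ _ P F _ mF _ _.
rewrite F0 measure0 => /(_ _ measurable0) cv.
have {}cv : (P \o F) n @[n --> \oo] --> 0%E.
  apply: cv; first by rewrite -ge0_fin_numE // fin_num_measure.
  by move=> i j ij; apply/subsetPset => w; rewrite /F /=; apply: le_lt_trans; rewrite ler_nat.
have /fine_cvgP[fcv] := cv.
move=> /cvgrPdist_lt /(_ _ eta0) [K _ HK].
exists K; have := HK K (leqnn K); rewrite /= sub0r normrN => h.
have Pf : P (F K) \is a fin_num by exact: fin_num_measure.
by rewrite -(fineK Pf) lee_fin ltW // (le_lt_trans (ler_norm _)).
Qed.

End tightness.

Section jump_integrals.
Context d (T : measurableType d) (R : realType) (N : R.-ker T ~> (R * R)%type).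

Lemma jump_integral_measurable (W : set (R * R)) : measurable W ->
  measurable_fun setT (fun w => \int[N w]_(z in W) z.2).
Proof.
move=> mW; have mf : measurable_fun setT ((fun z : R * R => (z.2)%:E) \_ W).
  apply/(measurable_restrictT _ _).1 => //.
  apply: measurable_funTS; apply/measurable_EFinP; exact: measurable_snd.
rewrite /Rintegral; apply: measurableT_comp => //.
rewrite (_ : (fun w => _) = (fun w =>
  \int[N w]_z (((fun z : R * R => (z.2)%:E) \_ W)^\+)%E z -
  \int[N w]_z (((fun z : R * R => (z.2)%:E) \_ W)^\-)%E z)%E); last first.
  by apply/funext => w; rewrite integral_mkcond integralE.
apply: emeasurable_funB.
  apply: measurable_fun_integral_kernel => //.
  - by move=> U mU; exact: measurable_kernel.
  - exact: measurable_funepos.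
apply: measurable_fun_integral_kernel => //.
- by move=> U mU; exact: measurable_kernel.
- exact: measurable_funeneg.
Qed.

End jump_integrals.

Section jump_martingale.
Context d (T : measurableType d) (R : realType) (P : probability T R).
Variables (nu : {sigma_finite_measure set R -> \bar R}) (N : R.-ker T ~> (R * R)%type).
Hypothesis prmN : poisson_random_measure P (time_space_intensity nu) N.

Definition jump_martingale (c1 c2 t : R) (w : T) : R :=
  \int[N w]_(z in `[0, t] `*` `[c1, c2[) z.2 - t * \int[nu]_(x in `[c1, c2[) x.

Lemma jump_martingale_measurable c1 c2 t : measurable_fun setT (jump_martingale c1 c2 t).
Proof.
apply: measurable_funB => //; apply: jump_integral_measurable.
by apply: measurableX; exact: measurable_itv.
Qed.

Variables (m : nat) (tau : nat -> R).
Hypothesis tau0 : 0 <= tau 0%N.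
Hypothesis tau_homo : {homo tau : i j / (i <= j)%N >-> i <= j}.
Variables (c1 c2 : R).
Hypothesis c10 : 0 < c1.
Hypothesis c12 : c1 < c2.
Hypothesis nu_fin : (nu `[c1, +oo[%classic < +oo)%E.

Let nuE : R := fine (nu `[c1, c2[%classic).

Let nu_sub_fin A : measurable A -> A `<=` `[c1, +oo[%classic -> (nu A < +oo)%E.
Proof.
by move=> mA As; apply: le_lt_trans nu_fin; apply: le_measure; rewrite ?inE //;
  exact: measurable_itv.
Qed.

Let W : set (R * R) := `[0, tau m]%classic `*` `[c1, c2[%classic.

Let mW : measurable W.
Proof. by apply: measurableX; exact: measurable_itv. Qed.

Let W_fin : (time_space_intensity nu W < +oo)%E.
Proof.
rewrite intensity_rectangle; try exact: measurable_itv; last first.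
  by move=> x /=; rewrite !in_itv /= => /andP[-> _].
rewrite lte_mul_pinfty //.
  by rewrite ge0_fin_numE // lebesgue_measure_itv; case: ifP => _; rewrite ?ltry // -EFinB ltry.
apply: nu_sub_fin; first exact: measurable_itv.
by move=> x /=; rewrite !in_itv /= => /andP[-> _].
Qed.

Section fixed_mesh.
Variable L : nat.
Hypothesis L0 : (0 < L)%N.
Let h : R := (c2 - c1) / L%:R.
Let a (l : nat) : R := c1 + l%:R * h.
Let y (l : 'I_L) : R := a l.
Local Notation I := ('I_m.+1 * 'I_L)%type.
Let A (p : I) : set (R * R) := time_cell tau p.1 `*` space_cell a p.2.
Let mu (p : I) : R := fine (time_space_intensity nu (A p)).
(* Riemann sums of the compensated integral: jumps in a cell are given the smallest size
   of the cell. *)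
Let S := grid_sum (fun p w => N w (A p)) mu y.
Let len (k : nat) : R := tau k - (if k is k'.+1 then tau k' else 0).

Let h0 : 0 < h.
Proof. by rewrite divr_gt0 ?subr_gt0 // ltr0n. Qed.

Let a_homo : {homo a : i j / (i <= j)%N >-> i <= j}.
Proof. by move=> i j ij; rewrite lerD2l ler_wpM2r ?ler_nat // ltW. Qed.

Let a0 : a 0%N = c1. Proof. by rewrite /a mul0r addr0. Qed.

Let aL : a L = c2.
Proof. by rewrite /a mulrCA divff ?mulr1 ?subrKC // pnatr_eq0 -lt0n. Qed.

Let a_ge l : c1 <= a l.
Proof. by rewrite -[leLHS]a0; exact: a_homo. Qed.

Let cell_sub (l : 'I_L) : space_cell a l `<=` `[c1, +oo[%classic.
Proof.
by move=> x; rewrite /space_cell /= !in_itv /= andbT => /andP[h1 _]; apply: le_trans h1.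
Qed.

Let mcell l : measurable (space_cell a l).
Proof. exact: measurable_itv. Qed.

Let cell_fin (l : 'I_L) : (nu (space_cell a l) < +oo)%E.
Proof. by apply: nu_sub_fin => //; exact: cell_sub. Qed.

Let nul (l : 'I_L) : R := fine (nu (space_cell a l)).

Let nulE l : nu (space_cell a (l : 'I_L)) = (nul l)%:E.
Proof. by rewrite fineK // ge0_fin_numE. Qed.

Let nul_ge0 l : 0 <= nul l. Proof. by rewrite fine_ge0. Qed.

Let mA p : measurable (A p).
Proof. by apply: measurableX; [exact: time_cell_measurable|exact: mcell]. Qed.

Let tA : trivIset setT A.
Proof.
move=> [i l] [i' l'] _ _ [[u v] [[/= u1 v1] [/= u2 v2]]].
congr (_, _); apply: val_inj => /=.
  by apply: (time_cell_triv tau_homo) => //; exists u.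
by apply: (space_cell_triv a_homo) => //; exists v.
Qed.

Let time_cell_pos k : time_cell tau k `<=` `[0, +oo[%classic.
Proof.
move=> x; rewrite /= in_itv /= andbT; case: k => [|k] /=; rewrite in_itv /= => /andP[] //.
by move=> h1 _; apply: ltW; apply: le_lt_trans h1; apply: le_trans tau0 _; exact: tau_homo.
Qed.

Let A_int p : time_space_intensity nu (A p) = (len p.1 * nul p.2)%:E.
Proof.
rewrite intensity_rectangle //; last exact: time_cell_measurable.
by rewrite time_cell_length // nulE EFinM.
Qed.

Let muE p : mu p = len p.1 * nul p.2.
Proof. by rewrite /mu A_int. Qed.

Let len_ge0 k : 0 <= len k.
Proof. by rewrite subr_ge0; case: k => // k; exact: tau_homo. Qed.

Let len_sum k : (k <= m)%N -> \sum_(i < m.+1 | (i <= k)%N) len i = tau k.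
Proof.
move=> km; transitivity (\sum_(i < k.+1) len i).
  rewrite (big_ord_widen m.+1 len (n1 := k.+1)) //.
rewrite -(big_mkord xpredT len) big_nat_recl //= {1}/len subr0.
by rewrite telescope_sumr // subrKC.
Qed.

Let sum_pair (f : nat -> R) (g : 'I_L -> R) (c : pred nat) :
  \sum_(p : I) (if c p.1 then g p.2 * (f p.1) else 0) =
  (\sum_(i < m.+1 | c i) f i) * \sum_l g l.
Proof.
rewrite -(pair_bigA _ (fun (i : 'I_m.+1) (l : 'I_L) => if c i then g l * f i else 0)) /=.
rewrite mulr_suml [RHS]big_mkcond; apply: eq_bigr => i _.
case: ifP => _; last by rewrite big1.
by rewrite mulr_sumr; apply: eq_bigr => l _; rewrite mulrC.
Qed.

Let cells_union : \big[setU/set0]_(l < L) space_cell a l = `[c1, c2[%classic.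
Proof. by rewrite space_cell_union // a0 aL. Qed.

Let y_ge0 l : 0 <= y l. Proof. exact: le_trans (ltW c10) (a_ge l). Qed.

Let y_le l : y l <= c2.
Proof. by rewrite -aL; apply: a_homo; apply: ltnW. Qed.

Let y_cell (l : 'I_L) x : space_cell a l x -> y l <= x <= y l + h.
Proof.
rewrite /space_cell /= in_itv /= => /andP[h1 /ltW h2]; rewrite h1 /=.
by apply: (le_trans h2); rewrite /y /a -addrA lerD2l -natr1 mulrDl mul1r.
Qed.

Let tcell : trivIset setT (fun l : 'I_L => space_cell a l).
Proof. by move=> i j _ _ h1; apply: val_inj; exact: (space_cell_triv a_homo). Qed.

Lemma cell_second_moment V :
  (\int[nu]_(x in `[0%R, +oo[) (x ^+ 2)%:E <= V%:E)%E ->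
  \sum_i mu i * y i.2 ^+ 2 <= tau m * V.
Proof.
move=> HV; rewrite (eq_bigr (fun p : I => if true then (nul p.2 * y p.2 ^+ 2) * len p.1 else 0)); last first.
  by move=> p _; rewrite muE -mulrA mulrC.
rewrite (sum_pair len (fun l => nul l * y l ^+ 2) (fun=> true)).
rewrite (eq_bigl (fun i : 'I_m.+1 => (i <= m)%N)); last by move=> i; rewrite -ltnS ltn_ord.
rewrite len_sum // ler_wpM2l //; first by apply: le_trans tau0 _; exact: tau_homo.
have msq D : measurable_fun D (fun x : R => (x ^+ 2)%:E).
  by apply/measurable_EFinP; apply: measurable_funTS; exact: measurable_funX.
have sq0 (x : R) : (0 <= (x ^+ 2)%:E)%E by rewrite lee_fin sqr_ge0.
rewrite -lee_fin; apply: le_trans HV.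
apply: (@le_trans _ _ (\int[nu]_(x in `[c1, c2[) (x ^+ 2)%:E)%E); last first.
  apply: ge0_subset_integral => //; try exact: measurable_itv.
  by move=> x /=; rewrite !in_itv /= andbT => /andP[h1 _]; apply: le_trans h1; exact: ltW.
rewrite -cells_union ge0_integral_bigsetU //; last 2 first.
- exact: index_enum_uniq.
- by move=> i j _ _; exact: tcell.
rewrite -sumEFin; apply: lee_sum => l _.
rewrite mulrC EFinM -nulE -integral_cst //; apply: ge0_le_integral => //.
- by move=> x _; rewrite lee_fin sqr_ge0.
- move=> x /y_cell/andP[h1 _]; rewrite lee_fin lerXn2r // nnegrE //.
  exact: le_trans (y_ge0 l) h1.
Qed.

Lemma cell_tail (s q : R) : 0 < s ->
  (nu `[((2 * s)^-1)%R, +oo[%classic <= q%:E)%E ->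
  \sum_(i : I | 2^-1 < s * y i.2) mu i <= tau m * q.
Proof.
move=> s0 Hq; rewrite big_mkcond /=.
rewrite (eq_bigr (fun p : I => if true then (if 2^-1 < s * y p.2 then nul p.2 else 0) * len p.1 else 0)); last first.
  by move=> p _; rewrite muE; case: ifP => _; rewrite ?mul0r // mulrC.
rewrite (sum_pair len (fun l => if 2^-1 < s * y l then nul l else 0) (fun=> true)).
rewrite (eq_bigl (fun i : 'I_m.+1 => (i <= m)%N)); last by move=> i; rewrite -ltnS ltn_ord.
rewrite len_sum // ler_wpM2l //; first by apply: le_trans tau0 _; exact: tau_homo.
rewrite -lee_fin; apply: le_trans Hq.
pose E (l : 'I_L) := if 2^-1 < s * y l then space_cell a l else set0.
have mE l : measurable (E l) by rewrite /E; case: ifP.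
apply: (@le_trans _ _ (nu (\big[setU/set0]_l E l))).
  rewrite measure_bigsetU_fin //.
    rewrite -sumEFin; apply: lee_sum => l _; rewrite /E.
    by case: ifP => _; [rewrite -nulE|rewrite measure0].
  move=> i j _ _ [x []]; rewrite /E; case: ifP => // _ xi; case: ifP => // _ xj.
  by apply: tcell => //; exists x.
apply: le_measure; rewrite ?inE; try exact: measurable_itv.
  by apply: bigsetU_measurable => l _.
move=> x /mem_bigsetU[l]; rewrite /E; case: ifP => // h1 /y_cell/andP[h2 _] /=.
rewrite in_itv /= andbT; apply: le_trans h2.
by rewrite invfM ler_pdivrMr // [y l * s]mulrC ltW.
Qed.

Let F k (p : I) := if (p.1 <= k)%N then A p else set0.

Let F_union k : (k <= m)%N ->
  \big[setU/set0]_(p : I) F k p = `[0, tau k]%classic `*` `[c1, c2[%classic.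
Proof.
move=> km; rewrite -(time_cell_union k tau0 tau_homo) -cells_union.
apply/seteqP; split=> -[u v].
  move=> /mem_bigsetU[[i l]]; rewrite /F /=; case: ifP => // ik [/= h1 h2]; split=> /=.
    by apply/mem_bigsetU; exists (Ordinal (ik : (i < k.+1)%N)).
  by apply/mem_bigsetU; exists l.
move=> [/= /mem_bigsetU[i h1] /mem_bigsetU[l h2]].
have im : (i < m.+1)%N by apply: leq_trans (ltn_ord i) _.
by apply/mem_bigsetU; exists (Ordinal im, l); rewrite /F /= -ltnS ltn_ord.
Qed.

Let mF k p : measurable (F k p). Proof. by rewrite /F; case: ifP. Qed.

Let tF k : trivIset setT (F k).
Proof.
move=> i j _ _ [x []]; rewrite /F; case: ifP => // _ xi; case: ifP => // _ xj.
by apply: tA => //; exists x.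
Qed.

Lemma jump_martingale_approx k w : (k <= m)%N -> (N w W < +oo)%E ->
  `|jump_martingale c1 c2 (tau k) w - S k w| <= h * (fine (N w W) + tau m * nuE).
Proof.
move=> km Nfin.
have FW p : F k p `<=` W.
  move=> z Fz; have : (\big[setU/set0]_(p : I) F k p) z by apply/mem_bigsetU; exists p.
  rewrite F_union // => -[/= h1 h2]; split=> //=.
  by move: h1; rewrite /= !in_itv /= => /andP[-> h1]; apply: (le_trans h1); exact: tau_homo.
have Ffin p : (N w (F k p) < +oo)%E.
  by apply: le_lt_trans Nfin; apply: le_measure; rewrite ?inE.
have ysnd p z : F k p z -> y p.2 <= z.2 <= y p.2 + h.
  by rewrite /F; case: ifP => // _ [_ /y_cell].
have := @integral_step_approx _ _ R (N w) _ (F k) snd (fun p => y p.2) h (ltW h0)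
  measurable_snd (mF k) (@tF k) Ffin (fun p => y_ge0 p.2) ysnd.
rewrite F_union // => H1.
have H2 := @integral_step_approx _ _ R nu _ (fun l : 'I_L => space_cell a l) id y h (ltW h0)
  (@measurable_id _ _ setT) mcell tcell cell_fin y_ge0 y_cell.
rewrite cells_union in H2.
have NF : \sum_(p : I) fine (N w (F k p)) <= fine (N w W).
  rewrite -lee_fin (fineK (x := N w W)) ?ge0_fin_numE // -sumEFin.
  rewrite (eq_bigr (fun p => N w (F k p))); last first.
    by move=> p _; rewrite fineK // ge0_fin_numE.
  rewrite -measure_bigsetU_fin //; apply: le_measure; rewrite ?inE //.
    by apply: bigsetU_measurable => p _.
  by move=> z /mem_bigsetU[p]; exact: FW.
have nuS : \sum_(l < L) nul l = nuE.
  rewrite /nuE -cells_union measure_bigsetU_fin // (eq_bigr (fun l => (nul l)%:E)) ?sumEFin //.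
  by move=> l _; exact: nulE.
have SE : S k w = \sum_(p : I) y p.2 * fine (N w (F k p)) -
    tau k * \sum_(l < L) y l * nul l.
  rewrite /S /grid_sum /compensated_sum -(len_sum km).
  rewrite -(sum_pair len (fun l => y l * nul l) (fun i => i <= k)%N) -sumrB.
  apply: eq_bigr => p _; rewrite /F; case: ifP => _.
    by rewrite muE mulrBr; congr (_ - _); rewrite -mulrA [nul _ * _]mulrC.
  by rewrite mul0r measure0 mulr0 subrr.
rewrite SE /jump_martingale.
set J1 := Rintegral _ _ _ in H1 *; set J2 := Rintegral _ _ _ in H2 *.
set S1 := \sum_(p : I) _ in H1 *; set S2 := \sum_(l < L) _ in H2 *.
have tk0 : 0 <= tau k by apply: le_trans tau0 _; exact: tau_homo.
have tkm : tau k <= tau m by exact: tau_homo.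
rewrite (_ : _ - _ - _ = (J1 - S1) - tau k * (J2 - S2)); last by rewrite mulrBr; lra.
apply: (le_trans (ler_normB _ _)); rewrite [leRHS]mulrDr lerD //.
  by apply: (le_trans H1); rewrite ler_wpM2l // ltW.
rewrite normrM (ger0_norm tk0) mulrCA ler_pM //.
by rewrite -nuS.
Qed.

Lemma mesh_maximal (s x V q : R) : 0 < s ->
  (\int[nu]_(x in `[0%R, +oo[) (x ^+ 2)%:E <= V%:E)%E ->
  (nu `[((2 * s)^-1)%R, +oo[%classic <= q%:E)%E ->
  let D := expR (- (s * x) + 2 * s ^+ 2 * (tau m * V) + expR (s * c2) * (tau m * q)) in
  2 * D <= 2^-1 ->
  (P (\bigcup_(k < m.+1) [set w | (2 * x < `|S k w|)%R]) <= (4 * D)%:E)%E.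
Proof.
move=> s0 HV Hq D half; apply: poisson_grid_maximal => //.
- by move=> p; exact: prm_measurable.
- by move=> p; rewrite muE mulr_ge0.
- by move=> p k; apply: prm_poisson => //; rewrite A_int ltry.
- by apply: (prm_independent prmN (A := A)); [exact: mA|exact: tA].
- by move=> l; rewrite y_ge0 y_le.
- exact: cell_second_moment.
- exact: cell_tail.
Qed.

Lemma mesh_measurable k : measurable_fun setT (S k).
Proof. by apply: compensated_sum_measurable => p; exact: prm_measurable. Qed.

End fixed_mesh.

(** The Riemann sums differ from the integrals by at most the mesh times a variable [f] that
    does not depend on the mesh. As [f] is almost surely finite, a fine mesh makes the error
    less than [x] outside an event of arbitrarily small probability. *)
Theorem jump_martingale_maximal (s x V q : R) : 0 < s -> 0 < x ->
  (\int[nu]_(x in `[0%R, +oo[) (x ^+ 2)%:E <= V%:E)%E ->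
  (nu `[((2 * s)^-1)%R, +oo[%classic <= q%:E)%E ->
  let D := expR (- (s * x) + 2 * s ^+ 2 * (tau m * V) + expR (s * c2) * (tau m * q)) in
  2 * D <= 2^-1 ->
  (P (\bigcup_(k < m.+1) [set w | (3 * x < `|jump_martingale c1 c2 (tau k) w|)%R])
    <= (4 * D)%:E)%E.
Proof.
move=> s0 x0 HV Hq D half; apply/lee_addgt0Pr => eta eta0.
have mNW := prm_measurable N mW.
pose f w := fine (N w W) + tau m * nuE.
have mf : measurable_fun setT f by apply: measurable_funD => //; exact: measurableT_comp.
have [K HK] := probability_tail_small P mf eta0.
(* So fine that the mesh times [K] is at most [x] *)
pose L := (Num.truncn ((c2 - c1) * K%:R / x)).+1.
have L0 : (0 < L)%N by [].
have hK : (c2 - c1) / L%:R * K%:R <= x.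
  rewrite mulrAC ler_pdivrMr ?ltr0n // [x * _]mulrC -ler_pdivrMr // ltW //.
  exact: truncnS_gt.
have h0 : 0 <= (c2 - c1) / L%:R by rewrite divr_ge0 // subr_ge0 ltW.
pose S k := grid_sum (fun (p : 'I_m.+1 * 'I_L) w =>
    N w (time_cell tau p.1 `*` space_cell (fun l => c1 + l%:R * ((c2 - c1) / L%:R)) p.2))
  (fun p => fine (time_space_intensity nu
    (time_cell tau p.1 `*` space_cell (fun l => c1 + l%:R * ((c2 - c1) / L%:R)) p.2)))
  (fun l => c1 + l%:R * ((c2 - c1) / L%:R)) k.
have mS k : measurable_fun setT (S k) by exact: mesh_measurable.
have mlt (g : T -> R) (c : R) : measurable_fun setT g -> measurable [set w | c < `|g w|].
  move=> mg; rewrite -[X in measurable X]setTI.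
  by apply: (measurable_fun_ltr (measurable_cst _)) => //; exact: measurableT_comp.
have [mI PI] := prm_integer prmN mW W_fin.
have mB1 : measurable (\bigcup_(k < m.+1) [set w | 2 * x < `|S k w|]).
  by apply: bigcup_measurable => k _; exact: mlt.
have mB2 : measurable [set w | K%:R < f w].
  by rewrite -[X in measurable X]setTI; exact: (measurable_fun_ltr (measurable_cst _)).
apply: (@le_trans _ _ (P ((\bigcup_(k < m.+1) [set w | (2 * x < `|S k w|)%R] `|`
    [set w | (K%:R < f w)%R]) `|` ~` integer_valued (fun w => N w W)))).
  apply: le_measure; rewrite ?inE.
  - by apply: bigcup_measurable => k _; apply: mlt; exact: jump_martingale_measurable.
  - by apply: measurableU => //; exact: measurableU.
  - move=> w [k /= km Zk].
    have [iv|] := pselect (integer_valued (fun w => N w W) w); last by right.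
    have Nfin : (N w W < +oo)%E by case: iv => j _ /= ->; rewrite ltry.
    left; have [Kf|fK] := ltP K%:R (f w); first by right.
    left; exists k => //=.
    have := @jump_martingale_approx L L0 k w (km : (k <= m)%N) Nfin.
    rewrite -/(S k) -/(f w) => H.
    have : (c2 - c1) / L%:R * f w <= x by apply: le_trans hK; rewrite ler_wpM2l.
    have := ler_normD (jump_martingale c1 c2 (tau k) w - S k w) (S k w).
    rewrite subrK; move: H Zk => /=; lra.
apply: (@le_trans _ _ (P (\bigcup_(k < m.+1) [set w | (2 * x < `|S k w|)%R] `|`
    [set w | (K%:R < f w)%R]) + P (~` integer_valued (fun w => N w W)))%E).
  by apply: measureU2 => //; exact: measurableU.
rewrite [X in (_ + X)%E]PI adde0.
apply: (@le_trans _ _ (P (\bigcup_(k < m.+1) [set w | (2 * x < `|S k w|)%R]) +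
    P [set w | (K%:R < f w)%R])%E); first exact: measureU2.
by apply: leeD => //; exact: mesh_maximal.
Qed.

End jump_martingale.

(** * Brownian motion on a grid *)

Section gaussian_tail.
Variable R : realType.

(** Beyond [x] the density is at most [C] times the density with twice the variance, since
    half of the exponent can be bounded by its value at [x]. *)
Lemma normal_tail (sigma x : R) : 0 < sigma -> 0 <= x ->
  (normal_prob 0%R sigma [set u | (x < `|u|)%R] <=
   (Num.sqrt 2 * expR (- (x ^+ 2 / (4 * sigma ^+ 2))))%:E)%E.
Proof.
move=> s0 x0; pose s' := Num.sqrt 2 * sigma.
have sq2 : 0 < Num.sqrt 2 :> R by rewrite sqrtr_gt0.
have s'0 : 0 < s' by rewrite mulr_gt0.
have s'2 : s' ^+ 2 = 2 * sigma ^+ 2 by rewrite exprMn sqr_sqrtr.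
have sg2 : 0 < sigma ^+ 2 by rewrite exprn_gt0.
pose C := Num.sqrt 2 * expR (- (x ^+ 2 / (4 * sigma ^+ 2))).
have C0 : 0 <= C by rewrite mulr_ge0 ?sqrtr_ge0 ?expR_ge0.
have mA : measurable [set u : R | x < `|u|].
  rewrite -[X in measurable X]setTI.
  by apply: (measurable_fun_ltr (measurable_cst _)) => //; exact: normr_measurable.
have pdfE (s u : R) : 0 < s -> normal_pdf 0 s u =
    (Num.sqrt (s ^+ 2 * pi *+ 2))^-1 * expR (- (u ^+ 2 / (2 * s ^+ 2))).
  move=> sp; rewrite /normal_pdf gt_eqF //= /normal_fun /normal_peak subr0.
  by rewrite [s ^+ 2 *+ 2 in X in expR X]mulr2n mulNr mulrDl !mul1r.
have key u : x < `|u| -> normal_pdf 0 sigma u <= C * normal_pdf 0 s' u.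
  move=> xu; rewrite !pdfE //.
  have -> : Num.sqrt (s' ^+ 2 * pi *+ 2) = Num.sqrt 2 * Num.sqrt (sigma ^+ 2 * pi *+ 2).
    by rewrite s'2 -sqrtrM //; congr (Num.sqrt _); rewrite !mulr2n; lra.
  rewrite s'2 /C.
  move: (Num.sqrt (sigma ^+ 2 * pi *+ 2)) (sqrtr_ge0 (sigma ^+ 2 * pi *+ 2)) => r r0.
  rewrite [leRHS](_ : _ = r^-1 * (expR (- (x ^+ 2 / (4 * sigma ^+ 2))) *
      expR (- (u ^+ 2 / (2 * (2 * sigma ^+ 2)))))); last first.
    move: (expR _) (expR _) (Num.sqrt 2) sq2 => E1 E2 q q0.
    rewrite invfM -[RHS]mul1r -(divff (lt0r_neq0 q0)).
    by move: (q^-1) (r^-1) => ? ?; lra.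
  rewrite ler_wpM2l ?invr_ge0 // -expRD ler_expR.
  have : x ^+ 2 <= u ^+ 2.
    by rewrite -(real_normK (num_real u)) lerXn2r ?nnegrE // ltW.
  move: (x ^+ 2) (u ^+ 2) => x2 u2 xu2.
  rewrite [2 * (2 * _)]mulrA -natrM.
  rewrite (_ : u2 / (2 * sigma ^+ 2) = u2 / (4 * sigma ^+ 2) + u2 / (4 * sigma ^+ 2)).
    by rewrite opprD lerD2r lerN2 ler_wpM2r // invr_ge0 mulr_ge0 // ltW.
  by rewrite !invfM; move: (sigma ^+ 2)^-1 => v; lra.
rewrite /normal_prob.
apply: (@le_trans _ _ (\int[lebesgue_measure]_(u in [set u | (x < `|u|)%R])
   (C%:E * (normal_pdf 0 s' u)%:E))%E).
  apply: ge0_le_integral => //.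
  - by move=> u _; rewrite lee_fin normal_pdf_ge0.
  - apply/measurable_EFinP; apply: measurable_funTS; exact: measurable_normal_pdf.
  - apply: measurable_funeM; apply/measurable_EFinP; apply: measurable_funTS.
    exact: measurable_normal_pdf.
rewrite ge0_integralZl //; last 2 first.
- apply/measurable_EFinP; apply: measurable_funTS; exact: measurable_normal_pdf.
- by move=> u _; rewrite lee_fin normal_pdf_ge0.
rewrite -[leRHS]mule1 lee_wpmul2l ?lee_fin // -(@integral_normal_pdf R 0 s').
  apply: ge0_subset_integral => //.
  - by apply/measurable_EFinP; exact: measurable_normal_pdf.
  - by move=> u _; rewrite lee_fin normal_pdf_ge0.
Qed.

End gaussian_tail.

Section brownian_maximal.
Context d (T : measurableType d) (R : realType) (P : probability T R).
Variable B : R -> T -> R.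
Hypothesis BM : standard_brownian_motion P B.
Variables (m : nat) (tau : nat -> R).
Hypothesis tau0 : 0 <= tau 0%N.
Hypothesis tau_homo : {homo tau : i j / (i <= j)%N >-> i <= j}.
Hypothesis taum : 0 < tau m.

Let mB k : measurable_fun setT (B (tau k)).
Proof.
by have [[mB _] _ _ _] := BM; apply: mB; apply: le_trans tau0 _; exact: tau_homo.
Qed.

Let mlt (f : T -> R) c : measurable_fun setT f -> measurable [set w | c < `|f w|].
Proof.
move=> mf; rewrite -[X in measurable X]setTI.
by apply: (measurable_fun_ltr (measurable_cst _)) => //; exact: measurableT_comp.
Qed.

Let tail s t x : 0 <= s < t -> t <= tau m -> 0 <= x ->
  (P [set w | (x < `|B t w - B s w|)%R] <=
    (Num.sqrt 2 * expR (- (x ^+ 2 / (4 * tau m))))%:E)%E.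
Proof.
move=> /andP[s0 st] tm x0; have [_ law _ _] := BM.
have mA : measurable [set u : R | x < `|u|].
  rewrite -[X in measurable X]setTI.
  by apply: (measurable_fun_ltr (measurable_cst _)) => //; exact: normr_measurable.
have s01 : 0 <= s < t by rewrite s0.
have := law s t s01 _ mA; rewrite /= => ->.
have ts : 0 < t - s by rewrite subr_gt0.
have sg : 0 < Num.sqrt (t - s) by rewrite sqrtr_gt0.
apply: (le_trans (normal_tail sg x0)).
rewrite lee_fin ler_wpM2l ?sqrtr_ge0 // ler_expR lerN2.
rewrite sqr_sqrtr ?(ltW ts) // ler_wpM2l ?sqr_ge0 // lef_pV2 ?posrE ?mulr_gt0 //.
by rewrite ler_pM2l //; lra.
Qed.

Lemma brownian_maximal x : 0 < x ->
  Num.sqrt 2 * expR (- (x ^+ 2 / (4 * tau m))) <= 2^-1 ->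
  (P (\bigcup_(k < m.+1) [set w | (2 * x < `|B (tau k) w|)%R]) <=
   (2 * (Num.sqrt 2 * expR (- (x ^+ 2 / (4 * tau m)))))%:E)%E.
Proof.
move=> x0 half; have [[_ [N0 [mN0 PN0 sN0]]] law ind _] := BM.
have tk0 k : 0 <= tau k by apply: le_trans tau0 _; exact: tau_homo.
have tail_m : (P [set w | (x < `|B (tau m) w|)%R] <=
    (Num.sqrt 2 * expR (- (x ^+ 2 / (4 * tau m))))%:E)%E.
  have T0 : 0 <= (0 : R) < tau m by rewrite lexx.
  apply: le_trans (tail T0 (lexx _) (ltW x0)).
  have mB0 : measurable_fun setT (B 0) by have [[h _] _ _ _] := BM; exact: h.
  have mE : measurable [set w | x < `|B (tau m) w - B 0 w|].
    by apply: mlt; exact: measurable_funB.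
  apply: (@le_trans _ _ (P ([set w | (x < `|B (tau m) w - B 0 w|)%R] `|` N0))).
    apply: le_measure; rewrite ?inE; [exact: mlt|exact: measurableU|].
    move=> w /= xB; have [B0|B0] := pselect (B 0 w = 0); last by right; exact: sN0.
    by left; rewrite /= B0 subr0.
  by apply: (@le_trans _ _ (P [set w | (x < `|B (tau m) w - B 0 w|)%R] + P N0)%E);
    [exact: measureU2|rewrite PN0 adde0].
apply: (@le_trans _ _ (2%:E * P [set w | (x < `|B (tau m) w|)%R])%E); last first.
  by rewrite EFinM lee_wpmul2l // lee_fin.
apply: (@ottaviani _ _ _ P m (fun k => B (tau k)) x) => // k km.
- move=> A E; have km' := tau_homo km.
  pose G := \bigcup_(t in `[0, tau k]) g_sigma_algebra_preimage (B t).
  have mG j : (j <= k)%N -> @measurable _ (g_sigma_algebraType G)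
      [set w | 2 * x < `|B (tau j) w|].
    move=> jk; rewrite -[X in measurable X]setTI.
    apply: (@measurable_fun_ltr _ (g_sigma_algebraType G)) => //.
    apply: measurableT_comp => //; apply: measurable_fun_preimage => C mC.
    apply: sub_sigma_algebra; exists (tau j); first by rewrite /= in_itv /= tk0 tau_homo.
    by exists C => //; rewrite setTI.
  have GA : generated_sigma `[0, tau k] B A.
    apply: (@measurableD _ (g_sigma_algebraType G)); first exact: mG.
    apply: (@bigsetU_measurable _ (g_sigma_algebraType G)) => j _.
    by apply: mG; exact: ltnW.
  have [tkm|tkm] := eqVneq (tau k) (tau m).
    have -> : E = setT.
      by apply/seteqP; split=> // w _; rewrite /E /= tkm subrr normr0 ltW.
    by rewrite setIT probability_setT mule1.
  have tlt : 0 <= tau k < tau m by rewrite tk0 lt_neqAle tkm.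
  apply: (ind _ _ tlt) => //.
  exists [set u | `|u| <= x]; last by rewrite setTI.
  rewrite -[X in measurable X]setTI.
  by apply: (measurable_fun_ler _ (measurable_cst _)) => //; exact: normr_measurable.
- have km' := tau_homo km; have [tkm|tkm] := eqVneq (tau k) (tau m).
    rewrite (_ : [set w | _] = set0) ?measure0 ?lee_fin ?invr_ge0 //.
    by apply/seteqP; split=> // w /=; rewrite tkm subrr normr0 ltNge ltW.
  have tlt : 0 <= tau k < tau m by rewrite tk0 lt_neqAle tkm.
  by apply: (le_trans (tail tlt (lexx _) (ltW x0))); rewrite lee_fin.
Qed.

End brownian_maximal.

(** * Moments of the jump measure *)

Section null_modification.
Context d (X : measurableType d) (R : realType) (mu : {measure set X -> \bar R}).

Lemma Rintegral_null_difference (A C Z : set X) (f : X -> R) :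
  measurable A -> measurable C -> measurable Z -> measurable_fun setT f ->
  A `<=` C -> C `<=` A `|` Z -> mu Z = 0%E ->
  \int[mu]_(x in C) f x = \int[mu]_(x in A) f x.
Proof.
move=> mA mC mZ mf AC CAZ Z0.
have mD : measurable (C `\` A) by exact: measurableD.
have D0 : mu (C `\` A) = 0%E.
  apply: (subset_measure0 mD mZ) => // x [Cx nAx].
  by case: (CAZ x Cx).
rewrite /Rintegral; congr fine.
rewrite -(setDUK AC) integral_setU_EFin //; last 2 first.
- exact: measurable_funTS.
- by apply/disj_setPS => x [? []].
by rewrite [X in (_ + X)%E]null_set_integral ?adde0 //; apply/measurable_EFinP; exact: measurable_funTS.
Qed.

End null_modification.

Section levy_measure_tail.
Context (R : realType) (nu : {sigma_finite_measure set R -> \bar R}) (V : R).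
Hypothesis HV : (\int[nu]_(x in `[0%R, +oo[) (x ^+ 2)%:E <= V%:E)%E.

Let msq D : measurable_fun D (fun x : R => (x ^+ 2)%:E).
Proof. by apply/measurable_EFinP; apply: measurable_funTS; exact: measurable_funX. Qed.

Let sq0 (x : R) : (0 <= (x ^+ 2)%:E)%E. Proof. by rewrite lee_fin sqr_ge0. Qed.

Lemma levy_V_ge0 : 0 <= V.
Proof. by rewrite -lee_fin; apply: le_trans HV; apply: integral_ge0. Qed.

Lemma levy_sq_itv c : 0 <= c -> (\int[nu]_(x in `[c, +oo[) (x ^+ 2)%:E <= V%:E)%E.
Proof.
move=> c0; apply: le_trans HV; apply: ge0_subset_integral => //; try exact: measurable_itv.
by move=> x /=; rewrite !in_itv /= !andbT; exact: le_trans.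
Qed.

Lemma levy_tail_second_moment c : 0 < c -> (nu `[c, +oo[%classic <= (V / c ^+ 2)%:E)%E.
Proof.
move=> c0; have c2 : 0 < c ^+ 2 by rewrite exprn_gt0.
rewrite EFinM muleC -lee_pdivrMl ?invr_gt0 // invrK -integral_cst; last exact: measurable_itv.
apply: le_trans (levy_sq_itv (ltW c0)); apply: ge0_le_integral => //; try exact: measurable_itv.
- by move=> x _; rewrite lee_fin ltW.
- by move=> x /=; rewrite in_itv /= andbT lee_fin => cx; rewrite lerXn2r // nnegrE ?(le_trans (ltW c0)) // ltW.
Qed.

Lemma levy_tail_finite c : 0 < c -> (nu `[c, +oo[%classic < +oo)%E.
Proof. by move=> c0; apply: le_lt_trans (levy_tail_second_moment c0) _; rewrite ltry. Qed.

Lemma levy_first_moment c : 0 < c -> (\int[nu]_(x in `[c, +oo[) x%:E <= (V / c)%:E)%E.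
Proof.
move=> c0; rewrite EFinM muleC -lee_pdivrMl ?invr_gt0 // invrK -ge0_integralZl //; try exact: measurable_itv.
- apply: le_trans (levy_sq_itv (ltW c0)); apply: ge0_le_integral => //; try exact: measurable_itv.
  + by move=> x /=; rewrite in_itv /= andbT -EFinM lee_fin => cx; rewrite mulr_ge0 ?ltW // (lt_le_trans c0).
  + by apply/measurable_EFinP; apply: measurable_funTS; exact: (measurable_funM (measurable_cst _) (@measurable_id _ _ setT)).
  + by move=> x /=; rewrite in_itv /= andbT -EFinM lee_fin expr2 => cx; rewrite ler_wpM2r // (le_trans (ltW c0)).
- by move=> x /=; rewrite in_itv /= andbT lee_fin => cx; rewrite (le_trans (ltW c0)).
- by rewrite lee_fin ltW.
Qed.

Lemma levy_first_moment_ge0 c : 0 < c -> (0 <= \int[nu]_(x in `[c, +oo[) x%:E)%E.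
Proof.
move=> c0; apply: integral_ge0 => x; rewrite /= in_itv /= andbT lee_fin => cx.
by rewrite (le_trans (ltW c0)).
Qed.

Lemma levy_integrable c : 0 < c -> nu.-integrable `[c, +oo[%classic (EFin \o (@id R)).
Proof.
move=> c0; apply/integrableP; split; first by apply/measurable_EFinP; exact: measurable_id.
apply: (@le_lt_trans _ _ (V / c)%:E); last by rewrite ltry.
apply: le_trans (levy_first_moment c0).
rewrite le_eqVlt; apply/orP; left; apply/eqP; apply: eq_integral => x.
by rewrite inE /= in_itv /= andbT => cx; rewrite ger0_norm // (le_trans (ltW c0)).
Qed.

Lemma levy_moment_split c : 1 < c -> \int[nu]_(x in `[1, +oo[) x =
  \int[nu]_(x in `[1, c[) x + \int[nu]_(x in `[c, +oo[) x.
Proof.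
move=> c1; have E : `[1, c[ `|` `[c, +oo[ = `[1, +oo[%classic :> set R.
  by rewrite -itv_bndbnd_setU // bnd_simp ltW.
rewrite -E Rintegral_setU //; first by rewrite E; exact: levy_integrable.
apply/disj_setPS => x [] /=; rewrite !in_itv /= andbT => /andP[_ h1] h2.
by have := lt_le_trans h1 h2; rewrite ltxx.
Qed.

Lemma levy_first_moment_Rintegral c : 0 < c -> 0 <= \int[nu]_(x in `[c, +oo[) x <= V / c.
Proof.
move=> c0; rewrite /Rintegral -!lee_fin fineK.
  by rewrite levy_first_moment_ge0 // levy_first_moment.
rewrite ge0_fin_numE ?levy_first_moment_ge0 //.
by apply: le_lt_trans (levy_first_moment c0) _; rewrite ltry.
Qed.

End levy_measure_tail.

(** * Regular outcomes and the remainder of a Levy process *)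

Section regular_outcomes.
Context d (T : measurableType d) (R : realType) (P : probability T R).
Variables (nu : {sigma_finite_measure set R -> \bar R}) (N : R.-ker T ~> (R * R)%type).
Hypothesis prmN : poisson_random_measure P (time_space_intensity nu) N.
Hypothesis nu_neg : nu `]-oo, 0[%classic = 0%E.
Variable V : R.
Hypothesis HV : (\int[nu]_(x in `[0%R, +oo[) (x ^+ 2)%:E <= V%:E)%E.
Variable tm : R.
Hypothesis tm0 : 0 <= tm.

Let time_rect (E : set R) : set (R * R) := `[0, tm]%classic `*` E.

Let mrect E : measurable E -> measurable (time_rect E).
Proof. by move=> mE; apply: measurableX => //; exact: measurable_itv. Qed.

Let rect_intensity E : measurable E -> time_space_intensity nu (time_rect E) = (tm%:E * nu E)%E.
Proof.
move=> mE; have sub : `[0, tm]%classic `<=` `[0, +oo[%classic by move=> x /=; rewrite !in_itv /= => /andP[-> _].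
rewrite (intensity_rectangle nu (measurable_itv _) mE sub).
congr (_ * _)%E; rewrite lebesgue_measure_itv /= lte_fin.
by move: tm0; rewrite le_eqVlt => /orP[/eqP <-|->]; rewrite ?ltxx ?sube0.
Qed.

(** Almost sure properties that make the integrals of jump sizes against the measure [N w]
    finite, hence additive, outcome by outcome *)
Definition regular e w := [/\ N w (time_rect `]-oo, 0[) = 0%E,
  (N w (time_rect `[e, +oo[) < +oo)%E &
  exists K : nat, N w (time_rect `[K%:R, +oo[) = 0%E].

(** The last property holds because the mean number of jumps above [K] is at most
    [tm * V / K ^ 2]. *)
Lemma regular_ae e : 0 < e -> P.-negligible (~` [set w | regular e w]).
Proof.
move=> e0.
have eqset (A : set (R * R)) (x : \bar R) : measurable A -> measurable [set w | N w A = x].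
  move=> mA; have := prm_measurable N mA measurableT (emeasurable_set1 x).
  by rewrite setTI.
have n1 : P.-negligible [set w | N w (time_rect `]-oo, 0[) <> 0%E].
  have m1 := mrect (measurable_itv `]-oo, 0[).
  exists [set w | N w (time_rect `]-oo, 0[) <> 0%E]; split => //.
    rewrite (_ : [set w | _] = ~` [set w | N w (time_rect `]-oo, 0[) = 0%E]) //.
    by apply: measurableC; exact: eqset.
  apply: (prm_null prmN m1).
  by rewrite rect_intensity ?nu_neg ?mule0 //; exact: measurable_itv.
have fin c : 0 < c -> (time_space_intensity nu (time_rect `[c, +oo[) <= (tm * (V / c ^+ 2))%:E)%E.
  move=> c0; rewrite rect_intensity; last exact: measurable_itv.
  by rewrite EFinM lee_wpmul2l ?lee_fin // levy_tail_second_moment.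
have n2 : P.-negligible [set w | ~ (N w (time_rect `[e, +oo[) < +oo)%E].
  have m2 := mrect (measurable_itv `[e, +oo[).
  have fin2 : (time_space_intensity nu (time_rect `[e, +oo[) < +oo)%E.
    by apply: le_lt_trans (fin _ e0) _; rewrite ltry.
  have [mI PI] := prm_integer prmN m2 fin2.
  exists (~` integer_valued (fun w => N w (time_rect `[e, +oo[))); split => //.
  by move=> w /= h [k _ Nk]; apply: h; rewrite Nk ltry.
have n3 : P.-negligible [set w | ~ exists K : nat, N w (time_rect `[K%:R, +oo[) = 0%E].
  pose Z := \bigcap_(K : nat) [set w | N w (time_rect `[K.+1%:R, +oo[) <> 0%E].
  have mZK (K : nat) : measurable [set w | N w (time_rect `[K.+1%:R, +oo[) <> 0%E].
    rewrite (_ : [set w | _] = ~` [set w | N w (time_rect `[K.+1%:R, +oo[) = 0%E]) //.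
    by apply: measurableC; apply: eqset; apply: mrect; exact: measurable_itv.
  have mZ : measurable Z by apply: bigcapT_measurable.
  exists Z; split => //; last first.
    by move=> w /= h K _ /= NK; apply: h; exists K.+1.
  apply/eqP; rewrite eq_le measure_ge0 andbT; apply/lee_addgt0Pr => eta eta0; rewrite add0e.
  pose K := Num.truncn (tm * V / eta).
  have mK := mrect (measurable_itv `[K.+1%:R, +oo[).
  have K0 : 0 < K.+1%:R :> R by [].
  have KV : tm * (V / K.+1%:R ^+ 2) <= eta.
    have V0 := levy_V_ge0 HV.
    rewrite mulrA ler_pdivrMr ?exprn_gt0 // [leRHS]mulrC -ler_pdivrMr //.
    apply: (@le_trans _ _ K.+1%:R); first by apply: ltW; rewrite truncnS_gt.
    by rewrite expr2 ler_peMl // ler1n.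
  have finK : (time_space_intensity nu (time_rect `[K.+1%:R, +oo[) < +oo)%E.
    by apply: le_lt_trans (fin _ K0) _; rewrite ltry.
  have mu0 : 0 <= fine (time_space_intensity nu (time_rect `[K.+1%:R, +oo[)).
    by rewrite fine_ge0.
  have := poisson_tail (prm_measurable N mK) mu0 (prm_poisson prmN mK finK) 1%N.
  rewrite expr1 fineK ?ge0_fin_numE // => h.
  apply: (@le_trans _ _ (P [set w | N w (time_rect `[K.+1%:R, +oo[) <> 0%E])).
    by apply: le_measure; rewrite ?inE // => w; apply.
  apply: (@le_trans _ _ (time_space_intensity nu (time_rect `[K.+1%:R, +oo[))); last first.
    by apply: le_trans (fin _ K0) _; rewrite lee_fin.
  rewrite (_ : [set w | _] = [set w | forall i : nat, (i < 1)%N ->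
    N w (time_rect `[K.+1%:R, +oo[) <> i%:R%:E]) //.
  by apply/seteqP; split=> w /=; [move=> h0 [|i] // _|move=> /(_ 0%N); exact].
apply: (negligibleS _ (negligibleU n1 (negligibleU n2 n3))).
move=> w /= h; have [h1|h1] := pselect (N w (time_rect `]-oo, 0[) = 0%E); last by left.
right; have [h2|h2] := pselect (N w (time_rect `[e, +oo[) < +oo)%E; last by left.
by right=> h3; apply: h; split.
Qed.

Section pathwise.
Variables (e : R) (w : T).
Hypothesis e0 : 0 < e.
Hypothesis reg : regular e w.

Let msnd D : measurable_fun D (EFin \o (@snd R R)).
Proof. by apply/measurable_EFinP; apply: measurable_funTS; exact: measurable_snd. Qed.

Lemma regular_integrable (A : set (R * R)) : measurable A -> A `<=` time_rect `[e, +oo[ ->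
  (N w).-integrable A (EFin \o snd).
Proof.
move=> mA As; have [_ fin [K NK]] := reg.
have mW := mrect (measurable_itv `[e, +oo[).
have mZ := mrect (measurable_itv `[K%:R, +oo[).
apply: (integrableS mW mA As); apply/integrableP; split; first exact: msnd.
rewrite (ge0_negligible_integral mZ mW _ _ NK) //; last exact: measurableT_comp.
have mWZ := measurableD mW mZ.
apply: (@le_lt_trans _ _ (\int[N w]_(z in time_rect `[e, +oo[ `\` time_rect `[K%:R, +oo[) (K%:R)%:E)%E).
  apply: ge0_le_integral => //.
  - by apply: measurableT_comp.
  - move=> [u v] /= [[/= u1 v1] nz]; rewrite lee_fin.
    move: v1; rewrite in_itv /= andbT => v1.
    rewrite ger0_norm ?(le_trans (ltW e0)) // leNgt; apply/negP => Kv.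
    by apply: nz; split=> //=; rewrite in_itv /= andbT ltW.
rewrite (integral_cst _ mWZ); apply: lte_mul_pinfty => //.
by apply: le_lt_trans fin; apply: le_measure; rewrite ?inE.
Qed.

Let sub_rect t E : t <= tm -> `[0, t]%classic `*` E `<=` time_rect E.
Proof.
by move=> ttm [u v] [/= u1 v1]; split=> //=; move: u1; rewrite !in_itv /= => /andP[-> /le_trans]; apply.
Qed.

Let neg0 t : t <= tm -> N w (`[0, t]%classic `*` `]-oo, 0[%classic) = 0%E.
Proof.
move=> ttm; have [h _ _] := reg; apply: subset_measure0 h; last exact: sub_rect.
  by apply: measurableX; exact: measurable_itv.
exact: mrect (measurable_itv _).
Qed.

Let mX (t : R) (i : interval R) : measurable (`[0, t]%classic `*` [set` i]).
Proof. by apply: measurableX; exact: measurable_itv. Qed.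

Lemma regular_split t (A C : set R) : t <= tm -> measurable A -> measurable C ->
  A `<=` `[e, +oo[ -> C `<=` `[e, +oo[ -> A `&` C = set0 ->
  \int[N w]_(z in `[0, t] `*` (A `|` C)) z.2 =
  \int[N w]_(z in `[0, t] `*` A) z.2 + \int[N w]_(z in `[0, t] `*` C) z.2.
Proof.
move=> ttm mA mC Ae Ce AC0.
have mtA : measurable (`[0, t] `*` A) by apply: measurableX => //; exact: measurable_itv.
have mtC : measurable (`[0, t] `*` C) by apply: measurableX => //; exact: measurable_itv.
have E : `[0, t] `*` (A `|` C) = (`[0, t] `*` A) `|` (`[0, t] `*` C) :> set (R * R).
  by apply/seteqP; split=> -[u v] /= => [[h1 [h2|h2]]|[[h1 h2]|[h1 h2]]]; [left|right|split=> //; left|split=> //; right].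
rewrite E Rintegral_setU //.
- apply: regular_integrable; first exact: measurableU.
  rewrite -E => -[u v] [/= u1 v1]; apply: (sub_rect ttm); split=> //=.
  by case: v1 => [/Ae|/Ce].
- by apply/disj_setPS => -[u v] [[_ /= h1] [_ /= h2]]; have : (A `&` C) v by []; rewrite AC0.
Qed.

Lemma regular_abs t (A C : set R) : t <= tm -> measurable A -> measurable C ->
  A `<=` C -> C `<=` A `|` `]-oo, 0[ ->
  \int[N w]_(z in `[0, t] `*` C) z.2 = \int[N w]_(z in `[0, t] `*` A) z.2.
Proof.
move=> ttm mA mC AC CA.
have mtA : measurable (`[0, t] `*` A) by apply: measurableX => //; exact: measurable_itv.
have mtC : measurable (`[0, t] `*` C) by apply: measurableX => //; exact: measurable_itv.
apply: (Rintegral_null_difference mtA mtC (mX t `]-oo, 0[) _ _ _ (neg0 ttm)).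
- exact: measurable_snd.
- by move=> [u v] [/= h1 h2]; split => //=; exact: AC.
- by move=> [u v] [/= h1 /CA[] h2]; [left|right].
Qed.

Lemma regular_large_jumps t c : t <= tm -> e < 1 -> 1 < c ->
  \int[N w]_(z in `[0, t] `*` [set x | 1 <= `|x|]) z.2 =
  \int[N w]_(z in `[0, t] `*` `[1, c[) z.2 + \int[N w]_(z in `[0, t] `*` `[c, +oo[) z.2.
Proof.
move=> ttm e1 c1.
rewrite (@regular_abs t `[1, +oo[%classic) //; first last.
- move=> x /=; rewrite !in_itv /= andbT; case: (ltP x 0) => [|x0]; first by right.
  by rewrite ger0_norm //; left.
- by move=> x /=; rewrite in_itv /= andbT => x1; rewrite ger0_norm // (le_trans _ x1).
- have mn : measurable_fun setT (fun x : R => `|x|) by exact: measurableT_comp.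
  by have := mn measurableT _ (measurable_itv `[1, +oo[); rewrite setTI (_ : _ @^-1` _ = [set x | 1 <= `|x|]) //;
    apply/seteqP; split=> x /=; rewrite in_itv /= andbT.
have -> : `[1, +oo[%classic = `[1, c[ `|` `[c, +oo[ :> set R.
  by rewrite -itv_bndbnd_setU // bnd_simp ltW.
apply: regular_split => //; try exact: measurable_itv.
- by move=> x /=; rewrite !in_itv /= andbT => /andP[h _]; rewrite (le_trans (ltW e1)).
- by move=> x /=; rewrite !in_itv /= !andbT => h; rewrite (le_trans _ h) // (le_trans (ltW e1) (ltW c1)).
- apply/seteqP; split => // x [] /=; rewrite !in_itv /= andbT => /andP[_ h1] h2.
  by have := lt_le_trans h1 h2; rewrite ltxx.
Qed.

Lemma regular_compensated_jumps t : t <= tm -> e < 1 ->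
  compensated_jumps nu N t e w = jump_martingale nu N e 1 t w.
Proof.
move=> ttm e1; rewrite /compensated_jumps /jump_martingale.
have mabs : measurable [set x : R | e <= `|x| < 1].
  have mn : measurable_fun setT (fun x : R => `|x|) by exact: measurableT_comp.
  by have := mn measurableT _ (measurable_itv `[e, 1[); rewrite setTI (_ : _ @^-1` _ = [set x | e <= `|x| < 1]) //;
    apply/seteqP; split=> x /=; rewrite in_itv.
have s1 : `[e, 1[%classic `<=` [set x : R | e <= `|x| < 1].
  by move=> x /=; rewrite in_itv /= => /andP[x1 x2]; rewrite ger0_norm ?x1 // (le_trans (ltW e0)).
have s2 : [set x : R | e <= `|x| < 1] `<=` `[e, 1[ `|` `]-oo, 0[.
  move=> x /=; rewrite !in_itv /=; case: (ltP x 0) => [|x0]; first by right.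
  by rewrite ger0_norm //; left.
congr (_ - t * _).
  by apply: regular_abs => //; exact: measurable_itv.
apply: (Rintegral_null_difference (measurable_itv _) mabs (measurable_itv _) _ s1 s2 nu_neg).
exact: measurable_id.
Qed.

Lemma regular_jump_martingale t c : t <= tm -> e < 1 -> 1 < c ->
  jump_martingale nu N e 1 t w + jump_martingale nu N 1 c t w = jump_martingale nu N e c t w.
Proof.
move=> ttm e1 c1; rewrite /jump_martingale.
have E : `[e, c[%classic = `[e, 1[ `|` `[1, c[ :> set R.
  by rewrite -itv_bndbnd_setU // bnd_simp ltW.
have D : `[e, 1[ `&` `[1, c[ = set0 :> set R.
  apply/seteqP; split => // x [] /=; rewrite !in_itv /= => /andP[_ h1] /andP[h2 _].
  by have := lt_le_trans h1 h2; rewrite ltxx.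
have s1 : `[e, 1[%classic `<=` `[e, +oo[%classic.
  by move=> x /=; rewrite !in_itv /= => /andP[-> _].
have s2 : `[1, c[%classic `<=` `[e, +oo[%classic.
  by move=> x /=; rewrite !in_itv /= andbT => /andP[/(le_trans (ltW e1)) -> _].
rewrite E (regular_split ttm (measurable_itv _) (measurable_itv _) s1 s2 D).
rewrite Rintegral_setU; [|exact: measurable_itv|exact: measurable_itv| |].
- lra.
- apply: (integrableS _ _ _ (levy_integrable HV e0)); try exact: measurable_itv.
    by apply: measurableU; exact: measurable_itv.
  by move=> x [/s1|/s2].
- by apply/disj_setPS; rewrite D.
Qed.

End pathwise.

End regular_outcomes.

Lemma finite_union_bound d (T : measurableType d) (R : realType) (P : probability T R)
  (A : nat -> set T) (eta : R) n : (forall k, measurable (A k)) ->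
  (forall k, (k < n)%N -> (P (A k) <= eta%:E)%E) ->
  (P (\bigcup_(k < n) A k) <= (n%:R * eta)%:E)%E.
Proof.
move=> mA; elim: n => [|n IH] PA.
  by rewrite bigcup_mkord big_ord0 measure0 mul0r.
have mU : measurable (\bigcup_(k < n) A k) by rewrite bigcup_mkord; exact: bigsetU_measurable.
rewrite bigcup_mkord big_ord_recr /= -bigcup_mkord.
apply: (@le_trans _ _ (P (\bigcup_(k < n) A k) + P (A n))%E); first exact: measureU2.
rewrite -[n.+1]addn1 natrD mulrDl mul1r EFinD; apply: leeD; last exact: PA.
by apply: IH => k kn; apply: PA; rewrite ltnS ltnW.
Qed.

Section levy_grid_bound.
Context d (T : measurableType d) (R : realType) (P : probability T R).
Variables (nu : {sigma_finite_measure set R -> \bar R}) (N : R.-ker T ~> (R * R)%type).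
Hypothesis prmN : poisson_random_measure P (time_space_intensity nu) N.
Hypothesis nu_neg : nu `]-oo, 0[%classic = 0%E.
Variable V : R.
Hypothesis HV : (\int[nu]_(x in `[0%R, +oo[) (x ^+ 2)%:E <= V%:E)%E.
Variables (a b : R) (B X : R -> T -> R).
Hypothesis BM : standard_brownian_motion P B.
Hypothesis mX : forall t, 0 <= t -> measurable_fun setT (X t).
Hypothesis XE : forall t, 0 <= t -> exists2 M : T -> R, compensated_integral P nu N t M &
  {ae P, forall w, X t w = b * t + a * B t w + M w +
     \int[N w]_(z in `[0, t] `*` [set x | 1 <= `|x|]) z.2}.

(** What is left of the centred process once its jumps of size at least [c] are removed *)
Definition levy_remainder (c t : R) (w : T) : R :=
  X t w - b * t - t * \int[nu]_(x in `[1, +oo[) x - \int[N w]_(z in `[0, t] `*` `[c, +oo[) z.2.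

Lemma levy_remainder_measurable c t : 0 <= t -> measurable_fun setT (levy_remainder c t).
Proof.
move=> t0; apply: measurable_funB.
  by apply: measurable_funB => //; apply: measurable_funB => //; exact: mX.
by apply: jump_integral_measurable; apply: measurableX; exact: measurable_itv.
Qed.

Let compensated_jumps_measurable t e : measurable_fun setT (compensated_jumps nu N t e).
Proof.
apply: measurable_funB => //; apply: jump_integral_measurable.
apply: measurableX; first exact: measurable_itv.
have mn : measurable_fun setT (fun x : R => `|x|) by exact: measurableT_comp.
by have := mn measurableT _ (measurable_itv `[e, 1[); rewrite setTI (_ : _ @^-1` _ = [set x | e <= `|x| < 1]) //;
  apply/seteqP; split=> x /=; rewrite in_itv.
Qed.

(** Chebyshev's inequality: the compensated integral is the limit in mean square of its
    truncations. *)
Let compensation_error t M x eta : 0 < x -> 0 < eta -> compensated_integral P nu N t M ->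
  \forall e \near 0^'+, (P [set w | (x < `|M w - compensated_jumps nu N t e w|)%R] <= eta%:E)%E.
Proof.
move=> x0 eta0 [mM cM].
have ex0 : 0 < eta * x ^+ 2 by rewrite mulr_gt0 // exprn_gt0.
have : \forall e \near 0^'+, (\int[P]_w ((M w - compensated_jumps nu N t e w) ^+ 2)%:E < (eta * x ^+ 2)%:E)%E.
  have nb : nbhs (0%E : \bar R) [set y | (y < (eta * x ^+ 2)%:E)%E].
    by apply: open_nbhs_nbhs; split; [exact: open_ereal_lt_ereal|rewrite /= lte_fin].
  exact: cM nb.
apply: filterS => e he.
have mg : measurable_fun setT (fun w => M w - compensated_jumps nu N t e w) by exact: measurable_funB.
have x2 : 0 < x ^+ 2 by rewrite exprn_gt0.
have := le_integral_abse P measurableT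
  (g := fun w => ((M w - compensated_jumps nu N t e w) ^+ 2)%:E) (a := x ^+ 2) _ x2.
have mg2 : measurable_fun setT (fun w => ((M w - compensated_jumps nu N t e w) ^+ 2)%:E).
  by apply/measurable_EFinP; exact: measurable_funX.
move=> /(_ mg2); rewrite setTI => h.
rewrite -(@lee_pmul2l _ (x ^+ 2)%:E) //.
apply: (@le_trans _ _ ((x ^+ 2)%:E * P [set w | ((x ^+ 2)%:E <= `|((M w - compensated_jumps nu N t e w) ^+ 2)%:E|)%E])%E).
  rewrite lee_pmul2l //; apply: le_measure; rewrite ?inE.
  - rewrite -[X in measurable X]setTI; apply: (measurable_fun_ltr (measurable_cst _)) => //.
    exact: measurableT_comp.
  - rewrite -[X in measurable X]setTI; apply: emeasurable_fun_c_infty => //.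
    exact: measurableT_comp.
  - move=> w /= xw; rewrite lee_fin ger0_norm ?sqr_ge0 //
     -[leRHS]real_normK ?num_real // lerXn2r ?nnegrE ?normr_ge0 ?(ltW x0) ?(ltW xw) //.
apply: (le_trans h); rewrite -EFinM mulrC; apply: le_trans (ltW he).
rewrite le_eqVlt; apply/orP; left; apply/eqP; apply: eq_integral => w _.
by rewrite /= ger0_norm // sqr_ge0.
Qed.

Variables (m : nat) (tau : nat -> R).
Hypothesis tau0 : 0 <= tau 0%N.
Hypothesis tau_homo : {homo tau : i j / (i <= j)%N >-> i <= j}.
Hypothesis taum : 0 < tau m.

(** Up to a truncation error that disappears as [e] decreases to 0, the remainder is the sum
    of the Brownian part, of the compensated jumps between [e] and [c], and of the drift
    compensating the jumps above [c]. They are allowed [2 * x], [3 * x] and [x], and the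
    truncation error [x], whence the 7. *)
Theorem levy_grid_bound (c s x q z : R) : 1 < c -> 0 < s -> 0 < x -> 0 < z ->
  (nu `[((2 * s)^-1)%R, +oo[%classic <= q%:E)%E ->
  `|a| * z <= x -> tau m * \int[nu]_(y in `[c, +oo[) y <= x ->
  let D := expR (- (s * x) + 2 * s ^+ 2 * (tau m * V) + expR (s * c) * (tau m * q)) in
  let G := Num.sqrt 2 * expR (- (z ^+ 2 / (4 * tau m))) in
  2 * D <= 2^-1 -> G <= 2^-1 ->
  (P (\bigcup_(k < m.+1) [set w | (7 * x < `|levy_remainder c (tau k) w|)%R])
    <= (4 * D + 2 * G)%:E)%E.
Proof.
move=> c1 s0 x0 z0 Hq az kx D G D2 G2.
have tk0 k : 0 <= tau k by apply: le_trans tau0 _; exact: tau_homo.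
have /choice[M HM] : forall k, exists M, compensated_integral P nu N (tau k) M /\
    {ae P, forall w, X (tau k) w = b * tau k + a * B (tau k) w + M w +
      \int[N w]_(z in `[0, tau k] `*` [set x | 1 <= `|x|]) z.2}.
  by move=> k; have [M h1 h2] := XE (tk0 k); exists M.
apply/lee_addgt0Pr => eta eta0.
have eta'0 : 0 < eta / m.+1%:R by rewrite divr_gt0.
have : \forall e \near 0^'+, forall k : 'I_m.+1,
    (P [set w | (x < `|M k w - compensated_jumps nu N (tau k) e w|)%R] <= (eta / m.+1%:R)%:E)%E.
  by apply: filter_forall => k; have [h _] := HM k; exact: compensation_error.
move=> err; have [e [e0 e1 {}err]] : exists e, [/\ 0 < e, e < 1 & forall k : 'I_m.+1,
    (P [set w | (x < `|M k w - compensated_jumps nu N (tau k) e w|)%R] <= (eta / m.+1%:R)%:E)%E].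
  near (at_right (0 : R)) => e; exists e; split.
  - by near: e; exact: nbhs_right_gt.
  - by near: e; apply: nbhs_right_lt.
  - by near: e; exact: err.
pose E k := [set w | (x < `|M k w - compensated_jumps nu N (tau k) e w|)%R].
have mE k : measurable (E k).
  rewrite /E -[X in measurable X]setTI; apply: (measurable_fun_ltr (measurable_cst _)) => //.
  apply: measurableT_comp => //; apply: measurable_funB => //; by have [[]] := HM k.
have PE : (P (\bigcup_(k < m.+1) E k) <= eta%:E)%E.
  have -> : eta = m.+1%:R * (eta / m.+1%:R) by rewrite mulrC divfK.
  by apply: finite_union_bound => // k km; have := err (Ordinal km).
pose J := \bigcup_(k < m.+1) [set w | (3 * x < `|jump_martingale nu N e c (tau k) w|)%R].
have PJ : (P J <= (4 * D)%:E)%E.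
  apply: (jump_martingale_maximal prmN tau0 tau_homo e0 _ _ s0 x0 HV Hq D2).
  - exact: lt_trans e1 c1.
  - exact: levy_tail_finite HV _ e0.
have mJ : measurable J.
  rewrite /J bigcup_mkord; apply: bigsetU_measurable => k _.
  rewrite -[X in measurable X]setTI; apply: (measurable_fun_ltr (measurable_cst _)) => //.
  apply: measurableT_comp => //; exact: jump_martingale_measurable.
pose W := \bigcup_(k < m.+1) [set w | (2 * z < `|B (tau k) w|)%R].
have PW : (P W <= (2 * G)%:E)%E := brownian_maximal BM tau0 tau_homo taum z0 G2.
have mW : measurable W.
  rewrite /W bigcup_mkord; apply: bigsetU_measurable => k _.
  rewrite -[X in measurable X]setTI; apply: (measurable_fun_ltr (measurable_cst _)) => //.
  by apply: measurableT_comp => //; have [[mB _] _ _ _] := BM; exact: mB.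
have mEU : measurable (\bigcup_(k < m.+1) E k) by rewrite bigcup_mkord; apply: bigsetU_measurable.
have [Z [mZ PZ sZ]] : P.-negligible (~` [set w | regular N (tau m) e w /\ forall k : nat,
    X (tau k) w = b * tau k + a * B (tau k) w + M k w +
      \int[N w]_(z in `[0, tau k] `*` [set x | 1 <= `|x|]) z.2]).
  have n1 := regular_ae prmN nu_neg HV (ltW taum) e0.
  have n2 : P.-negligible (~` [set w | forall k : nat, X (tau k) w = b * tau k + a * B (tau k) w + M k w +
      \int[N w]_(z in `[0, tau k] `*` [set x | 1 <= `|x|]) z.2]).
    by apply: ae_foralln => k; have [] := HM k.
  by apply: negligibleS (negligibleU n1 n2) => w /= h; apply: contrapT => /not_orP[/contrapT h1 /contrapT h2]; apply: h.
have mL : measurable (\bigcup_(k < m.+1) [set w | (7 * x < `|levy_remainder c (tau k) w|)%R]).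
  rewrite bigcup_mkord; apply: bigsetU_measurable => k _.
  rewrite -[X in measurable X]setTI; apply: (measurable_fun_ltr (measurable_cst _)) => //.
  by apply: measurableT_comp => //; exact: levy_remainder_measurable.
apply: (@le_trans _ _ (P (Z `|` (J `|` (W `|` \bigcup_(k < m.+1) E k))))).
  apply: le_measure; rewrite ?inE //.
    by apply: measurableU => //; apply: measurableU => //; exact: measurableU.
  move=> w [k /= km]; apply: contraPP => /= nU; apply/negP; rewrite -leNgt.
  have /not_orP[nZ /not_orP[nJ /not_orP[nW nE]]] := nU.
  have [reg XkE] : regular N (tau m) e w /\ forall k : nat, X (tau k) w = b * tau k + a * B (tau k) w + M k w +
      \int[N w]_(z in `[0, tau k] `*` [set x | 1 <= `|x|]) z.2 by apply: contrapT => h; apply: nZ; exact: sZ.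
  have ktm : tau k <= tau m by exact: tau_homo.
  have hJ : `|jump_martingale nu N e c (tau k) w| <= 3 * x.
    by rewrite leNgt; apply/negP => h; apply: nJ; exists k.
  have hW : `|B (tau k) w| <= 2 * z.
    by rewrite leNgt; apply/negP => h; apply: nW; exists k.
  have hE : `|M k w - compensated_jumps nu N (tau k) e w| <= x.
    by rewrite leNgt; apply/negP => h; apply: nE; exists k.
  have /andP[kc0 _] := levy_first_moment_Rintegral HV (lt_trans ltr01 c1).
  have hK : 0 <= tau k * \int[nu]_(y in `[c, +oo[) y <= x.
    by rewrite mulr_ge0 //=; apply: le_trans kx; rewrite ler_wpM2r.
  have hB : `|a * B (tau k) w| <= 2 * x.
    rewrite normrM; apply: le_trans (ler_wpM2l (normr_ge0 a) hW) _.
    by rewrite mulrCA ler_pM2l.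
  have := regular_jump_martingale HV e0 reg ktm e1 c1.
  have := regular_compensated_jumps nu_neg e0 reg ktm e1.
  move: hE hJ hB hK; rewrite /levy_remainder XkE (regular_large_jumps e0 reg ktm e1 c1) (levy_moment_split HV c1).
  rewrite /jump_martingale mulrDr.
  move: (compensated_jumps _ _ _ _ _) (M k w) (a * B _ _) (b * _) => C Mk aB bt.
  rewrite !ler_norml => hE hJ hB hK CE E3; move: CE E3 hE hJ hB hK.
  lra.
apply: le_trans (measureU2 _ _ _) _ => //; first by apply: measurableU => //; exact: measurableU.
rewrite -[leRHS]add0e; apply: leeD; first by rewrite le_eqVlt; apply/orP; left; apply/eqP; exact: PZ.
apply: le_trans (measureU2 _ _ _) _ => //; first exact: measurableU.
rewrite !EFinD -addeA; apply: leeD => //.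
apply: le_trans (measureU2 _ _ _) _ => //.
by apply: leeD.
Unshelve. all: by end_near. Qed.

End levy_grid_bound.

Lemma Rintegral_between d (X : measurableType d) (R : realType) (mu : {measure set X -> \bar R})
  (S : set X) (f : X -> R) (lo hi : R) : measurable S -> (mu S < +oo)%E ->
  measurable_fun S f -> (forall x, S x -> lo <= f x <= hi) ->
  lo * fine (mu S) <= \int[mu]_(x in S) f x <= hi * fine (mu S).
Proof.
move=> mS Sfin mf Hf.
have ic (r : R) : mu.-integrable S (EFin \o cst r).
  apply/integrableP; split; first by apply/measurable_EFinP; exact: measurable_cst.
  rewrite (eq_integral (cst (`|r|%:E))) // integral_cst //.
  by rewrite lte_mul_pinfty // lee_fin.
have fi : mu.-integrable S (EFin \o f).
  apply: (@le_integrable _ _ _ mu S mS _ (EFin \o cst (`|lo| + `|hi|))) => //.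
    exact/measurable_EFinP.
  move=> x Sx /=; rewrite lee_fin (ger0_norm (addr_ge0 (normr_ge0 _) (normr_ge0 _))).
  have /andP[h1 h2] := Hf x Sx; rewrite ler_norml.
  have := ler_norm hi; have := ler_norm (- lo); rewrite normrN.
  have := normr_ge0 hi; have := normr_ge0 lo; lra.
have cE (r : R) : \int[mu]_(x in S) (cst r x) = r * fine (mu S) by rewrite Rintegral_cst.
apply/andP; split; rewrite -cE; apply: le_Rintegral => // x Sx.
  by have /andP[] := Hf x Sx.
by have /andP[] := Hf x Sx.
Qed.

(** * Counting large jumps *)

Section cumulative_measure.
Context (R : realType) (mu : {measure set (R * R) -> \bar R}) (A : set (R * R)).
Hypothesis mA : measurable A.
Hypothesis finA : (mu A < +oo)%E.

Definition strip (I : interval R) : set (R * R) := A `&` ([set` I] `*` setT).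

Lemma strip_measurable I : measurable (strip I).
Proof. by apply: measurableI => //; apply: measurableX => //; exact: measurable_itv. Qed.

Lemma strip_finite I : (mu (strip I) < +oo)%E.
Proof. by apply: le_lt_trans finA; apply: le_measure; rewrite ?inE //; [exact: strip_measurable|exact: subIsetl]. Qed.

Let small (F : nat -> set (R * R)) (e : R) : 0 < e -> (forall i, measurable (F i)) ->
  (forall i, F i `<=` A) -> {homo F : n m / (n <= m)%N >-> m `<=` n} ->
  mu (\bigcap_i F i) = 0%E -> exists i, (mu (F i) < e%:E)%E.
Proof.
move=> e0 mF FA Fh F0.
have h : (mu \o F) x @[x --> \oo] --> mu (\bigcap_n F n).
  apply: nonincreasing_cvg_mu => //; last 2 first.
  - exact: bigcapT_measurable.
  - by move=> i j ij; apply/subsetPset; exact: Fh.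
  - by apply: le_lt_trans finA; apply: le_measure; rewrite ?inE.
move: h; rewrite F0 => h.
have nb : nbhs (0%E : \bar R) [set y | (y < e%:E)%E].
  by apply: open_nbhs_nbhs; split; [exact: open_ereal_lt_ereal|rewrite /= lte_fin].
have [i _ /(_ i (leqnn i))] := h _ nb; by exists i.
Qed.

Lemma strip_right t e : 0 < e -> exists2 v, t < v & (mu (strip `]t, v]) < e%:E)%E.
Proof.
move=> e0; pose F (i : nat) := strip `]t, (t + i.+1%:R^-1)].
have [//| |i hi] := small (F := F) e0 (fun i => strip_measurable _) (fun i => @subIsetl _ _ _); last first.
- by exists (t + i.+1%:R^-1) => //; rewrite ltrDl invr_gt0.
- rewrite (_ : \bigcap_i F i = set0) ?measure0 //; apply/seteqP; split=> // -[u v] /= h.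
  have [_ [/= tu _]] := h 0%N I; move: tu; rewrite in_itv /= => /andP[tu _].
  have ut : 0 < u - t by rewrite subr_gt0.
  have [i _ /(_ i (leqnn i)) /= hi] := near_infty_natSinv_lt (PosNum ut).
  have [_ [/= ]] := h i I; rewrite in_itv /= => /andP[_ ui] _.
  by move: hi; move: ui; move: (_^-1) => z; lra.
- move=> i j ij [u v] [Auv [/= + _]]; rewrite in_itv /= => /andP[u1 u2]; split=> //; split=> //=.
  rewrite in_itv /= u1 (le_trans u2) // lerD2l lef_pV2 ?posrE // ler_nat //.
Qed.

Lemma strip_left t e : 0 < e -> mu (strip `[t, t]) = 0%E ->
  exists2 v, v < t & (mu (strip `]v, t]) < e%:E)%E.
Proof.
move=> e0 t0; pose F (i : nat) := strip `](t - i.+1%:R^-1), t].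
have [| |i hi] := small (F := F) e0 (fun i => strip_measurable _) (fun i => @subIsetl _ _ _); last first.
- by exists (t - i.+1%:R^-1) => //; rewrite ltrBlDr ltrDl invr_gt0.
- rewrite (_ : \bigcap_i F i = strip `[t, t]) //; apply/seteqP; split=> -[u v] /= h.
    have [Auv [/= + _]] := h 0%N I; rewrite in_itv /= => /andP[_ ut].
    split=> //; split=> //=; rewrite in_itv /= ut andbT leNgt; apply/negP => tu.
    have tu0 : 0 < t - u by rewrite subr_gt0.
    have [i _ /(_ i (leqnn i)) /= hi] := near_infty_natSinv_lt (PosNum tu0).
    have [_ [/= ]] := h i I; rewrite in_itv /= => /andP[ui _] _.
    by move: hi; move: ui; move: (_^-1) => z; lra.
  move=> i _; have [Auv [/= + _]] := h; rewrite in_itv /= => /andP[u1 u2].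
  split=> //; split=> //=; rewrite in_itv /= u2 andbT (lt_le_trans _ u1) //.
  by rewrite ltrBlDr ltrDl invr_gt0.
- move=> i j ij [u v] [Auv [/= + _]]; rewrite in_itv /= => /andP[u1 u2]; split=> //; split=> //=.
  rewrite in_itv /= u2 andbT (le_lt_trans _ u1) // lerD2l lerN2 lef_pV2 ?posrE // ler_nat //.
Qed.

Lemma strip_split t v : 0 <= t -> t <= v ->
  mu (strip `[0, v]) = (mu (strip `[0%R, t]) + mu (strip `]t, v]))%E.
Proof.
move=> t0 tv; rewrite -measureU //; try exact: strip_measurable.
- congr (mu _); apply/seteqP; split=> -[x y] /=.
    move=> [Axy [/= + _]]; rewrite in_itv /= => /andP[x0 xv].
    by have [xt|xt] := leP x t; [left|right]; split=> //; split=> //=; rewrite in_itv /= ?x0 ?xt.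
  move=> [] [Axy [/= + _]]; rewrite in_itv /= => /andP[x0 xv]; split=> //; split=> //=; rewrite in_itv /=.
    by rewrite x0 (le_trans xv).
  by rewrite xv andbT ltW // (le_lt_trans t0).
- apply/seteqP; split=> // -[x y] [[_ [/= + _]] [_ [/= + _]]]; rewrite !in_itv /= => /andP[_ h1] /andP[h2 _].
  by have := lt_le_trans h2 h1; rewrite ltxx.
Qed.

Variable tm : R.
Hypothesis tm0 : 0 < tm.

Lemma dyadic_between t v : 0 <= t -> t < v -> v <= tm ->
  exists r k : nat, [/\ (k <= 2 ^ r)%N, t < tm * (k%:R / (2 ^ r)%:R) & tm * (k%:R / (2 ^ r)%:R) < v].
Proof.
move=> t0 tv vtm.
have e0 : 0 < (v - t) / tm by rewrite divr_gt0 // subr_gt0.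
have [r _ /(_ r (leqnn r)) /= hr] := near_infty_natSinv_expn_lt (PosNum e0).
have q0 : 0 < (2 ^ r)%:R :> R by rewrite ltr0n expn_gt0.
have hr' : tm / (2 ^ r)%:R < v - t.
  by rewrite mulrC -ltr_pdivlMr // natrX; move: hr; rewrite div1r.
pose k := (Num.truncn (t * (2 ^ r)%:R / tm)).+1.
have arg0 : 0 <= t * (2 ^ r)%:R / tm by rewrite !mulr_ge0 ?invr_ge0 // ltW.
have k1 : t < tm * (k%:R / (2 ^ r)%:R).
  rewrite mulrA ltr_pdivlMr // [ltRHS]mulrC -ltr_pdivrMr //; exact: truncnS_gt.
have k2 : tm * (k%:R / (2 ^ r)%:R) < v.
  have h : (Num.truncn (t * (2 ^ r)%:R / tm))%:R <= t * (2 ^ r)%:R / tm by rewrite truncn_le.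
  have : tm * ((Num.truncn (t * (2 ^ r)%:R / tm))%:R / (2 ^ r)%:R) <= t.
    by rewrite mulrA ler_pdivrMr // mulrC -ler_pdivlMr.
  rewrite /k -natr1 mulrDl mulrDr div1r; lra.
exists r, k; split => //.
have : k%:R / (2 ^ r)%:R < 1 :> R by rewrite -(ltr_pM2l tm0) mulr1 (lt_le_trans k2).
by rewrite ltr_pdivrMr // mul1r ltr_nat => /ltnW.
Qed.

(** The dyadic times being dense, right-continuity turns integer counts at dyadic times
    into integer counts at all times. *)
Lemma strip_integer t : 0 <= t <= tm ->
  (forall r k : nat, (k <= 2 ^ r)%N -> exists i : nat, mu (strip `[0, (tm * (k%:R / (2 ^ r)%:R))]) = i%:R%:E) ->
  exists i : nat, mu (strip `[0, t]) = i%:R%:E.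
Proof.
move=> /andP[t0 ttm] H.
have [->|tn] := eqVneq t tm.
  by have := H 0%N 1%N isT; rewrite divff ?mulr1 // expn0 oner_eq0.
have tlt : t < tm by rewrite lt_neqAle tn.
have ftE : mu (strip `[0, t]) = (fine (mu (strip `[0, t])))%:E.
  by rewrite fineK // ge0_fin_numE ?measure_ge0 // strip_finite.
have close e : 0 < e -> exists2 i : nat, fine (mu (strip `[0, t])) <= i%:R & i%:R < fine (mu (strip `[0, t])) + e.
  move=> e0; have [v tv mv] := strip_right t e0.
  have tv' : t < minr v tm by rewrite lt_min tv.
  have vtm : minr v tm <= tm by rewrite ge_min lexx orbT.
  have [r [k [kr q1 q2]]] := dyadic_between t0 tv' vtm.
  have [i qi] := H r k kr; exists i; rewrite -?lee_fin -?lte_fin ?EFinD -ftE -qi (strip_split t0 (ltW q1)).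
    by rewrite leeDl // measure_ge0.
  rewrite lteD2lE; last by rewrite ge0_fin_numE ?measure_ge0 //; exact: strip_finite.
  apply: le_lt_trans mv; apply: le_measure; rewrite ?inE; try exact: strip_measurable.
  move=> [x y] [Axy [/= + _]]; rewrite in_itv /= => /andP[x1 x2]; split=> //; split=> //=.
  by rewrite in_itv /= x1 (le_trans x2) // ltW // (lt_le_trans q2) // ge_min lexx.
have h2 : 0 < 2^-1 :> R by rewrite invr_gt0.
have [i i1 i2] := close _ h2; exists i; rewrite ftE; congr EFin.
apply/eqP; rewrite eq_le i1 /=; apply/ler_addgt0Pr => e e0.
have m0 : 0 < minr e 2^-1 by rewrite lt_min e0.
have [j j1 j2] := close _ m0.
have me : minr e 2^-1 <= e by rewrite ge_min lexx.
have mh : minr e 2^-1 <= 2^-1 by rewrite ge_min lexx orbT.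
have ij : i = j.
  apply/eqP; rewrite eqn_leq; apply/andP; split; rewrite -ltnS -(ltr_nat R) -natr1;
    move: j2 mh; move: (minr _ _) => q'; lra.
by rewrite ij; move: j2 me; move: (minr _ _) => q; lra.
Qed.

End cumulative_measure.

Section large_jumps.
Context d (T : measurableType d) (R : realType) (N : R.-ker T ~> (R * R)%type).

Definition large_jumps (c t : R) (w : T) : R := \int[N w]_(z in `[0, t] `*` `[c, +oo[) z.2.

Variables (tm c : R) (w : T).
Hypothesis c0 : 0 < c.
Hypothesis reg : regular N tm c w.

Local Notation A := (`[0, tm]%classic `*` `[c, +oo[%classic).

Let mA : measurable A.
Proof. by apply: measurableX; exact: measurable_itv. Qed.

Let finA : (N w A < +oo)%E. Proof. by have [] := reg. Qed.

Lemma large_jumps_increment : exists2 K, 0 <= K & forall t v, 0 <= t -> t <= v -> v <= tm ->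
  0 <= large_jumps c v w - large_jumps c t w <= K * fine (N w (strip A `]t, v])).
Proof.
have [_ _ [K NK]] := reg; exists K%:R => // t v t0 tv vtm.
pose S := `]t, v]%classic `*` `[c, +oo[%classic.
pose S' := `]t, v]%classic `*` `[c, K%:R[%classic.
have mS : measurable S by apply: measurableX; exact: measurable_itv.
have mS' : measurable S' by apply: measurableX; exact: measurable_itv.
have mK : measurable (`[0, tm]%classic `*` `[K%:R, +oo[%classic : set (R * R)).
  by apply: measurableX; exact: measurable_itv.
have m0t : measurable (`[0, t]%classic `*` `[c, +oo[%classic : set (R * R)).
  by apply: measurableX; exact: measurable_itv.
have SE : strip A `]t, v] = S.
  apply/seteqP; split=> -[x y]; rewrite /strip /S /=; first by move=> [[_ ?] [? _]].
  move=> [h1 h2]; split=> //; split=> //; move: h1; rewrite !in_itv /= => /andP[x1 x2].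
  by rewrite (le_trans t0 (ltW x1)) (le_trans x2).
have dif : large_jumps c v w - large_jumps c t w = \int[N w]_(z in S) z.2.
  have E : `[0, v]%classic `*` `[c, +oo[%classic = (`[0, t]%classic `*` `[c, +oo[%classic) `|` S :> set (R * R).
    apply/seteqP; split=> -[x y]; rewrite /S /= !in_itv /=.
      move=> [/andP[x0 xv] hy]; have [xt|xt] := leP x t; [left|right]; by rewrite ?x0 ?xv ?xt.
    move=> [[/andP[x0 xt] hy]|[/andP[tx xv] hy]]; rewrite hy; split=> //.
      by rewrite x0 (le_trans xt).
    by rewrite xv (le_trans t0 (ltW tx)).
  rewrite /large_jumps E Rintegral_setU //; first by rewrite addrC addKr.
  - apply: (regular_integrable c0 reg); first exact: measurableU.
    by rewrite -E => -[x y] [/= h1 h2]; split=> //=; move: h1; rewrite !in_itv /= => /andP[-> /le_trans]; apply.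
  - apply/disj_setPS => -[x y] [[/= h1 _] [/= h2 _]].
    move: h1 h2; rewrite !in_itv /= => /andP[_ h1] /andP[h2 _].
    by have := lt_le_trans h2 h1; rewrite ltxx.
have dif' : \int[N w]_(z in S) z.2 = \int[N w]_(z in S') z.2.
  apply: (Rintegral_null_difference mS' mS mK _ _ _ NK); first exact: measurable_snd.
    by move=> [x y] [/= h1]; rewrite /S /= !in_itv /= => /andP[h2 _]; split=> //; rewrite h2.
  move=> [x y] [/= h1]; rewrite in_itv /= andbT => h2.
  have [yK|Ky] := ltP y K%:R; first by left; rewrite /S' /=; split=> //; rewrite in_itv /= h2.
  right; rewrite /=; split; last by rewrite in_itv /= Ky.
  by move: h1; rewrite !in_itv /= => /andP[x1 x2]; rewrite (le_trans t0 (ltW x1)) (le_trans x2).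
have finS : (N w S < +oo)%E by rewrite -SE; exact: strip_finite.
have SS : S' `<=` S by move=> [x y] [/= h1]; rewrite /S /= !in_itv /= => /andP[h2 _]; split=> //; rewrite h2.
have finS' : (N w S' < +oo)%E by apply: le_lt_trans finS; apply: le_measure; rewrite ?inE.
rewrite dif dif'.
have /andP[h1 h2] : c * fine (N w S') <= \int[N w]_(z in S') z.2 <= K%:R * fine (N w S').
  apply: Rintegral_between => //; first by apply: measurable_funTS; exact: measurable_snd.
  by move=> [x y] [/= _]; rewrite in_itv /= => /andP[-> /ltW ->].
apply/andP; split.
  by apply: le_trans h1; rewrite mulr_ge0 ?(ltW c0) // fine_ge0.
apply: (le_trans h2); rewrite ler_wpM2l // SE fine_le ?ge0_fin_numE //.
by apply: le_measure; rewrite ?inE.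
Qed.

Lemma large_jumps0 : 0 <= tm -> N w (strip A `[0, 0]) = 0%E -> large_jumps c 0 w = 0.
Proof.
move=> tm0 h; have m0 : measurable (`[0, 0]%classic `*` `[c, +oo[%classic : set (R * R)).
  by apply: measurableX; exact: measurable_itv.
rewrite /large_jumps -[RHS](_ : \int[N w]_(z in set0) z.2 = 0); last by rewrite /Rintegral integral_set0.
apply: (Rintegral_null_difference measurable0 m0 (strip_measurable mA `[0, 0]) _ _ _ h) => //.
move=> [x y] [/= h1 h2]; right; rewrite /strip /=; split=> //; split=> //.
by move: h1; rewrite !in_itv /= => /andP[-> /le_trans]; apply.
Qed.

Lemma large_jumps_right_continuous t e : 0 <= t < tm -> 0 < e ->
  exists2 v, t < v <= tm & forall u, t <= u <= v -> `|large_jumps c u w - large_jumps c t w| <= e.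
Proof.
move=> /andP[t0 ttm] e0; have [K K0 inc] := large_jumps_increment.
have e1 : 0 < e / (K + 1) by rewrite divr_gt0 // ltr_wpDl.
have [v tv mv] := strip_right mA finA t e1.
exists (minr v tm); first by rewrite lt_min tv ttm ge_min lexx orbT.
move=> u /andP[tu]; rewrite le_min => /andP[uv utm].
have /andP[h1 h2] := inc t u t0 tu utm; rewrite ger0_norm //.
apply: (le_trans h2).
have : fine (N w (strip A `]t, u])) <= e / (K + 1).
  rewrite -lee_fin fineK; last by rewrite ge0_fin_numE ?measure_ge0 //; exact: strip_finite.
  apply: le_trans (ltW mv); apply: le_measure; rewrite ?inE; try exact: strip_measurable.
  move=> [x y] [Axy [/= + _]]; rewrite in_itv /= => /andP[x1 x2]; split=> //; split=> //=.
  by rewrite in_itv /= x1 (le_trans x2).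
move=> /(ler_wpM2l K0) /le_trans; apply.
rewrite mulrCA -[leRHS]mulr1 ler_pM2l // ler_pdivrMr ?mul1r; last by rewrite ltr_wpDl.
by rewrite lerDl.
Qed.

Lemma large_jumps_left_continuous t e : 0 < t <= tm -> 0 < e -> N w (strip A `[t, t]) = 0%E ->
  exists2 v, 0 <= v < t & large_jumps c t w <= large_jumps c v w + e.
Proof.
move=> /andP[t0 ttm] e0 Nt; have [K K0 inc] := large_jumps_increment.
have e1 : 0 < e / (K + 1) by rewrite divr_gt0 // ltr_wpDl.
have [v vt mv] := strip_left mA finA e1 Nt.
exists (maxr v 0); first by rewrite le_max lexx orbT gt_max vt.
have v0 : 0 <= maxr v 0 by rewrite le_max lexx orbT.
have vt' : maxr v 0 <= t by rewrite ge_max !ltW.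
have /andP[h1 h2] := inc _ t v0 vt' ttm; rewrite -lerBlDl; apply: (le_trans h2).
have : fine (N w (strip A `](maxr v 0), t])) <= e / (K + 1).
  rewrite -lee_fin fineK; last by rewrite ge0_fin_numE ?measure_ge0 //; exact: strip_finite.
  apply: le_trans (ltW mv); apply: le_measure; rewrite ?inE; try exact: strip_measurable.
  move=> [x y] [Axy [/= + _]]; rewrite in_itv /= => /andP[x1 x2]; split=> //; split=> //=.
  by rewrite in_itv /= x2 andbT (le_lt_trans _ x1) // le_max lexx.
move=> /(ler_wpM2l K0) /le_trans; apply.
rewrite mulrCA -[leRHS]mulr1 ler_pM2l // ler_pdivrMr ?mul1r; last by rewrite ltr_wpDl.
by rewrite lerDl.
Qed.

End large_jumps.

(** * Uniformity in time *)

Section levy_bad_event.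
Context d (T : measurableType d) (R : realType) (P : probability T R).
Variables (nu : {sigma_finite_measure set R -> \bar R}) (N : R.-ker T ~> (R * R)%type).
Hypothesis prmN : poisson_random_measure P (time_space_intensity nu) N.
Hypothesis nu_neg : nu `]-oo, 0[%classic = 0%E.
Variable V : R.
Hypothesis HV : (\int[nu]_(x in `[0%R, +oo[) (x ^+ 2)%:E <= V%:E)%E.
Variables (a b : R) (B : R -> T -> R) (X : T -> cadlag_path R).
Hypothesis BM : standard_brownian_motion P B.
Hypothesis mX : forall t, 0 <= t -> measurable_fun setT (fun w => X w t).
Hypothesis XE : forall t, 0 <= t -> exists2 M : T -> R, compensated_integral P nu N t M &
  {ae P, forall w, X w t = b * t + a * B t w + M w +
     \int[N w]_(z in `[0, t] `*` [set x | 1 <= `|x|]) z.2}.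

Let rem := levy_remainder nu N b (fun t w => X w t).

Let rem_right_continuous tm c w t : 0 < c -> regular N tm c w -> 0 <= t < tm ->
  rem c u w @[u --> t^'+] --> rem c t w.
Proof.
move=> c0 reg /andP[t0 ttm]; apply: cvgB; last first.
  apply/cvgrPdist_le => e e0.
  have [|v /andP[tv vtm] Hv] := large_jumps_right_continuous c0 reg _ e0 (t := t); first by rewrite t0.
  near=> u; rewrite distrC; apply: Hv; apply/andP; split.
    by apply: ltW; near: u; exact: nbhs_right_gt.
  by near: u; apply: nbhs_right_le.
apply: cvgB; last by apply: cvgMr_tmp; apply: cvg_at_right_filter; exact: cvg_id.
apply: cvgB; last by apply: cvgMl_tmp; apply: cvg_at_right_filter; exact: cvg_id.
by have [h _] := cadlag_funP (X w); exact: h.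
Unshelve. all: by end_near. Qed.

(** The bound of [levy_grid_bound] does not depend on the grid, so it survives the increasing
    union over dyadic grids; right-continuity of the remainder reaches the other times. *)
Theorem levy_bad_event (tm c s x q z : R) : 0 < tm -> 1 < c -> 0 < s -> 0 < x -> 0 < z ->
  (nu `[((2 * s)^-1)%R, +oo[%classic <= q%:E)%E ->
  `|a| * z <= x -> tm * \int[nu]_(y in `[c, +oo[) y <= x ->
  let D := expR (- (s * x) + 2 * s ^+ 2 * (tm * V) + expR (s * c) * (tm * q)) in
  let G := Num.sqrt 2 * expR (- (z ^+ 2 / (4 * tm))) in
  2 * D <= 2^-1 -> G <= 2^-1 ->
  exists Z, [/\ measurable Z, (P Z <= (4 * D + 2 * G)%:E)%E &
    forall w, ~ Z w -> regular N tm c w /\ forall t, 0 <= t <= tm -> `|rem c t w| <= 7 * x].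
Proof.
move=> tm0 c1 s0 x0 z0 Hq az kx D G D2 G2.
have c0 : 0 < c by exact: lt_trans c1.
pose g (r k : nat) : R := tm * (k%:R / (2 ^ r)%:R).
have g0 r k : 0 <= g r k by rewrite mulr_ge0 ?divr_ge0 // ltW.
have gtm r : g r (2 ^ r)%N = tm by rewrite /g divff ?mulr1 // pnatr_eq0 expn_eq0.
pose U (r : nat) := \bigcup_(k < (2 ^ r).+1) [set w | (7 * x < `|rem c (g r k) w|)%R].
have PU r : (P (U r) <= (4 * D + 2 * G)%:E)%E.
  have := @levy_grid_bound _ _ _ P nu N prmN nu_neg V HV a b B (fun t w => X w t) BM mX XE
    (2 ^ r)%N (g r) (g0 r 0%N) _ _ c s x q z c1 s0 x0 z0 Hq az.
  rewrite gtm; apply => //.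
  by move=> i j ij; rewrite ler_pM2l // ler_wpM2r ?invr_ge0 // ler_nat.
have mU r : measurable (U r).
  rewrite /U bigcup_mkord; apply: bigsetU_measurable => k _.
  rewrite -[X in measurable X]setTI; apply: (measurable_fun_ltr (measurable_cst _)) => //.
  by apply: measurableT_comp => //; exact: levy_remainder_measurable.
have mUU : measurable (\bigcup_r U r) by exact: bigcupT_measurable.
have PUU : (P (\bigcup_r U r) <= (4 * D + 2 * G)%:E)%E.
  have h : (P \o U) r @[r --> \oo] --> P (\bigcup_r U r).
    apply: nondecreasing_cvg_mu => //; apply/nondecreasing_seqP => r; apply/subsetPset => w [k /= kr Hk].
    exists (2 * k)%N => /=; first by rewrite ltnS expnS leq_mul2l /= -ltnS.
    suff -> : g r.+1 (2 * k)%N = g r k by [].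
    by rewrite /g expnS !natrM -mulf_div divff ?mul1r.
  have <- := cvg_lim _ h => //.
  by apply: lime_le; [apply/cvg_ex; eexists; exact: h|exact: nearW].
have [Z1 [mZ1 PZ1 sZ1]] := regular_ae prmN nu_neg HV (ltW tm0) c0.
exists (Z1 `|` \bigcup_r U r); split; first exact: measurableU.
  apply: le_trans (measureU2 _ mZ1 mUU) _; rewrite -[leRHS]add0e; apply: leeD => //.
  by rewrite le_eqVlt; apply/orP; left; apply/eqP; exact: PZ1.
move=> w /not_orP[nZ nU].
have reg : regular N tm c w by apply: contrapT => h; apply: nZ; exact: sZ1.
have good r k : (k <= 2 ^ r)%N -> `|rem c (g r k) w| <= 7 * x.
  by move=> kr; rewrite leNgt; apply/negP => h; apply: nU; exists r => //; exists k.
split=> // t /andP[t0]; rewrite le_eqVlt => /orP[/eqP ->|ttm].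
  by rewrite -(gtm 0%N); exact: good.
rewrite leNgt; apply/negP => h.
have rc : `|rem c u w| @[u --> t^'+] --> `|rem c t w|.
  by apply: cvg_norm; apply: (rem_right_continuous c0 reg); rewrite t0.
have [v tv Hv] : exists2 v, t < v & forall u, t < u < v -> 7 * x < `|rem c u w|.
  have /cvgrPdist_lt /(_ (`|rem c t w| - 7 * x)) := rc; rewrite subr_gt0 => /(_ h) [e /= e0 He].
  exists (t + e); first by rewrite ltrDl.
  move=> u /andP[tu ut]; have := He u; rewrite /= distrC ger0_norm ?subr_ge0 ?(ltW tu) //.
  rewrite ltrBlDl => /(_ ut tu); rewrite ltr_distlC => /andP[]; lra.
have tv' : t < minr v tm by rewrite lt_min tv.
have [|r [k [kr q1 q2]]] := dyadic_between tm0 t0 tv'; first by rewrite ge_min lexx orbT.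
have := Hv (g r k); rewrite q1 (lt_le_trans q2) ?ge_min ?lexx // => /(_ isT).
by rewrite ltNge good.
Qed.

End levy_bad_event.

(** * Asymptotics on the logarithmic scale *)

Section power_asymptotics.
Context (R : realType).
Implicit Types (A B C a b g p r eta : R).

Lemma powR_unbounded p C : 0 < p -> \forall l \near +oo, C <= l `^ p.
Proof.
move=> p0; near=> l.
have h : `|C| `^ p^-1 <= l by near: l; apply: nbhs_pinfty_ge; rewrite ?num_real.
apply: le_trans (ler_norm C) _; have p1 : p != 0 by rewrite gt_eqF.
rewrite -[leLHS](@powRr1 _ `|C|) // -(mulVf p1) powRrM.
apply: ge0_ler_powR; rewrite ?nnegrE ?powR_ge0 ?(ltW p0) //.
Unshelve. all: by end_near. Qed.

Lemma powR_dominates_affine g A B C : 1 < g -> 0 < C -> \forall l \near +oo, A + B * l <= C * l `^ g.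
Proof.
move=> g1 C0; have gm : 0 < g - 1 by rewrite subr_gt0.
near=> l.
have l1 : 1 <= l by near: l; apply: nbhs_pinfty_ge; rewrite ?num_real.
have h : (`|A| + `|B|) / C <= l `^ (g - 1) by near: l; exact: powR_unbounded.
have l0 : 0 <= l by rewrite (le_trans ler01).
rewrite -(mulr_powRB1 l0 (lt_trans ltr01 g1)) mulrCA.
have h2 : `|A| + `|B| <= C * l `^ (g - 1) by move: h; rewrite ler_pdivrMr // mulrC.
apply: le_trans (ler_wpM2l l0 h2).
have hA := ler_norm A; have hB : B * l <= `|B| * l by rewrite ler_wpM2r ?ler_norm.
have : `|A| * 1 <= `|A| * l by rewrite ler_wpM2l.
by rewrite mulrDr (mulrC l) (mulrC l); lra.
Unshelve. all: by end_near. Qed.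

Lemma powR_shift_ge g a eta : 0 < g -> 0 < eta -> \forall l \near +oo, (1 - eta) * l `^ g <= (l + a) `^ g.
Proof.
move=> g0 eta0; have [e1|e1] := leP 1 eta.
  near=> l; apply: (@le_trans _ _ 0); last exact: powR_ge0.
  by rewrite mulr_le0_ge0 ?powR_ge0 // subr_le0.
pose r := (1 - eta) `^ g^-1.
have e2 : 0 <= 1 - eta by rewrite subr_ge0 ltW.
have rg : r `^ g = 1 - eta by rewrite /r -powRrM mulVf ?gt_eqF // powRr1.
have r0 : 0 <= r by exact: powR_ge0.
have r1 : r < 1.
  have := @gt0_ltr_powR _ g^-1 _ (1 - eta) 1; rewrite invr_gt0 => /(_ g0).
  by rewrite powR1; apply; rewrite ?nnegrE // gtrBl.
near=> l.
have l0 : 0 <= l by near: l; apply: nbhs_pinfty_ge; rewrite ?num_real.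
have la : - a <= (1 - r) * l.
  by rewrite mulrC -ler_pdivrMr ?subr_gt0 //; near: l; apply: nbhs_pinfty_ge; rewrite ?num_real.
rewrite -rg -powRM //; apply: ge0_ler_powR; rewrite ?nnegrE ?mulr_ge0 ?(ltW g0) //.
- by have := mulr_ge0 r0 l0; move: la; rewrite mulrBl; lra.
- by move: la; rewrite mulrBl; lra.
Unshelve. all: by end_near. Qed.

Lemma powR_shift_le g a eta : 0 < g -> 0 < eta -> \forall l \near +oo, (l + a) `^ g <= (1 + eta) * l `^ g.
Proof.
move=> g0 eta0; pose r := (1 + eta) `^ g^-1.
have e2 : 0 <= 1 + eta by rewrite addr_ge0 // ltW.
have rg : r `^ g = 1 + eta by rewrite /r -powRrM mulVf ?gt_eqF // powRr1.
have r1 : 1 < r.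
  have := @gt0_ltr_powR _ g^-1 _ 1 (1 + eta); rewrite invr_gt0 => /(_ g0).
  by rewrite powR1; apply; rewrite ?nnegrE // ltrDl.
near=> l.
have l0 : 0 <= l by near: l; apply: nbhs_pinfty_ge; rewrite ?num_real.
have la0 : - a <= l by near: l; apply: nbhs_pinfty_ge; rewrite ?num_real.
have la : a <= (r - 1) * l.
  by rewrite mulrC -ler_pdivrMr ?subr_gt0 //; near: l; apply: nbhs_pinfty_ge; rewrite ?num_real.
rewrite -rg -powRM //; last exact: ltW (lt_trans ltr01 r1).
apply: ge0_ler_powR; rewrite ?nnegrE ?mulr_ge0 ?(ltW g0) //.
- by lra.
- exact: ltW (lt_trans ltr01 r1).
- by move: la; rewrite mulrBl; lra.
Unshelve. all: by end_near. Qed.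

(** The increment is at least [(b - a) * (l + a) ^ (g - 1)]. *)
Lemma powR_gap g a b C : 1 < g -> a < b -> \forall l \near +oo, C <= (l + b) `^ g - (l + a) `^ g.
Proof.
move=> g1 ab; have gm : 0 < g - 1 by rewrite subr_gt0.
have g0 : 0 < g by exact: lt_trans g1.
have ba : 0 < b - a by rewrite subr_gt0.
have [M [Mr HM]] : \forall m \near +oo, C / (b - a) <= m `^ (g - 1) by exact: powR_unbounded.
near=> l.
have l0 : 1 - a <= l by near: l; apply: nbhs_pinfty_ge; rewrite num_real.
have h : C / (b - a) <= (l + a) `^ (g - 1).
  by apply: HM; rewrite -ltrBlDr; near: l; apply: nbhs_pinfty_gt; rewrite num_real.
have la : 0 <= l + a by lra.
have lb : 0 <= l + b by lra.
rewrite -(mulr_powRB1 la g0) -(mulr_powRB1 lb g0).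
have mono : (l + a) `^ (g - 1) <= (l + b) `^ (g - 1).
  by apply: ge0_ler_powR; rewrite ?nnegrE ?(ltW gm) // lerD2l ltW.
have := ler_wpM2l lb mono; move: h; rewrite ler_pdivrMr //.
by rewrite mulrBr !mulrDl; move: (_ `^ _) (_ `^ _) => x y; lra.
Unshelve. all: by end_near. Qed.

Lemma expR_dominates_powR p A : \forall l \near +oo, A * l `^ p <= expR l.
Proof.
pose k := (Num.truncn `|p|).+2.
have pk : p <= k%:R - 1.
  rewrite /k -natr1 addrK; apply: le_trans (ler_norm p) _; apply: ltW; exact: truncnS_gt.
have k0 : 0 < k%:R :> R by [].
near=> l.
have l1 : 1 <= l by near: l; apply: nbhs_pinfty_ge; rewrite ?num_real.
have l0 : 0 < l by exact: lt_le_trans l1.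
have hA : `|A| * k%:R ^+ k <= l by near: l; apply: nbhs_pinfty_ge; rewrite ?num_real.
have h1 : l `^ p <= l `^ (k%:R - 1) by exact: ler_powR.
have h2 : (l / k%:R) ^+ k <= expR l.
  have -> : expR l = expR (l / k%:R) ^+ k by rewrite -expRM_natr divfK // gt_eqF.
  rewrite lerXn2r ?nnegrE ?expR_ge0 ?divr_ge0 ?(ltW l0) //.
  by apply: le_trans (expR_ge1Dx _); rewrite lerDr.
apply: le_trans h2.
apply: (@le_trans _ _ (`|A| * l `^ (k%:R - 1))).
  apply: (@le_trans _ _ (`|A| * l `^ p)); first by rewrite ler_wpM2r ?powR_ge0 ?ler_norm.
  by rewrite ler_wpM2l.
rewrite expr_div_n -powR_mulrn ?(ltW l0) // ler_pdivlMr ?exprn_gt0 //.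
by rewrite -(mulr_powRB1 (ltW l0) k0) mulrAC ler_wpM2r ?powR_ge0.
Unshelve. all: by end_near. Qed.

End power_asymptotics.

Section lognormal_tail.
Context (R : realType) (nu : {sigma_finite_measure set R -> \bar R}).
Variables (c beta lambda gamma : R).
Hypothesis c0 : 0 < c.
Hypothesis lambda0 : 0 < lambda.
Hypothesis gamma1 : 1 < gamma.
Hypothesis tail : \forall x \near +oo,
  nu `[x, +oo[%classic = (c * x `^ beta * expR (- (lambda * ln x `^ gamma)))%:E.

Let half_split (p q r t : R) : p = r + q -> q <= p / 2 -> t <= p / 2 -> t <= r.
Proof. lra. Qed.

Let gamma0 : 0 < gamma. Proof. exact: lt_trans gamma1. Qed.

(** With [l] the logarithm of the time horizon, all asymptotic statements about the tail
    become statements about powers of [l]. *)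
Lemma tail_log_scale y : 0 < y -> \forall l \near +oo, nu `[(expR l * y)%R, +oo[%classic =
  (expR (ln c + beta * (l + ln y) - lambda * (l + ln y) `^ gamma))%:E.
Proof.
move=> y0; have [M [Mr HM]] := tail; near=> l.
have yl : expR l * y = expR (l + ln y) by rewrite expRD lnK.
rewrite HM.
  rewrite yl expRK -expRM -{1}(lnK c0) -!expRD (mulrC beta).
  by [].
have : M / y < l by near: l; apply: nbhs_pinfty_gt; rewrite num_real.
rewrite ltr_pdivrMr // => h; apply: (lt_trans h); rewrite ltr_pM2r //.
by apply: lt_le_trans (expR_ge1Dx _); rewrite ltrDr.
Unshelve. all: by end_near. Qed.

Lemma tail_upper delta eta : 0 < delta -> 0 < eta -> \forall l \near +oo,
  ((expR l)%:E * nu `[(expR l * delta)%R, +oo[%classic <= (expR (- ((lambda - eta) * l `^ gamma)))%:E)%E.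
Proof.
move=> delta0 eta0.
have e1 : 0 < eta / 2 / lambda by rewrite !divr_gt0.
have e2 : 0 < eta / 2 by rewrite divr_gt0.
near=> l.
have -> : nu `[(expR l * delta)%R, +oo[%classic =
  (expR (ln c + beta * (l + ln delta) - lambda * (l + ln delta) `^ gamma))%:E.
  by near: l; exact: tail_log_scale.
rewrite -EFinM lee_fin -expRD ler_expR.
have h1 : (1 - eta / 2 / lambda) * l `^ gamma <= (l + ln delta) `^ gamma by near: l; exact: powR_shift_ge.
have h2 : (ln c + beta * ln delta) + (1 + beta) * l <= eta / 2 * l `^ gamma.
  by near: l; exact: powR_dominates_affine.
have := ler_wpM2l (ltW lambda0) h1; rewrite mulrA mulrBr mulr1.
have -> : lambda * (eta / 2 / lambda) = eta / 2 by rewrite mulrC divfK // gt_eqF.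
by move: h2; move: (l `^ gamma) ((l + _) `^ _) => x y; lra.
Unshelve. all: by end_near. Qed.

(** By [powR_gap] the tail above [z'] is eventually at most half of the tail above [z], so
    the window between them has at least half of the mass of the latter. *)
Lemma tail_window z z' eta : 0 < z -> z < z' -> 0 < eta -> \forall l \near +oo,
  ((expR (- ((lambda + eta) * l `^ gamma)))%:E <= nu `[(expR l * z)%R, (expR l * z')%R[%classic)%E.
Proof.
move=> z0 zz' eta0; have zh0 : 0 < z' by exact: lt_trans zz'.
have e1 : 0 < eta / 2 / lambda by rewrite !divr_gt0.
have e2 : 0 < eta / 2 by rewrite divr_gt0.
have lzh : ln z < ln z' by rewrite ltr_ln ?posrE.
have T1 := tail_log_scale z0.
have T2 := tail_log_scale zh0.
have T12 := filterI T1 T2.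
have T3 := powR_gap ((ln 2 + beta * (ln z' - ln z)) / lambda) gamma1 lzh.
have T4 := powR_shift_le (ln z) gamma0 e1.
have T5 := powR_dominates_affine (ln 2 - ln c - beta * ln z) (- beta) gamma1 e2.
have T345 := filterI T3 (filterI T4 T5).
near=> l.
have [E1 E2] : nu `[(expR l * z)%R, +oo[%classic =
    (expR (ln c + beta * (l + ln z) - lambda * (l + ln z) `^ gamma))%:E /\
  nu `[(expR l * z')%R, +oo[%classic =
    (expR (ln c + beta * (l + ln z') - lambda * (l + ln z') `^ gamma))%:E by near: l; exact: T12.
have [g [h1 h2]] :
  (ln 2 + beta * (ln z' - ln z)) / lambda <= (l + ln z') `^ gamma - (l + ln z) `^ gamma /\
  ((l + ln z) `^ gamma <= (1 + eta / 2 / lambda) * l `^ gamma /\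
   (ln 2 - ln c - beta * ln z) + (- beta) * l <= eta / 2 * l `^ gamma) by near: l; exact: T345.
move: E1 E2; set u1 := ln c + beta * (l + ln z) - _; set u2 := ln c + beta * (l + ln z') - _.
have ab : expR l * z <= expR l * z' by rewrite ler_pM2l ?expR_gt0 // ltW.
move: ab; move: (expR l * z) (expR l * z') => a b ab E1 E2.
have sum : nu `[a, +oo[%classic = (nu `[a, b[%classic + nu `[b, +oo[%classic)%E.
  rewrite -measureU; try exact: measurable_itv.
    by congr (nu _); rewrite -itv_bndbnd_setU // bnd_simp.
  apply/seteqP; split=> // x [] /=; rewrite !in_itv /= andbT => /andP[_ q1] q2.
  by have := lt_le_trans q1 q2; rewrite ltxx.
move: sum; rewrite E1 E2 => sum.
have fw : nu `[a, b[%classic \is a fin_num.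
  rewrite ge0_fin_numE ?measure_ge0 //; apply: (@le_lt_trans _ _ (expR u1)%:E); last exact: ltry.
  by rewrite sum leeDl // lee_fin expR_ge0.
rewrite -(fineK fw) lee_fin; move: sum; rewrite -(fineK fw) -EFinD => -[] sum.
have u21 : u2 <= u1 - ln 2.
  move: g; rewrite ler_pdivrMr // /u1 /u2.
  by move: (_ `^ _) (_ `^ _) => x y; lra.
have {}h1 : lambda * (l + ln z) `^ gamma <= lambda * l `^ gamma + eta / 2 * l `^ gamma.
  apply: le_trans (ler_wpM2l (ltW lambda0) h1) _.
  rewrite mulrA mulrDr mulr1 mulrDl lerD2l.
  by rewrite [lambda * _]mulrC divfK // gt_eqF.
have lo : - ((lambda + eta) * l `^ gamma) <= u1 - ln 2.
  move: h1 h2; rewrite /u1; clear; move: (l `^ gamma) (_ `^ gamma) (ln c) (ln z) (ln 2) => x y p q r.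
  lra.
have half u : expR (u - ln 2) = expR u / 2 by rewrite expRD expRN lnK // posrE.
apply: (half_split sum); first by rewrite -half ler_expR.
by rewrite -half ler_expR.
Unshelve. all: by end_near. Qed.

(** Near 0 this is part of the definition of a Levy measure; at infinity, dyadic blocks are
    summable since the tail is eventually less than [x ^ -4]. *)
Lemma levy_second_moment_finite : levy_measure nu ->
  exists V : R, (\int[nu]_(x in `[0%R, +oo[) (x ^+ 2)%:E <= V%:E)%E.
Proof.
move=> [_ lev]; pose f (x : R) : \bar R := (x ^+ 2)%:E.
have f0 x : (0 <= f x)%E by rewrite lee_fin sqr_ge0.
have mf D : measurable_fun D f.
  by apply/measurable_EFinP; apply: measurable_funTS; exact: measurable_funX.
pose g (x : R) : \bar R := (minr 1 (`|x| ^+ 2))%:E.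
have g0 x : (0 <= g x)%E by rewrite lee_fin le_min ler01 sqr_ge0.
have mg : measurable_fun setT g.
  apply/measurable_EFinP; apply: measurable_minr => //; apply: measurable_funX.
  exact: normr_measurable.
have tail1 : (nu `[1%R, +oo[%classic < +oo)%E.
  apply: le_lt_trans lev; rewrite -[leLHS]mul1e -integral_cst; last exact: measurable_itv.
  apply: (@le_trans _ _ (\int[nu]_(x in `[1%R, +oo[) g x)%E); last first.
    by apply: ge0_subset_integral => //; exact: measurable_itv.
  apply: ge0_le_integral => //; try exact: measurable_itv; first exact: measurable_funTS.
  move=> x /=; rewrite in_itv /= andbT => x1; rewrite lee_fin le_min lexx.
  by rewrite exprn_ege1 // ger0_norm // (le_trans _ x1).
have small : (\int[nu]_(x in `[0%R, 1%R[) f x < +oo)%E.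
  apply: le_lt_trans lev; apply: (@le_trans _ _ (\int[nu]_(x in `[0%R, 1%R[) g x)%E); last first.
    by apply: ge0_subset_integral => //; exact: measurable_itv.
  apply: ge0_le_integral => //; try exact: measurable_itv; first exact: measurable_funTS.
  move=> x /=; rewrite in_itv /= => /andP[x0 x1]; rewrite lee_fin le_min (ger0_norm x0) lexx andbT.
  by rewrite exprn_ile1 // ltW.
pose I (J : nat) := (\int[nu]_(x in `[0%R, (2 ^+ J)%R[) f x)%E.
have p2 (J : nat) : 0 < 2 ^+ J :> R by rewrite exprn_gt0.
have step J : (I J.+1 <= I J + ((4 * 4 ^+ J)%:E * nu `[(2 ^+ J)%R, +oo[%classic))%E.
  have E : `[0%R, (2 ^+ J.+1)%R[%classic = `[0, (2 ^+ J)[ `|` `[(2 ^+ J), (2 ^+ J.+1)[ :> set R.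
    rewrite -itv_bndbnd_setU // bnd_simp ?(ltW (p2 J)) //.
    by rewrite exprS ler_peMl ?(ltW (p2 J)) // ler1n.
  rewrite /I E ge0_integral_setU //; try exact: measurable_itv.
    apply: leeD => //.
    apply: (@le_trans _ _ (\int[nu]_(x in `[(2 ^+ J)%R, +oo[) (cst (4 * 4 ^+ J)%:E x))%E); last first.
      by rewrite integral_cst //; exact: measurable_itv.
    apply: (@le_trans _ _ (\int[nu]_(x in `[(2 ^+ J)%R, (2 ^+ J.+1)%R[) (cst (4 * 4 ^+ J)%:E x))%E).
      apply: ge0_le_integral => //; try exact: measurable_itv.
      move=> x /=; rewrite in_itv /= => /andP[x0 x1]; rewrite lee_fin.
      have x00 : 0 <= x by apply: le_trans x0; exact: ltW.
      have -> : 4 * 4 ^+ J = (2 ^+ J.+1) ^+ 2 :> R.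
        by rewrite -exprS -exprM mulnC exprM -[2 ^+ 2]/(2 * 2) -natrM.
      by rewrite lerXn2r ?nnegrE ?(ltW (p2 _)) // ltW.
    apply: ge0_subset_integral => //; try exact: measurable_itv.
    - by move=> x _; rewrite lee_fin mulr_ge0 // exprn_ge0.
    - by move=> x /=; rewrite !in_itv /= => /andP[-> _].
  apply/disj_setPS => x [] /=; rewrite !in_itv /= => /andP[_ h1] /andP[h2 _].
  by have := lt_le_trans h1 h2; rewrite ltxx.
have Ifin J : (I J < +oo)%E.
  elim: J => [|J IH]; first by rewrite /I expr0.
  apply: le_lt_trans (step J) _; rewrite lte_add_pinfty // lte_mul_pinfty //.
  apply: le_lt_trans tail1; apply: le_measure; rewrite ?inE; try exact: measurable_itv.
  move=> x /=; rewrite !in_itv /= !andbT => h; apply: le_trans h.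
  by apply: exprn_ege1; rewrite ler1n.
have [j0 Hj0] : exists j0 : nat, forall J, (j0 <= J)%N ->
    (nu `[(2 ^+ J)%R, +oo[%classic <= ((4 ^+ J)^-1 ^+ 2)%:E)%E.
  have [M [Mr HM]] : \forall l \near +oo, (nu `[(expR l * 1)%R, +oo[%classic <= (expR (- (4 * l)))%:E)%E.
    near=> l; have -> : nu `[(expR l * 1)%R, +oo[%classic =
        (expR (ln c + beta * (l + ln 1) - lambda * (l + ln 1) `^ gamma))%:E.
      by near: l; exact: tail_log_scale.
    rewrite lee_fin ler_expR ln1 addr0.
    have : ln c + (4 + beta) * l <= lambda * l `^ gamma by near: l; exact: powR_dominates_affine.
    by rewrite mulrDl; lra.
  have l20 : 0 < ln 2 :> R by rewrite ln_gt0 // ltr1n.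
  exists (Num.truncn (`|M| / ln 2)).+1 => J hJ.
  have hJ' : M < J%:R * ln 2.
    rewrite -ltr_pdivrMr //; apply: (@lt_le_trans _ _ (Num.truncn (`|M| / ln 2)).+1%:R); last by rewrite ler_nat.
    apply: le_lt_trans (truncnS_gt _); rewrite ler_pM2r ?invr_gt0 //; exact: ler_norm.
  have E2 : expR (J%:R * ln 2) = 2 ^+ J :> R by rewrite mulrC expRM_natr lnK // posrE.
  have := HM _ hJ'; rewrite mulr1 E2 => /le_trans; apply; rewrite lee_fin.
  rewrite -mulNr mulrA -[- 4 * J%:R]mulrC -mulrA mulrC expRM_natr.
  have -> : expR (- 4 * ln 2) = ((4 ^-1) ^+ 2) :> R.
    have f4 : 4 = 2 ^+ 2 :> R by rewrite expr2 -natrM.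
    rewrite mulNr expRN (expRM_natl 4) lnK ?posrE // exprVn; congr (_^-1).
    by rewrite f4 -exprM.
  by rewrite -exprVn exprAC.
have bound i : (I (j0 + i)%N <= I j0 + (8 * (1 - (4 ^+ i)^-1))%:E)%E.
  elim: i => [|i IH]; first by rewrite addn0 expr0 invr1 subrr mulr0 adde0.
  rewrite addnS; apply: le_trans (step _) _.
  apply: (@le_trans _ _ (I j0 + (8 * (1 - (4 ^+ i)^-1))%:E + (4 * (4 ^+ i)^-1)%:E)%E).
    apply: leeD => //; have p4 (k : nat) : 0 < 4 ^+ k :> R by rewrite exprn_gt0.
    apply: le_trans (lee_wpmul2l _ (Hj0 _ (leq_addr i j0))) _.
      by rewrite lee_fin mulr_ge0 // exprn_ge0.
    rewrite -EFinM lee_fin -mulrA ler_pM2l // expr2 mulrA divff ?mul1r ?gt_eqF //.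
    rewrite lef_pV2 ?posrE // exprD ler_peMl ?(ltW (p4 i)) // exprn_ege1 // ler1n //.
  rewrite -addeA -EFinD leeD2l // lee_fin exprS invfM.
  have : 0 <= (4 ^+ i)^-1 :> R by rewrite invr_ge0 exprn_ge0.
  move: (_ ^-1) => y; lra.
exists (fine (I j0) + 8).
have -> : `[0%R, +oo[%classic = \bigcup_i `[0%R, (2 ^+ (j0 + i))%R[%classic :> set R.
  apply/seteqP; split=> x /=; last by move=> [i _ /=]; rewrite !in_itv /= => /andP[-> _].
  rewrite in_itv /= andbT => x0; exists (Num.truncn x).+1 => //=; rewrite in_itv /= x0 /=.
  apply: lt_le_trans (truncnS_gt x) _; rewrite -natrX ler_nat.
  by apply: leq_trans (ltnW (ltn_expl _ (isT : (1 < 2)%N))) _; rewrite leq_exp2l // leq_addl.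
have hF : {homo (fun i => `[0%R, (2 ^+ (j0 + i))%R[%classic : set R) : n m / (n <= m)%N >-> (n <= m)%O}.
  move=> m n mn; apply/subsetPset => x /=; rewrite !in_itv /= => /andP[-> /lt_le_trans]; apply.
  by rewrite -!natrX ler_nat leq_exp2l // leq_add2l.
have cv := @ge0_nondecreasing_set_cvg_integral _ _ _ _ f nu hF (fun i => measurable_itv _)
  (fun i => mf _) (fun i x _ => f0 x).
rewrite -(cvg_lim _ cv) //; apply: lime_le; first by apply/cvg_ex; eexists; exact: cv.
apply: nearW => i; apply: le_trans (bound i) _.
rewrite EFinD fineK; last by rewrite ge0_fin_numE //; apply: integral_ge0.
apply: leeD2l; rewrite lee_fin.
have : 0 <= (4 ^+ i)^-1 :> R by rewrite invr_ge0 exprn_ge0.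
move: (_ ^-1) => y; lra.
Unshelve. all: by end_near. Qed.

End lognormal_tail.

Lemma pinfty_half (R : realType) (Q : R -> Prop) :
  (\forall m \near +oo, Q m) -> \forall l \near +oo, Q (l / 2).
Proof.
by move=> [M [Mr H]]; exists (M * 2); split; [rewrite num_real|move=> l Ml; apply: H; rewrite ltr_pdivlMr].
Qed.

Lemma pinfty_ln_nat (R : realType) (Q : R -> Prop) :
  (\forall l \near +oo, Q l) -> \forall n \near \oo, Q (ln n.+1%:R).
Proof.
move=> [M [Mr H]]; exists (Num.truncn (expR M)).+1 => // n /= Mn; apply: H.
rewrite -[ltLHS]expRK ltr_ln ?posrE ?expR_gt0 //.
by apply: lt_trans (truncnS_gt _) _; rewrite ltr_nat ltnS.
Qed.

(** * Approximation by large jumps *)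

Definition large_jump_approximation d (T : measurableType d) (R : realType) (P : probability T R)
    (N : R.-ker T ~> (R * R)%type) (gamma : R) (Y : nat -> T -> skorokhod R)
    (K eps delta : R) (n : nat) :=
  exists Z, [/\ measurable Z, (P Z <= (expR (- (K * ln n.+1%:R `^ gamma)))%:E)%E &
    forall w, ~ Z w -> regular N n.+1%:R (n.+1%:R * delta) w /\
      forall t, 0 <= t <= 1 ->
        `|Y n w t - n.+1%:R^-1 * large_jumps N (n.+1%:R * delta) (n.+1%:R * t) w| <= eps].

Section coordinate_bad_event.
Context d (T : measurableType d) (R : realType) (P : probability T R).
Variables (nu : {sigma_finite_measure set R -> \bar R}) (N : R.-ker T ~> (R * R)%type).
Hypothesis prmN : poisson_random_measure P (time_space_intensity nu) N.
Hypothesis nu_neg : nu `]-oo, 0[%classic = 0%E.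
Variable V : R.
Hypothesis HV : (\int[nu]_(x in `[0%R, +oo[) (x ^+ 2)%:E <= V%:E)%E.
Variables (a b : R) (B : R -> T -> R) (X : T -> cadlag_path R).
Hypothesis BM : standard_brownian_motion P B.
Hypothesis mX : forall t, 0 <= t -> measurable_fun setT (fun w => X w t).
Hypothesis XE : forall t, 0 <= t -> exists2 M : T -> R, compensated_integral P nu N t M &
  {ae P, forall w, X w t = b * t + a * B t w + M w +
     \int[N w]_(z in `[0, t] `*` [set x | 1 <= `|x|]) z.2}.
Variables (c beta lambda gamma : R).
Hypothesis c0 : 0 < c.
Hypothesis lambda0 : 0 < lambda.
Hypothesis gamma1 : 1 < gamma.
Hypothesis tail : \forall x \near +oo,
  nu `[x, +oo[%classic = (c * x `^ beta * expR (- (lambda * ln x `^ gamma)))%:E.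

Let gamma0 : 0 < gamma. Proof. exact: lt_trans gamma1. Qed.

Let cancelE (x y E : R) : E != 0 -> x / E * (y * E) = x * y.
Proof. by move=> E0; rewrite mulrACA mulVf ?mulr1. Qed.

(** The probability is bounded by [6 * W] with [W = expR (2 - (K + 1) * y)]; the spare factor
    [expR (- y)] absorbs the constants. *)
Let exponent_bound (K W y D G : R) : 0 < K -> 0 < y -> ln 6 + 2 <= y -> W = expR (- ((K + 1) * y) + 2) ->
  D <= W -> G <= W -> [/\ 2 * D <= 2^-1, G <= 2^-1 & 4 * D + 2 * G <= expR (- (K * y))].
Proof.
move=> K0 y0 y1 WE DW GW.
have W0 : 0 <= W by rewrite WE expR_ge0.
have key : 6 * W <= expR (- (K * y)).
  rewrite WE -[6 in leLHS](@lnK R) ?posrE // -expRD ler_expR mulrDl mul1r.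
  by move: y1; move: (ln 6) (K * y) => p q; lra.
have le1 : expR (- (K * y)) <= 1.
  by rewrite -expR0 ler_expR oppr_le0 mulr_ge0 ?ltW.
by split; move: DW GW key le1 W0; move: (expR _) => u; lra.
Qed.

(** The choices are [s = th * l ^ gamma / expR l] with [th * eps = K + 1], [delta] such that
    [th * delta <= lambda * 2 ^ - gamma / 2], and the level [expR (l / 2)] for the jumps
    that escape the quadratic bound. *)
Let bad_event_log (K eps : R) : 0 < K -> 0 < eps -> exists2 delta0, 0 < delta0 &
  forall delta, 0 < delta -> delta <= delta0 -> \forall l \near +oo,
  exists Z, [/\ measurable Z, (P Z <= (expR (- (K * l `^ gamma)))%:E)%E &
    forall w, ~ Z w -> regular N (expR l) (expR l * delta) w /\
      forall t, 0 <= t <= expR l ->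
        `|levy_remainder nu N b (fun t w => X w t) (expR l * delta) t w| <= 7 * (eps * expR l)].
Proof.
move=> K0 eps0.
have [th th0 thE] : exists2 th, 0 < th & th * eps = K + 1.
  by exists ((K + 1) / eps); rewrite ?divfK ?gt_eqF // divr_gt0 // ltr_wpDr.
have g2 : 0 < 2 `^ (- gamma) :> R by exact: powR_gt0.
exists (lambda * 2 `^ (- gamma) / 2 / th); first by rewrite !divr_gt0 // mulr_gt0.
move=> delta delta0; rewrite ler_pdivlMr // => delta1.
have a1 : 0 < `|a| + 1 by rewrite ltr_wpDl.
have [zr zr0 zrE] : exists2 zr, 0 < zr & zr * (`|a| + 1) = eps.
  by exists (eps / (`|a| + 1)); rewrite ?divfK ?gt_eqF // divr_gt0.
have rho0 : 0 < zr ^+ 2 / 4 by rewrite divr_gt0 // exprn_gt0.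
have lg0 : 0 < lambda * 2 `^ (- gamma) / 2 by rewrite divr_gt0 // mulr_gt0.
have F0 : \forall l \near +oo, (0 : R) < l by apply: nbhs_pinfty_gt; rewrite num_real.
(* [F1]: the cutoff exceeds 1; [F3], [F4]: tail beyond [expR (l / 2)]; [F5]: drift of
   the large jumps; [F6], [F7]: the two error terms of the exponent; [F8]: the Brownian
   part; [F9]: constants *)
have F1 := @expR_dominates_powR R 0 (2 / delta).
have F3 := pinfty_half (@expR_dominates_powR R gamma (2 * th * 2 `^ gamma)).
have F4 := pinfty_half (@tail_log_scale R nu c beta lambda gamma c0 tail 1 ltr01).
have F5 := @expR_dominates_powR R 0 (V / delta / eps).
have F6 := @expR_dominates_powR R (gamma * 2) (2 * th ^+ 2 * V).
have F7 := @powR_dominates_affine R gamma (ln c) (1 + beta / 2) _ gamma1 lg0.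
have F8 := @expR_dominates_powR R gamma ((K + 1) / (zr ^+ 2 / 4)).
have F9 := @powR_unbounded R gamma (ln 6 + 2) gamma0.
have F := filterI F0 (filterI F1 (filterI F3 (filterI F4 (filterI F5 (filterI F6 (filterI F7 (filterI F8 F9))))))).
have [M [Mr HM]] := F; exists M; split=> // l Ml.
have [l0 [f1 [f3 [f4 [f5 [f6 [f7 [f8 f9]]]]]]]] := HM l Ml.
have y0 : 0 < l `^ gamma by exact: powR_gt0.
have E0 : 0 < expR l by exact: expR_gt0.
have En : expR l != 0 by rewrite gt_eqF.
have halfg : (l / 2) `^ gamma = l `^ gamma * 2 `^ (- gamma).
  by rewrite powRM ?(ltW l0) ?invr_ge0 // -powR_inv1 // -powRrM mulN1r.
have two : 2 `^ gamma * 2 `^ (- gamma) = 1 :> R.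
  by rewrite powRN divff // gt_eqF // powR_gt0.
have s0 : 0 < th * l `^ gamma / expR l by rewrite divr_gt0 // mulr_gt0.
have x0 : 0 < eps * expR l by rewrite mulr_gt0.
have z0 : 0 < zr * expR l by rewrite mulr_gt0.
have c1 : 1 < expR l * delta.
  by move: f1; rewrite powRr0 mulr1 ler_pdivrMr //; apply: lt_le_trans; rewrite ltr1n.
have az : `|a| * (zr * expR l) <= eps * expR l.
  rewrite mulrA ler_pM2r // -zrE mulrC ler_pM2l //.
  by rewrite lerDl.
have kx : expR l * \int[nu]_(y in `[(expR l * delta), +oo[) y <= eps * expR l.
  have /andP[_ h] := levy_first_moment_Rintegral HV (lt_trans ltr01 c1).
  rewrite [leRHS]mulrC ler_pM2l //; apply: (le_trans h).
  rewrite ler_pdivrMr ?mulr_gt0 //; move: f5; rewrite powRr0 mulr1 !ler_pdivrMr //.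
  by rewrite mulrA (mulrC eps).
have Hq : (nu `[((2 * (th * l `^ gamma / expR l))^-1)%R, +oo[%classic <=
    (expR (ln c + beta * (l / 2) - lambda * (l / 2) `^ gamma))%:E)%E.
  move: f4; rewrite mulr1 ln1 addr0 => <-.
  apply: le_measure; rewrite ?inE; try exact: measurable_itv.
  move=> x /=; rewrite !in_itv /= !andbT; apply: le_trans.
  rewrite -[leLHS]invrK lef_pV2 ?posrE ?invr_gt0 ?expR_gt0 //; last by rewrite mulr_gt0.
  rewrite mulrA ler_pdivrMr // -expRN -expRD.
  have -> : - (l / 2) + l = l / 2 by lra.
  apply: le_trans f3; rewrite halfg.
  have -> : 2 * th * 2 `^ gamma * (l `^ gamma * 2 `^ (- gamma)) =
    2 * th * l `^ gamma * (2 `^ gamma * 2 `^ (- gamma)).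
    by move: (2 `^ _) (2 `^ _) (l `^ _) => p q r; lra.
  by rewrite two mulr1 mulrA.
have Db : expR (- ((th * l `^ gamma / expR l) * (eps * expR l)) +
    2 * (th * l `^ gamma / expR l) ^+ 2 * (expR l * V) +
    expR ((th * l `^ gamma / expR l) * (expR l * delta)) *
      (expR l * expR (ln c + beta * (l / 2) - lambda * (l / 2) `^ gamma)))
    <= expR (- ((K + 1) * l `^ gamma) + 2).
  rewrite ler_expR; apply: (@le_trans _ _ (- ((K + 1) * l `^ gamma) + 1 + 1)); last lra.
  apply: lerD; first apply: lerD.
  - by rewrite lerN2 cancelE // mulrAC thE.
  - have -> : 2 * (th * l `^ gamma / expR l) ^+ 2 * (expR l * V) =
       (2 * th ^+ 2 * V * (l `^ gamma) ^+ 2) / expR l.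
      rewrite expr2 -mulrA -[X in _ * X]mulrA (mulrC _ V) cancelE //.
      move: (_ `^ _) (_^-1) => p q; lra.
    by rewrite ler_pdivrMr // mul1r -powR_mulrn ?powR_ge0 // -powRrM.
  - rewrite -!expRD -[leRHS]expR0 ler_expR.
    have -> : th * l `^ gamma / expR l * (expR l * delta) = delta * th * l `^ gamma.
      by rewrite (mulrC _ delta) cancelE // -[RHS]mulrA [RHS]mulrC.
    have := ler_wpM2r (ltW y0) delta1; rewrite halfg; move: f7.
    by move: (2 `^ _) (l `^ _) (ln c) => p q r; lra.
have Gb : Num.sqrt 2 * expR (- ((zr * expR l) ^+ 2 / (4 * expR l))) <= expR (- ((K + 1) * l `^ gamma) + 2).
  rewrite expRD mulrC; apply: ler_pM; rewrite ?expR_ge0 ?sqrtr_ge0 //.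
    rewrite ler_expR lerN2; move: f8; rewrite mulrAC ler_pdivrMr // => h; apply: (le_trans h).
    rewrite le_eqVlt; apply/orP; left; apply/eqP.
    by rewrite exprMn [expR l ^+ 2]expr2 -mulf_div mulfK // mulrC.
  apply: (@le_trans _ _ 2); last by apply: le_trans (expR_ge1Dx _); rewrite lerDr.
  by rewrite -[leRHS](@ger0_norm _ 2) // -sqrtr_sqr ler_wsqrtr // expr2 ler_peMr // ler1n.
have [D2 G2 tot] := exponent_bound K0 y0 f9 erefl Db Gb.
have [Z [mZ PZ HZ]] := levy_bad_event prmN nu_neg HV BM mX XE E0 c1 s0 x0 z0 Hq az kx D2 G2.
by exists Z; split => //; apply: (le_trans PZ); rewrite lee_fin.
Qed.

Theorem coordinate_bad_event (K eps : R) : 0 < K -> 0 < eps -> exists2 delta0, 0 < delta0 &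
  forall delta, 0 < delta -> delta <= delta0 -> \forall n \near \oo,
  large_jump_approximation P N gamma (fun n w => scaled_path b nu n.+1 (X w)) K eps delta n.
Proof.
move=> K0 eps0; have e7 : 0 < eps / 7 by rewrite divr_gt0.
have [delta0 d0 H] := bad_event_log K0 e7; exists delta0 => // delta h1 h2.
have := pinfty_ln_nat (H delta h1 h2); apply: filterS => n [Z [mZ PZ HZ]].
have n0 : 0 < n.+1%:R :> R by [].
move: HZ; rewrite lnK ?posrE // => HZ.
exists Z; split => // w /HZ[reg Hw]; split => // t t01.
rewrite /= /scaled_fun t01 -mulrBr normrM ger0_norm ?invr_ge0 // ler_pdivrMl //.
have /andP[t0 t1] := t01.
have := Hw (n.+1%:R * t); rewrite mulr_ge0 // ler_piMr // => /(_ isT).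
rewrite /levy_remainder /large_jumps.
have -> : b * (n.+1%:R * t) = b * n.+1%:R * t by rewrite mulrA.
move=> /le_trans; apply.
have -> : 7 * (eps / 7 * n.+1%:R) = n.+1%:R * eps by move: n.+1%:R => q; lra.
by [].
Qed.

End coordinate_bad_event.

(** * Upper bound for one coordinate *)

Section counting_boxes.
Context d (T : measurableType d) (R : realType) (P : probability T R).
Variables (nu : {sigma_finite_measure set R -> \bar R}) (N : R.-ker T ~> (R * R)%type).
Hypothesis prmN : poisson_random_measure P (time_space_intensity nu) N.
Variables (I W : set R).
Hypothesis mI : measurable I.
Hypothesis I0 : I `<=` `[0, +oo[%classic.
Hypothesis finI : (lebesgue_measure I < +oo)%E.
Hypothesis mW : measurable W.
Hypothesis finW : (nu W < +oo)%E.

Let stripE (J : interval R) : strip (I `*` W) J = (I `&` [set` J]) `*` W.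
Proof. by apply/seteqP; split=> -[x y] /= => [[[h1 h2] [h3 _]]|[[h1 h2] h3]]. Qed.

Lemma box_intensity : time_space_intensity nu (I `*` W) = (lebesgue_measure I * nu W)%E.
Proof. exact: intensity_rectangle. Qed.

Lemma box_finite : (time_space_intensity nu (I `*` W) < +oo)%E.
Proof. by rewrite box_intensity lte_mul_pinfty // ge0_fin_numE. Qed.

Let strip_intensity (J : interval R) : time_space_intensity nu (strip (I `*` W) J) =
  (lebesgue_measure (I `&` [set` J]) * nu W)%E.
Proof.
rewrite stripE; apply: intensity_rectangle => //; last by move=> x [/I0].
by apply: measurableI => //; exact: measurable_itv.
Qed.

Let strip_fin (J : interval R) : (time_space_intensity nu (strip (I `*` W) J) < +oo)%E.
Proof.
have mJ : measurable (I `&` [set` J]) by apply: measurableI => //; exact: measurable_itv.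
have fJ : (lebesgue_measure (I `&` [set` J]) < +oo)%E.
  by apply: le_lt_trans finI; apply: le_measure; rewrite ?inE //; exact: subIsetl.
by rewrite strip_intensity lte_mul_pinfty // ge0_fin_numE.
Qed.

Let mstrip (J : interval R) : measurable (strip (I `*` W) J).
Proof. by apply: strip_measurable; exact: measurableX. Qed.

Lemma box_counts_ae tm : {ae P, forall w, forall r k : nat, exists i : nat,
  N w (strip (I `*` W) `[0, (tm * (k%:R / (2 ^ r)%:R))]) = i%:R%:E}.
Proof.
apply: ae_foralln => r; apply: ae_foralln => k.
have [mI' PI'] := prm_integer prmN (mstrip `[0, (tm * (k%:R / (2 ^ r)%:R))]) (strip_fin _).
exists (~` integer_valued (fun w => N w (strip (I `*` W) `[0, (tm * (k%:R / (2 ^ r)%:R))]))).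
by split => // w /= h [i _ Ni]; apply: h; exists i.
Qed.

Lemma box_instant_ae t : {ae P, forall w, N w (strip (I `*` W) `[t, t]) = 0%E}.
Proof.
have h0 : time_space_intensity nu (strip (I `*` W) `[t, t]) = 0%E.
  rewrite strip_intensity (_ : lebesgue_measure _ = 0%E) ?mul0e //.
  apply/eqP; rewrite eq_le measure_ge0 andbT.
  apply: (@le_trans _ _ (lebesgue_measure `[t, t]%classic)); last first.
    by rewrite lebesgue_measure_itv /= ltxx.
  apply: le_measure; rewrite ?inE //; try exact: measurable_itv.
  by apply: measurableI => //; exact: measurable_itv.
exists [set w | N w (strip (I `*` W) `[t, t]) <> 0%E]; split => //.
  rewrite (_ : [set w | _] = ~` [set w | N w (strip (I `*` W) `[t, t]) = 0%E]) //.
  apply: measurableC; have := prm_measurable N (mstrip `[t, t]) measurableT (emeasurable_set1 0%E).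
  by rewrite setTI.
exact: (prm_null prmN (mstrip `[t, t]) h0).
Qed.

End counting_boxes.

Section upper_coordinate.
Context d (T : measurableType d) (R : realType) (N : R.-ker T ~> (R * R)%type).

(** [counting_representation], with the number of large jumps so far as counter *)
Lemma large_jumps_steps (tm c : R) (k : nat) w : 0 < tm -> 0 < c -> regular N tm c w ->
  (forall r k : nat, exists i : nat,
     N w (strip (`[0, tm] `*` `[c, +oo[) `[0, (tm * (k%:R / (2 ^ r)%:R))]) = i%:R%:E) ->
  N w (strip (`[0, tm] `*` `[c, +oo[) `[0, 0]) = 0%E ->
  N w (strip (`[0, tm] `*` `[c, +oo[) `[tm, tm]) = 0%E ->
  (exists2 i : nat, (i <= k)%N & N w (`[0, tm] `*` `[c, +oo[) = i%:R%:E) ->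
  exists2 zeta, steps k zeta &
    forall t, 0 <= t <= 1 -> zeta t = tm^-1 * large_jumps N c (tm * t) w.
Proof.
move=> tm0 c0 reg int N0 Ntm [i0 i0k Ni0].
set A := `[0, tm] `*` `[c, +oo[ : set (R * R).
have mA : measurable A by apply: measurableX; exact: measurable_itv.
have finA : (N w A < +oo)%E by have [] := reg.
have cnt u : 0 <= u <= 1 -> exists i : nat, N w (strip A `[0, (tm * u)]) = i%:R%:E.
  move=> /andP[u0 u1]; apply: (strip_integer mA finA tm0).
    by rewrite mulr_ge0 ?(ltW tm0) //= ler_piMr // ltW.
  by move=> r k' _; exact: int.
pose C u := Num.truncn (fine (N w (strip A `[0, (tm * u)]))).
have CE u : 0 <= u <= 1 -> N w (strip A `[0, (tm * u)]) = (C u)%:R%:E.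
  by move=> /cnt[i Ni]; rewrite /C Ni /= natrK.
have mon u v : u <= v -> tm * u <= tm * v by move=> uv; rewrite ler_pM2l.
have [K K0 inc] := large_jumps_increment c0 reg.
have tmV : 0 < tm^-1 by rewrite invr_gt0.
pose L u := tm^-1 * large_jumps N c (tm * u) w.
have incL u v : 0 <= u -> u <= v -> v <= 1 -> L u <= L v.
  move=> u0 uv v1; rewrite ler_pM2l // -subr_ge0.
  have tu0 : 0 <= tm * u by rewrite mulr_ge0 // ltW.
  have tv1 : tm * v <= tm by rewrite ler_piMr // ltW.
  by have /andP[] := inc _ _ tu0 (mon _ _ uv) tv1.
have subs u v : u <= v -> strip A `[0, (tm * u)] `<=` strip A `[0, (tm * v)].
  move=> uv [x y] [Axy [/= + _]]; rewrite in_itv /= => /andP[x0 x1]; split=> //; split=> //=.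
  by rewrite in_itv /= x0 (le_trans x1) // mon.
have incC u v : 0 <= u -> u <= v -> v <= 1 -> (C u <= C v)%N.
  move=> u0 uv v1; rewrite -(ler_nat R) -lee_fin -!CE ?u0 ?v1 ?(le_trans uv) ?(le_trans u0) //.
  by apply: le_measure; rewrite ?inE; try exact: strip_measurable; exact: subs.
have Ck u : 0 <= u <= 1 -> (C u <= k)%N.
  move=> u01; apply: leq_trans i0k; rewrite -(ler_nat R) -lee_fin -CE // -Ni0.
  by apply: le_measure; rewrite ?inE //; [exact: strip_measurable|exact: subIsetl].
have eqC u v : 0 <= u -> u <= v -> v <= 1 -> C u = C v -> L u = L v.
  move=> u0 uv v1 Cuv; rewrite /L; congr (_ * _); apply/eqP; rewrite eq_sym -subr_eq0.
  have tu0 : 0 <= tm * u by rewrite mulr_ge0 // ltW.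
  have tv1 : tm * v <= tm by rewrite ler_piMr // ltW.
  have := strip_split (N w) mA tu0 (mon _ _ uv).
  rewrite !CE ?u0 ?v1 ?(le_trans uv) ?(le_trans u0) // -Cuv => h.
  have s0 : N w (strip A `](tm * u), (tm * v)]) = 0%E.
    have fs : N w (strip A `](tm * u), (tm * v)]) \is a fin_num.
      by rewrite ge0_fin_numE ?measure_ge0 //; exact: strip_finite.
    move: h; rewrite -(fineK fs) -EFinD => -[] h; congr EFin; move: h.
    by move: (fine _) => q; lra.
  have /andP[h1 h2] := inc _ _ tu0 (mon _ _ uv) tv1.
  by rewrite eq_le h1 andbT (le_trans h2) // s0 mulr0.
have L0 : L 0 = 0 by rewrite /L mulr0 (large_jumps0 (ltW tm0)) ?mulr0.
have Lr u e : 0 <= u < 1 -> 0 < e -> exists2 v, u < v <= 1 & L v <= L u + e.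
  move=> /andP[u0 u1] e0; have te : 0 < tm * e by rewrite mulr_gt0.
  have [|v /andP[uv vtm] Hv] := large_jumps_right_continuous c0 reg _ te (t := tm * u).
    by rewrite mulr_ge0 ?(ltW tm0) //= gtr_pMr.
  exists (v / tm); first by rewrite ltr_pdivlMr // mulrC uv ler_pdivrMr // mul1r.
  have vE : tm * (v / tm) = v by rewrite mulrC divfK // gt_eqF.
  have := Hv v; rewrite lexx (ltW uv) => /(_ isT); rewrite ler_norml => /andP[_ h].
  rewrite /L vE -(ler_pM2l tm0) mulrDr !mulrA divff ?gt_eqF // !mul1r; lra.
have Ll e : 0 < e -> exists2 v, 0 <= v < 1 & L 1 <= L v + e.
  move=> e0; have te : 0 < tm * e by rewrite mulr_gt0.
  have [|v /andP[v0 vtm] Hv] := large_jumps_left_continuous c0 reg _ te Ntm.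
    by rewrite tm0 lexx.
  exists (v / tm); first by rewrite divr_ge0 ?(ltW tm0) //= ltr_pdivrMr // mul1r.
  have vE : tm * (v / tm) = v by rewrite mulrC divfK // gt_eqF.
  rewrite /L vE mulr1 -(ler_pM2l tm0) mulrDr !mulrA divff ?gt_eqF // !mul1r; lra.
have [z [s [z0 s01 LE]]] := counting_representation incL incC Ck eqC L0 Lr Ll.
have s0 i : 0 <= s i by have /andP[/ltW] := s01 i.
exists (step_path s0 z); last by move=> t t01; rewrite -/(L t) LE //= stepfE.
by exists z, s; split => // u u01; rewrite /= stepfE.
Qed.

End upper_coordinate.

Section upper_probability.
Context d (T : measurableType d) (R : realType) (P : probability T R).
Variables (nu : {sigma_finite_measure set R -> \bar R}) (N : R.-ker T ~> (R * R)%type).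
Hypothesis prmN : poisson_random_measure P (time_space_intensity nu) N.
Variables (c beta lambda gamma : R).
Hypothesis c0 : 0 < c.
Hypothesis lambda0 : 0 < lambda.
Hypothesis gamma1 : 1 < gamma.
Hypothesis tail : \forall x \near +oo,
  nu `[x, +oo[%classic = (c * x `^ beta * expR (- (lambda * ln x `^ gamma)))%:E.
Variable Y : nat -> T -> skorokhod R.
Hypothesis mY : forall n (G : set (skorokhod R)), open G -> measurable (Y n @^-1` G).
Local Notation v n := (ln n.+1%:R `^ gamma).

Hypothesis bad : forall K eps, 0 < K -> 0 < eps -> exists2 delta0, 0 < delta0 &
  forall delta, 0 < delta -> delta <= delta0 -> \forall n \near \oo,
  large_jump_approximation P N gamma Y K eps delta n.

(** The event requires more than [k] large jumps or a failure of the approximation. *)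
Theorem coordinate_upper_bound k (e eta : R) : 0 < e -> 0 < eta -> \forall n \near \oo,
  (P [set w | ~ exists2 zeta, steps k zeta & (dJ1 zeta (Y n w) < e)%R]
     <= (expR (- ((lambda * k.+1%:R - eta) * v n)))%:E)%E.
Proof.
move=> e0 eta0.
have K0 : 0 < lambda * k.+1%:R by rewrite mulr_gt0.
have e2 : 0 < e / 2 by rewrite divr_gt0.
have [delta delta0 /(_ delta delta0 (lexx _)) B] := bad K0 e2.
have eta1 : 0 < eta / 2 / k.+1%:R by rewrite !divr_gt0.
have U := pinfty_ln_nat (tail_upper c0 lambda0 gamma1 tail delta0 eta1).
have half0 : 0 < eta / 2 by rewrite divr_gt0.
have V2 := pinfty_ln_nat (@powR_unbounded R gamma (ln 2 / (eta / 2)) (lt_trans ltr01 gamma1)).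
have [m _ Hm] := filterI B (filterI U V2); exists m => // n mn.
have [[Z [mZ PZ HZ]] [hU hV]] := Hm n mn.
have n0 : 0 < n.+1%:R :> R by [].
have nd0 : 0 < n.+1%:R * delta by rewrite mulr_gt0.
move: hU; rewrite lnK ?posrE // => hU.
pose A : set (R * R) := `[0, n.+1%:R]%classic `*` `[(n.+1%:R * delta), +oo[%classic.
have mA : measurable A by apply: measurableX; exact: measurable_itv.
have lebI : lebesgue_measure (`[0, n.+1%:R]%classic : set R) = n.+1%:R%:E.
  by rewrite lebesgue_measure_itv /= lte_fin n0 oppr0 adde0.
have finI : (lebesgue_measure (`[0%R, n.+1%:R]%classic : set R) < +oo)%E by rewrite lebI ltry.
have finW : (nu `[(n.+1%:R * delta)%R, +oo[%classic < +oo)%E.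
  rewrite ltey; apply/eqP => h; move: hU; rewrite h gt0_muley ?lte_fin //.
have I0 : (`[0, n.+1%:R]%classic : set R) `<=` `[0, +oo[%classic.
  by move=> x /=; rewrite !in_itv /= => /andP[-> _].
have mI := measurable_itv `[0, n.+1%:R] : measurable (`[0, n.+1%:R]%classic : set R).
have mW := measurable_itv `[(n.+1%:R * delta), +oo[.
have fA := box_finite mI I0 finI mW finW.
pose mu := fine (time_space_intensity nu A).
have mu0 : 0 <= mu by rewrite fine_ge0.
have muE : mu <= expR (- ((lambda - eta / 2 / k.+1%:R) * v n)).
  by rewrite -lee_fin fineK ?ge0_fin_numE // (box_intensity nu mI I0 mW) // lebI.
pose E1 := [set w | forall i, (i < k.+1)%N -> N w A <> i%:R%:E].
have PE1 : (P E1 <= (mu ^+ k.+1)%:E)%E.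
  exact: (poisson_tail (prm_measurable N mA) mu0 (prm_poisson prmN mA fA) k.+1).
have mE1 : measurable E1.
  rewrite (_ : E1 = \bigcap_(i < k.+1) ~` [set w | N w A = i%:R%:E]) //.
  apply: bigcap_measurable => // [|i _]; first by exists 0%N.
  apply: measurableC; have := prm_measurable N mA measurableT (emeasurable_set1 i%:R%:E).
  by rewrite setTI.
have mu_pow : mu ^+ k.+1 <= expR (- ((lambda * k.+1%:R - eta / 2) * v n)).
  apply: (@le_trans _ _ (expR (- ((lambda - eta / 2 / k.+1%:R) * v n)) ^+ k.+1)).
    by rewrite lerXn2r // nnegrE // expR_ge0.
  rewrite -expRM_natl ler_expR mulrN lerN2 mulrA mulrBr [k.+1%:R * (_ / _)]mulrC divfK //.
  by rewrite (mulrC lambda).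
have [Z2 [mZ2 PZ2 sZ2]] : {ae P, forall w,
    (forall r k : nat, exists i : nat, N w (strip A `[0, (n.+1%:R * (k%:R / (2 ^ r)%:R))]) = i%:R%:E) /\
    N w (strip A `[0, 0]) = 0%E /\ N w (strip A `[n.+1%:R, n.+1%:R]) = 0%E}.
  have h1 := box_counts_ae prmN mI I0 finI mW finW n.+1%:R.
  have h2 := box_instant_ae prmN mI I0 mW 0.
  have h3 := box_instant_ae prmN mI I0 mW n.+1%:R.
  exact: filterI h1 (filterI h2 h3).
have mbad : measurable [set w | ~ exists2 zeta, steps k zeta & (dJ1 zeta (Y n w) < e)%R].
  rewrite (_ : [set w | _] = ~` (Y n @^-1` \bigcup_(zeta in steps k) [set y | dJ1 zeta y < e])).
    by apply: measurableC; apply: mY; apply: bigcup_open => zeta _; exact: open_mball.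
  by apply/seteqP; split=> w /= h h'; apply: h; case: h' => z; exists z.
apply: (@le_trans _ _ (P (Z `|` (E1 `|` Z2)))).
  apply: le_measure; rewrite ?inE //.
    by apply: measurableU => //; exact: measurableU.
  move=> w /=; apply: contra_notP => /not_orP[nZ /not_orP[nE1 nZ2]].
  have [reg Hw] := HZ w nZ.
  have [h1 [h2 h3]] : (forall r k : nat, exists i : nat,
      N w (strip A `[0, (n.+1%:R * (k%:R / (2 ^ r)%:R))]) = i%:R%:E) /\
      N w (strip A `[0, 0]) = 0%E /\ N w (strip A `[n.+1%:R, n.+1%:R]) = 0%E.
    by apply: contrapT => h; apply: nZ2; exact: sZ2.
  have hk : exists2 i : nat, (i <= k)%N & N w A = i%:R%:E.
    apply: contrapT => h; apply: nE1 => i ik Ni; apply: h; exists i => //.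
  have [zeta zk zE] := large_jumps_steps n0 nd0 reg h1 h2 h3 hk.
  exists zeta => //; apply: (@le_lt_trans _ _ (e / 2)); last by rewrite ltr_pdivrMr // ltr_pMr // ltr1n.
  by apply: dJ1_le_unif => t t01; rewrite zE // distrC; exact: Hw.
apply: le_trans (measureU2 _ mZ (measurableU _ _ mE1 mZ2)) _.
apply: (@le_trans _ _ ((expR (- (lambda * k.+1%:R * v n)))%:E + ((mu ^+ k.+1)%:E + 0))%E).
  apply: leeD => //; apply: le_trans (measureU2 _ mE1 mZ2) _; apply: leeD => //.
  by rewrite le_eqVlt; apply/orP; left; apply/eqP; exact: PZ2.
rewrite adde0 -EFinD lee_fin.
have vn0 : 0 <= v n by exact: powR_ge0.
have h1 : expR (- (lambda * k.+1%:R * v n)) <= expR (- ((lambda * k.+1%:R - eta / 2) * v n)).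
  by rewrite ler_expR lerN2 ler_wpM2r // gerBl ltW.
apply: le_trans (lerD h1 mu_pow) _.
have dbl (u : R) : u + u = expR (ln 2) * u by rewrite lnK ?posrE // mulr_natl mulr2n.
rewrite dbl -expRD ler_expR.
move: hV; rewrite ler_pdivrMr //; move: (v n) (lambda * _) (ln 2) => x y q; lra.
Qed.

End upper_probability.

(** * Lower bound for one coordinate *)

Section single_jump.
Context (R : realType) (mu : {measure set (R * R) -> \bar R}).
Variables (tm al be : R) (W : set R).
Hypothesis mW : measurable W.
Hypothesis al0 : 0 < al.
Hypothesis be_tm : be < tm.
Let Q : set (R * R) := `[al, be]%classic `*` W.
Hypothesis Q1 : mu Q = 1%E.
Hypothesis int : forall r k : nat, exists i : nat,
  mu (strip Q `[0%R, (tm * (k%:R / (2 ^ r)%:R))%R]) = i%:R%:E.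

(** The count of the box up to a given time is a monotone integer bounded by 1:
    [counting_representation] applies with the count as both path and counter. *)
Lemma single_jump_time : al <= be -> exists2 s, al <= tm * s <= be &
  forall u, 0 <= u <= 1 -> mu (strip Q `[0%R, (tm * u)%R]) = ((s <= u)%R%:R)%:E.
Proof.
move=> albe; have tm0 : 0 < tm by rewrite (lt_trans al0) // (le_lt_trans albe).
have mQ : measurable Q by apply: measurableX => //; exact: measurable_itv.
have finQ : (mu Q < +oo)%E by rewrite Q1 ltry.
have cnt u : 0 <= u <= 1 -> exists i : nat, mu (strip Q `[0, (tm * u)]) = i%:R%:E.
  move=> /andP[u0 u1]; apply: (strip_integer mQ finQ tm0).
    by rewrite mulr_ge0 ?(ltW tm0) //= ler_piMr // ltW.
  by move=> r k' _; exact: int.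
pose L u : R := fine (mu (strip Q `[0, (tm * u)])).
pose C u := Num.truncn (L u).
have LC u : 0 <= u <= 1 -> L u = (C u)%:R.
  by move=> /cnt[i Ni]; rewrite /C /L Ni /= natrK.
have LE u : mu (strip Q `[0, (tm * u)]) = (L u)%:E.
  by rewrite /L fineK // ge0_fin_numE ?measure_ge0 //; exact: strip_finite.
have mon u v : u <= v -> tm * u <= tm * v by move=> uv; rewrite ler_pM2l.
have subs u v : u <= v -> strip Q `[0, (tm * u)] `<=` strip Q `[0, (tm * v)].
  move=> uv [x y] [Axy [/= + _]]; rewrite in_itv /= => /andP[x0 x1]; split=> //; split=> //=.
  by rewrite in_itv /= x0 (le_trans x1) // mon.
have incL u v : 0 <= u -> u <= v -> v <= 1 -> L u <= L v.
  move=> u0 uv v1; rewrite -lee_fin -!LE.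
  by apply: le_measure; rewrite ?inE; try exact: strip_measurable; exact: subs.
have incC u v : 0 <= u -> u <= v -> v <= 1 -> (C u <= C v)%N.
  move=> u0 uv v1; rewrite -(ler_nat R) -!LC ?u0 ?v1 ?(le_trans uv) ?(le_trans u0) //.
  exact: incL.
have Lle1 u : L u <= 1.
  rewrite -lee_fin -LE -Q1; apply: le_measure; rewrite ?inE //; first exact: strip_measurable.
  exact: subIsetl.
have C1 u : 0 <= u <= 1 -> (C u <= 1)%N by move=> u01; rewrite -(ler_nat R) -LC.
have eqC u v : 0 <= u -> u <= v -> v <= 1 -> C u = C v -> L u = L v.
  by move=> u0 uv v1 Cuv; rewrite !LC ?Cuv ?u0 ?v1 ?(le_trans uv) ?(le_trans u0).
have Lsmall u : tm * u < al -> L u = 0.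
  move=> ual; rewrite /L (_ : strip _ _ = set0) ?measure0 //.
  apply/seteqP; split=> // -[x y] [[/= + _] [/= + _]]; rewrite !in_itv /= => /andP[h _] /andP[_ h'].
  by have := lt_le_trans ual h; rewrite ltNge h'.
have Lbig u : be <= tm * u -> L u = 1.
  move=> ube; rewrite /L (_ : strip _ _ = Q) ?Q1 //.
  apply/seteqP; split=> [|[x y] h]; first exact: subIsetl.
  split=> //; split=> //=; case: h => /= + _; rewrite !in_itv /= => /andP[h h'].
  by rewrite (le_trans (ltW al0) h) (le_trans h').
have L0 : L 0 = 0 by rewrite Lsmall ?mulr0.
have Lr u e : 0 <= u < 1 -> 0 < e -> exists2 v, u < v <= 1 & L v <= L u + e.
  move=> /andP[u0 u1] e0; have [v uv mv] := strip_right mQ finQ (tm * u) e0.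
  have uv' : tm * u < minr v tm by rewrite lt_min uv gtr_pMr.
  have vE : tm * (minr v tm / tm) = minr v tm by rewrite mulrC divfK // gt_eqF.
  exists (minr v tm / tm).
    by rewrite ltr_pdivlMr // mulrC uv' ler_pdivrMr // mul1r ge_min lexx orbT.
  rewrite -lee_fin EFinD -!LE vE (strip_split _ mQ _ (ltW uv')) ?mulr_ge0 ?(ltW tm0) //.
  apply: leeD => //; apply: le_trans (ltW mv).
  apply: le_measure; rewrite ?inE; try exact: strip_measurable.
  move=> [x y] [Axy [/= + _]]; rewrite in_itv /= => /andP[x1 x2]; split=> //; split=> //=.
  by rewrite in_itv /= x1 (le_trans x2) // ge_min lexx.
have bE : tm * (be / tm) = be by rewrite mulrC divfK // gt_eqF.
have be01 : 0 <= be / tm < 1.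
  by rewrite divr_ge0 ?(ltW tm0) ?(le_trans (ltW al0)) //= ltr_pdivrMr // mul1r.
have Ll e : 0 < e -> exists2 v, 0 <= v < 1 & L 1 <= L v + e.
  move=> e0; exists (be / tm) => //; rewrite [L (be / tm)]Lbig ?bE //.
  by apply: le_trans (Lle1 1) _; rewrite lerDl ltW.
have [z [s [z0 s01 LzE]]] := counting_representation incL incC C1 eqC L0 Lr Ll.
have {}LzE u : 0 <= u <= 1 -> L u = z ord0 * (s ord0 <= u)%R%:R by move=> /LzE; rewrite big_ord1.
have /andP[s0 s1] := s01 ord0.
have z1 : z ord0 = 1.
  have := LzE 1; rewrite ler01 lexx (ltW s1) mulr1 => /(_ isT) <-.
  by apply: Lbig; rewrite mulr1 ltW.
rewrite z1 in LzE; exists (s ord0).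
  apply/andP; split.
    rewrite leNgt; apply/negP => h; have := LzE (s ord0).
    by rewrite Lsmall // lexx (ltW s0) (ltW s1) mulr1 => /(_ isT)/esym/eqP; rewrite oner_eq0.
  have := LzE (be / tm); rewrite (andP be01).1 (ltW (andP be01).2) Lbig ?bE // mul1r.
  move=> /(_ isT); case: leP => [h _|_ /eqP]; last by rewrite oner_eq0.
  by rewrite -bE ler_pM2l.
by move=> u u01; rewrite LE LzE // mul1r.
Qed.

End single_jump.

Section boxed_jumps.
Context d (T : measurableType d) (R : realType) (N : R.-ker T ~> (R * R)%type).
Variables (tm c : R) (w : T).
Hypothesis tm0 : 0 < tm.
Hypothesis c0 : 0 < c.
Hypothesis reg : regular N tm c w.
Variables (j : nat) (al be lo hi s : 'I_j -> R).
Let A : set (R * R) := `[0, tm]%classic `*` `[c, +oo[%classic.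
Let Q (i : 'I_j) : set (R * R) := `[al i, be i]%classic `*` `[lo i, hi i[%classic.
Hypothesis QA : forall i, Q i `<=` A.
Hypothesis disj : trivIset setT Q.
Hypothesis rest : N w (A `\` \bigcup_i Q i) = 0%E.
Hypothesis counts : forall i u, 0 <= u <= 1 ->
  N w (strip (Q i) `[0%R, (tm * u)%R]) = ((s i <= u)%R%:R)%:E.

(** Up to a null set the large jumps lie in the boxes, and a jump in box [i] has size between
    [lo i] and [hi i]. *)
Lemma boxed_jumps_bounds u : 0 <= u <= 1 ->
  \sum_(i < j) lo i * (s i <= u)%R%:R <= large_jumps N c (tm * u) w <= \sum_(i < j) hi i * (s i <= u)%R%:R.
Proof.
move=> u01; have /andP[u0 u1] := u01.
have mA : measurable A by apply: measurableX; exact: measurable_itv.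
have mQ i : measurable (Q i) by apply: measurableX; exact: measurable_itv.
have bigE (F : 'I_j -> set (R * R)) : \big[setU/set0]_(i < j) F i = \bigcup_i F i.
  by apply/seteqP; split=> p; rewrite mem_bigsetU => -[i Fi]; exists i.
have mQU : measurable (\bigcup_i Q i) by rewrite -bigE; exact: bigsetU_measurable.
pose S i := strip (Q i) `[0, (tm * u)].
have mS i : measurable (S i) by exact: strip_measurable.
pose D := \big[setU/set0]_(i < j) S i.
have mD : measurable D by exact: bigsetU_measurable.
have mC : measurable (`[0, (tm * u)]%classic `*` `[c, +oo[%classic : set (R * R)).
  by apply: measurableX; exact: measurable_itv.
have tS : trivIset setT S.
  by move=> i k _ _ [p [[Qi _] [Qk _]]]; apply: disj => //; exists p.
have mZ : measurable (A `\` \bigcup_i Q i) by exact: measurableD.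
have intE : large_jumps N c (tm * u) w = \sum_(i < j) \int[N w]_(z in S i) z.2.
  rewrite /large_jumps (Rintegral_null_difference mD mC mZ (@measurable_snd _ _ _ _) _ _ rest); last 2 first.
  - move=> p; rewrite /D bigE => -[i _ [Qi [pu _]]]; split; last by have [] := QA Qi.
    by move: pu; rewrite /= !in_itv.
  - move=> p [pu pc]; have Ap : A p.
      split=> //; move: pu; rewrite /= !in_itv /= => /andP[-> h]; apply: le_trans h _.
      by rewrite ler_piMr // ltW.
    have [pQ|npQ] := pselect ((\bigcup_i Q i) p); last by right.
    by left; rewrite /D bigE; have [i _ Qi] := pQ; exists i => //; split.
  have uI := index_enum_uniq 'I_j.
  rewrite /Rintegral /D integral_bigsetU_EFin //; last 2 first.
  - by apply: sub_trivIset tS.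
  - by apply/measurable_EFinP; apply: measurable_funTS; exact: measurable_snd.
  rewrite -sum_fine // => i _; apply: integrable_fin_num => //.
  by apply: (regular_integrable c0 reg) => // p [/QA].
have bd i : lo i * (s i <= u)%R%:R <= \int[N w]_(z in S i) z.2 <= hi i * (s i <= u)%R%:R.
  have -> : (s i <= u)%R%:R = fine (N w (S i)) by rewrite counts.
  apply: Rintegral_between => //.
  - by rewrite counts // ltry.
  - by apply: measurable_funTS; exact: measurable_snd.
  - by move=> [x y] [[_ /= +] _]; rewrite in_itv /= => /andP[-> /ltW ->].
by rewrite intE; apply/andP; split; apply: ler_sum => i _; have /andP[] := bd i.
Qed.

End boxed_jumps.

Section box_event.
Context d (T : measurableType d) (R : realType) (P : probability T R).
Variables (nu : {sigma_finite_measure set R -> \bar R}) (N : R.-ker T ~> (R * R)%type).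
Hypothesis prmN : poisson_random_measure P (time_space_intensity nu) N.

Lemma intensity_le (A C : set (R * R)) : measurable A -> measurable C -> A `<=` C ->
  (time_space_intensity nu A <= time_space_intensity nu C)%E.
Proof. by move=> mA mC AC; apply: le_measure; rewrite ?inE. Qed.

Lemma intensity_ge0 A : (0 <= time_space_intensity nu A)%E.
Proof. exact: measure_ge0. Qed.

Variables (j : nat) (Q : 'I_j -> set (R * R)) (A : set (R * R)) (q : R).
Hypothesis mA : measurable A.
Hypothesis mQ : forall i, measurable (Q i).
Hypothesis QA : forall i, Q i `<=` A.
Hypothesis disj : trivIset setT Q.
Hypothesis A1 : (time_space_intensity nu A <= 1)%E.
Hypothesis q0 : 0 <= q.
Hypothesis Qq : forall i, (q%:E <= time_space_intensity nu (Q i))%E.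

Definition box_event := [set w | (forall i, N w (Q i) = 1%E) /\ N w (A `\` \bigcup_i Q i) = 0%E].

Let F (o : 'I_j.+1) : set (R * R) :=
  if unlift ord0 o is Some i then Q i else A `\` \bigcup_i Q i.
Let k (o : 'I_j.+1) : nat := if unlift ord0 o is Some i then 1%N else 0%N.

Let mU : measurable (\bigcup_i Q i).
Proof.
rewrite (_ : \bigcup_i Q i = \big[setU/set0]_(i < j) Q i); first exact: bigsetU_measurable.
by apply/seteqP; split=> p; rewrite mem_bigsetU => -[i]; [move=> _ Qi; exists i|exists i].
Qed.

Let mF o : measurable (F o).
Proof. by rewrite /F; case: unliftP => [i _|_] //; exact: measurableD. Qed.

Let FA o : F o `<=` A.
Proof. by rewrite /F; case: unliftP => [i _|_] //; exact: subDsetl. Qed.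

Let tF : trivIset setT F.
Proof.
move=> o1 o2 _ _; rewrite /F; case: unliftP => [i1 ->|->]; case: unliftP => [i2 ->|->] //.
- by move=> [p [Q1 Q2]]; congr lift; apply: disj => //; exists p.
- by move=> [p [Q1 [_]]]; case; exists i1.
- by move=> [p [[_ nQ] Q2]]; case: nQ; exists i2.
Qed.

Let E o := [set w | N w (F o) = (k o)%:R%:E].

Let mE o : measurable (E o).
Proof.
have := prm_measurable N (mF o) measurableT (emeasurable_set1 (k o)%:R%:E).
by rewrite setTI.
Qed.

Let box_eventE : box_event = \bigcap_o E o.
Proof.
apply/seteqP; split=> w.
  move=> [h1 h2] o _; rewrite /E /F /k /=; case: unliftP => [i _|_] //; exact: h1.
move=> h; split=> [i|].
  by have := h (lift ord0 i) I; rewrite /E /F /k /= liftK.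
by have := h ord0 I; rewrite /E /F /k /= unlift_none.
Qed.

Lemma box_event_measurable : measurable box_event.
Proof. by rewrite box_eventE; apply: fin_bigcap_measurable. Qed.

Let mu o : R := fine (time_space_intensity nu (F o)).

Let finF o : (time_space_intensity nu (F o) < +oo)%E.
Proof.
apply: (@le_lt_trans _ _ (time_space_intensity nu A)); first exact: (intensity_le (mF o) mA (@FA o)).
by apply: le_lt_trans A1 _; rewrite ltry.
Qed.

Let mu0 o : 0 <= mu o.
Proof. by rewrite fine_ge0 // intensity_ge0. Qed.

Let muE o : time_space_intensity nu (F o) = (mu o)%:E.
Proof. by rewrite fineK // ge0_fin_numE // intensity_ge0. Qed.

Let mu1 o : mu o <= 1.
Proof. by rewrite -lee_fin -muE (le_trans (intensity_le (mF o) mA (@FA o))). Qed.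

Let PE o : P (E o) = (poisson_weight (mu o) (k o))%:E.
Proof. by rewrite /E (prm_poisson prmN (mF o) (finF o)) (poisson_prob_set1 _ (mu0 o)). Qed.

(** The boxes and their complement being independent, and the intensity of [A] being at
    most one, all Poisson exponentials are at least [expR (-1)]. *)
Lemma box_event_probability : ((q ^+ j * expR (- j.+1%:R))%:E <= P box_event)%E.
Proof.
have indep := prm_independent prmN mF tF.
have -> : P box_event = (\prod_(o < j.+1) P (E o))%E.
  have := indep [set: 'I_j.+1]%SET E _; rewrite (_ : \bigcap_(i in _) E i = box_event).
    move=> ->; first by apply: eq_bigl => o; rewrite finset.inE.
    move=> o _; exists [set (k o)%:R%:E]; first exact: emeasurable_set1.
    by rewrite setTI.
  rewrite box_eventE; apply/seteqP; split=> w h o _; first by apply: h; rewrite /= finset.inE.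
  exact: h.
rewrite (eq_bigr (fun o => (poisson_weight (mu o) (k o))%:E)) //.
rewrite prodEFin lee_fin big_ord_recl /=.
have e1 (x : R) : x <= 1 -> expR (- 1) <= expR (- x) by move=> x1; rewrite ler_expR lerN2.
have pw1 (x : R) : poisson_weight x 1 = x * expR (- x) by rewrite /poisson_weight expr1 divr1.
have w1 : (q * expR (- 1)) ^+ j <= \prod_(i < j) poisson_weight (mu (lift ord0 i)) (k (lift ord0 i)).
  rewrite -[in leLHS](card_ord j) -prodr_const; apply: ler_prod => i _.
  have -> : k (lift ord0 i) = 1%N by rewrite /k liftK.
  have qm : q <= mu (lift ord0 i) by rewrite -lee_fin -muE /F liftK.
  rewrite pw1 mulr_ge0 ?expR_ge0 //=.
  move: (mu1 (lift ord0 i)) qm; move: (mu _) => x x1 qx.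
  by apply: ler_pM; rewrite ?expR_ge0 ?q0 //; exact: e1.
have w0 : expR (- 1) <= poisson_weight (mu ord0) (k ord0).
  by rewrite /poisson_weight /k unlift_none expr0 fact0 divr1 mul1r; exact: e1.
apply: le_trans (ler_pM (expR_ge0 _) _ w0 w1); last by rewrite exprn_ge0 // mulr_ge0 // expR_ge0.
rewrite exprMn -expRM_natl mulrCA ler_wpM2l ?exprn_ge0 // -expRD ler_expR.
by rewrite -natr1; move: j%:R => x; lra.
Qed.

End box_event.

Section lower_probability.
Context d (T : measurableType d) (R : realType) (P : probability T R).
Variables (nu : {sigma_finite_measure set R -> \bar R}) (N : R.-ker T ~> (R * R)%type).
Hypothesis prmN : poisson_random_measure P (time_space_intensity nu) N.
Variables (c beta lambda gamma : R).
Hypothesis c0 : 0 < c.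
Hypothesis lambda0 : 0 < lambda.
Hypothesis gamma1 : 1 < gamma.
Hypothesis tail : \forall x \near +oo,
  nu `[x, +oo[%classic = (c * x `^ beta * expR (- (lambda * ln x `^ gamma)))%:E.
Variable Y : nat -> T -> skorokhod R.
Hypothesis mY : forall n (G : set (skorokhod R)), open G -> measurable (Y n @^-1` G).
Local Notation v n := (ln n.+1%:R `^ gamma).

Hypothesis bad : forall K eps, 0 < K -> 0 < eps -> exists2 delta0, 0 < delta0 &
  forall delta, 0 < delta -> delta <= delta0 -> \forall n \near \oo,
  large_jump_approximation P N gamma Y K eps delta n.

(** [move_points] aligns the jump times; only the differences of the heights remain. *)
Let boxes_close j xi (z t s : 'I_j -> R) (y : skorokhod R) (L : R -> R) (w0 h h1 eps e : R) :
  (forall h' (s' : 'I_j -> R), h' <= w0 -> (forall i, `|s' i - t i| <= h') ->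
    exists l, [/\ time_change l, forall i, 0 < s' i < 1,
      forall i u, 0 <= u <= 1 -> (t i <= l u) = (s' i <= u) &
      forall u, 0 <= u <= 1 -> `|l u - u| <= j%:R * h']) ->
  strict_steps xi z t -> h <= w0 -> 0 <= h1 -> (forall i, `|s i - t i| <= h) ->
  (forall u, 0 <= u <= 1 -> \sum_(i < j) z i * (s i <= u)%R%:R <= L u <=
     \sum_(i < j) (z i + h1) * (s i <= u)%R%:R) ->
  (forall u, 0 <= u <= 1 -> `|y u - L u| <= eps) ->
  j%:R * h <= e -> j%:R * h1 + eps <= e -> dJ1 xi y <= e.
Proof.
move=> Hw [z0 t01 tinj xiE] hw h10 st HL Hy he h1e.
have [l [tl s01 ls lu]] := Hw h s hw st.
apply: (dJ1_le_time_change tl) => u u01; first by apply: le_trans (lu u u01) he.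
rewrite xiE; last exact: time_change_itv.
rewrite (eq_bigr (fun i => z i * (s i <= u)%R%:R)); last first.
  by move=> i _; rewrite indic_itv1 ?ls //; exact: time_change_itv.
have /andP[H1 H2] := HL u u01.
have H3 : \sum_(i < j) (z i + h1) * (s i <= u)%R%:R <= \sum_(i < j) z i * (s i <= u)%R%:R + j%:R * h1.
  have -> : j%:R * h1 = \sum_(i < j) h1 by rewrite sumr_const card_ord mulr_natl.
  rewrite -big_split /=; apply: ler_sum => i _.
  by case: (s i <= u); rewrite ?mulr1 ?mulr0 ?add0r.
move: (Hy u u01) H1 H2 H3 h1e; rewrite !ler_norml.
move: (\sum_(i < j) _) (\sum_(i < j) _) (y u) (L u) => p q a b /andP[a1 a2] b1 b2 b3 b4.
by apply/andP; split; lra.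
Qed.

(** The boxes have times within [h] of the jumps of [xi] and sizes between [z i] and
    [z i + h1]. Since [delta] is below all the heights, the boxes only contain large
    jumps. *)
Theorem coordinate_lower_bound j xi (z t : 'I_j -> R) (e eta : R) :
  strict_steps xi z t -> 0 < e -> 0 < eta -> \forall n \near \oo,
  ((expR (- ((lambda * j%:R + eta) * v n)))%:E <= P [set w | (dJ1 xi (Y n w) < e)%R])%E.
Proof.
move=> sxi e0 eta0; have [z0 t01 tinj xiE] := sxi.
have gamma0 : 0 < gamma by exact: lt_trans gamma1.
have [w0 w00 Hw0] := move_points t01 tinj.
have [g g0 Hg] : exists2 g, 0 < g & forall p : 'I_j * 'I_j, g <= (if p.1 == p.2 then 1 else `|t p.1 - t p.2|).
  apply: finite_pos_lower_bound => -[a b] /=; case: eqVneq => // ab.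
  by rewrite normr_gt0 subr_eq0; apply: contra_neq ab; exact: tinj.
have [zm zm0 Hzm] := finite_pos_lower_bound z0.
have j1 : 0 < j.+1%:R :> R by [].
have [h [h0 hw hg hj]] : exists h, [/\ 0 < h, h <= w0, h + h < g & j%:R * h <= e / 2].
  exists (minr w0 (minr (g / 4) (e / 2 / j.+1%:R))); split.
  - by rewrite !lt_min w00 !divr_gt0.
  - by rewrite ge_min lexx.
  - have : minr w0 (minr (g / 4) (e / 2 / j.+1%:R)) <= g / 4 by rewrite !ge_min lexx !orbT.
    by move: (minr _ _) => q; lra.
  - have h' : minr w0 (minr (g / 4) (e / 2 / j.+1%:R)) <= e / 2 / j.+1%:R by rewrite !ge_min lexx !orbT.
    apply: le_trans (ler_wpM2l (ler0n _ _) h') _.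
    by rewrite mulrCA -[leRHS]mulr1 ler_pM2l ?divr_gt0 // ler_pdivrMr // mul1r ler_nat.
have [h1 [h10 h1j]] : exists h1, 0 < h1 /\ j%:R * h1 <= e / 4.
  exists (e / 4 / j.+1%:R); split; first by rewrite !divr_gt0.
  by rewrite mulrCA -[leRHS]mulr1 ler_pM2l ?divr_gt0 // ler_pdivrMr // mul1r ler_nat.
have tlo i : 0 < t i - h.
  have [|l [_ /(_ i)/andP[]]] := Hw0 h (fun i => t i - h) hw; last by [].
  by move=> k; rewrite addrC addKr normrN ger0_norm // ltW.
have thi i : t i + h < 1.
  have [|l [_ /(_ i)/andP[]]] := Hw0 h (fun i => t i + h) hw; last by [].
  by move=> k; rewrite addrC addKr ger0_norm // ltW.
have K0 : 0 < lambda * j%:R + eta by rewrite ltr_wpDl // mulr_ge0 // ltW.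
have e4 : 0 < e / 4 by rewrite divr_gt0.
have [delta0 d0 B0] := bad K0 e4.
have [delta [delta_gt0 dd dz]] : exists delta, [/\ 0 < delta, delta <= delta0 & delta <= zm].
  by exists (minr delta0 zm); rewrite lt_min d0 zm0 !ge_min !lexx orbT.
have B := B0 delta delta_gt0 dd.
have l2 : 0 < lambda / 2 by rewrite divr_gt0.
have U := pinfty_ln_nat (tail_upper c0 lambda0 gamma1 tail delta_gt0 l2).
have eta1 : 0 < eta / 2 / j.+1%:R by rewrite !divr_gt0.
have Wn : \forall n \near \oo, forall i : 'I_j, ((expR (- ((lambda + eta / 2 / j.+1%:R) * v n)))%:E <=
    nu `[(expR (ln n.+1%:R) * z i)%R, (expR (ln n.+1%:R) * (z i + h1))%R[%classic)%E.
  apply: filter_forall => i; have zz : z i < z i + h1 by rewrite ltrDl.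
  exact: (pinfty_ln_nat (tail_window c0 lambda0 gamma1 tail (z0 i) zz eta1)).
have big : \forall n \near \oo, 1 <= n.+1%:R * (h + h).
  exists (Num.truncn (h + h)^-1) => // n /= hn.
  rewrite -ler_pdivrMr ?addr_gt0 // div1r; apply: ltW; apply: lt_le_trans (truncnS_gt _) _.
  by rewrite ler_nat ltnS.
have V2 := pinfty_ln_nat (@powR_unbounded R gamma ((ln 2 + j.+1%:R) / (eta / 2)) gamma0).
have [m _ Hm] := filterI B (filterI U (filterI Wn (filterI big V2))); exists m => // n mn.
have [[Z [mZ PZ HZ]] [hU [hW [hbig hV]]]] := Hm n mn.
have n0 : 0 < n.+1%:R :> R by [].
move: hU hW; rewrite lnK ?posrE // => hU hW.
have nd0 : 0 < n.+1%:R * delta by rewrite mulr_gt0.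
have vn0 : 0 <= v n by exact: powR_ge0.
pose A : set (R * R) := `[0, n.+1%:R]%classic `*` `[(n.+1%:R * delta), +oo[%classic.
pose I i : set R := `[(n.+1%:R * (t i - h)), (n.+1%:R * (t i + h))]%classic.
pose W i : set R := `[(n.+1%:R * z i), (n.+1%:R * (z i + h1))[%classic.
pose Q i : set (R * R) := I i `*` W i.
have mA : measurable A by apply: measurableX; exact: measurable_itv.
have mQ i : measurable (Q i) by apply: measurableX; exact: measurable_itv.
have mI i : measurable (I i) by exact: measurable_itv.
have mW i : measurable (W i) by exact: measurable_itv.
have Ipos i : I i `<=` `[0, +oo[%classic.
  move=> x; rewrite /I /= !in_itv /= andbT => /andP[h' _]; apply: le_trans h'.
  by rewrite mulr_ge0 // ltW.
have QA i : Q i `<=` A.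
  move=> [x y] [/=]; rewrite /I /W /= !in_itv /= => /andP[x1 x2] /andP[y1 y2]; split.
    rewrite /= in_itv /=; apply/andP; split.
      by apply: le_trans x1; rewrite mulr_ge0 // ltW.
    by apply: (le_trans x2); rewrite ler_piMr // ltW.
  by rewrite /= in_itv /= andbT; apply: le_trans y1; rewrite ler_pM2l // (le_trans dz).
(* Two boxes whose time windows meet have jump times closer than the gap [g]. *)
have disj : trivIset setT Q.
  move=> i k _ _ [[x y] [[/= + _] [/= + _]]]; rewrite /I /= !in_itv /= => /andP[a1 a2] /andP[b1 b2].
  apply/eqP; apply: contraTT isT => ik; have := Hg (i, k); rewrite /= (negbTE ik).
  have := le_trans b1 a2; have := le_trans a1 b2; rewrite !ler_pM2l // => r1 r2.
  have : `|t i - t k| <= h + h by rewrite ler_norml; apply/andP; split; lra.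
  by move=> r3 r4; have := le_lt_trans (le_trans r4 r3) hg; rewrite ltxx.
have lebA : lebesgue_measure (`[0, n.+1%:R]%classic : set R) = n.+1%:R%:E.
  by rewrite lebesgue_measure_itv /= lte_fin n0 oppr0 adde0.
have lebI i : lebesgue_measure (I i) = (n.+1%:R * (h + h))%:E.
  rewrite /I lebesgue_measure_itv /= lte_fin ltr_pM2l //.
  have -> : t i - h < t i + h by lra.
  by rewrite -EFinB -mulrBr; congr (_ * _)%:E; lra.
have A0 : (`[0, n.+1%:R]%classic : set R) `<=` `[0, +oo[%classic.
  by move=> x /=; rewrite !in_itv /= => /andP[-> _].
have A1 : (time_space_intensity nu A <= 1)%E.
  rewrite (box_intensity nu (measurable_itv _) A0 (measurable_itv _)) lebA; apply: (le_trans hU).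
  have hl : 0 <= lambda - lambda / 2 by lra.
  by rewrite lee_fin -[leRHS]expR0 ler_expR oppr_le0 mulr_ge0.
pose q := expR (- ((lambda + eta / 2 / j.+1%:R) * v n)).
have q0 : 0 <= q by exact: expR_ge0.
have Qq i : (q%:E <= time_space_intensity nu (Q i))%E.
  rewrite (box_intensity nu (mI i) (@Ipos i) (mW i)) lebI -[leLHS]mul1e.
  by apply: lee_pmul => //; exact: hW.
have PH := box_event_probability prmN mA mQ QA disj A1 q0 Qq.
have mH := box_event_measurable N mA mQ.
have [Z2 [mZ2 PZ2 sZ2]] : {ae P, forall w, forall i : 'I_j, forall r k : nat, exists i' : nat,
    N w (strip (Q i) `[0, (n.+1%:R * (k%:R / (2 ^ r)%:R))]) = i'%:R%:E}.
  apply: filter_forall => i.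
  have fI : (lebesgue_measure (I i) < +oo)%E by rewrite lebI ltry.
  have fW : (nu (W i) < +oo)%E.
    apply: (@le_lt_trans _ _ (nu `[(n.+1%:R * delta)%R, +oo[%classic)); last first.
      by rewrite ltey; apply/eqP => h'; move: hU; rewrite h' gt0_muley ?lte_fin.
    apply: le_measure; rewrite ?inE //; try exact: measurable_itv.
    move=> x; rewrite /W /= !in_itv /= andbT => /andP[y1 _].
    by apply: le_trans y1; rewrite ler_pM2l // (le_trans dz).
  exact: (box_counts_ae prmN (mI i) (@Ipos i) fI (mW i) fW n.+1%:R).
have mball : measurable [set w | dJ1 xi (Y n w) < e] by exact: (mY n (open_mball xi e)).
have sub : box_event N Q A `\` (Z `|` Z2) `<=` [set w | dJ1 xi (Y n w) < e].
  move=> w [[HQ Hrest]] /not_orP[nZ nZ2].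
  have [reg Hy] := HZ w nZ.
  have int : forall i : 'I_j, forall r k : nat, exists i' : nat,
    N w (strip (Q i) `[0, (n.+1%:R * (k%:R / (2 ^ r)%:R))]) = i'%:R%:E.
    by apply: contrapT => h'; apply: nZ2; exact: sZ2.
  have /choice[s Hs] : forall i, exists s, (n.+1%:R * (t i - h) <= n.+1%:R * s <= n.+1%:R * (t i + h)) /\
     forall u, 0 <= u <= 1 -> N w (strip (Q i) `[0%R, (n.+1%:R * u)%R]) = ((s <= u)%R%:R)%:E.
    move=> i; have al0 : 0 < n.+1%:R * (t i - h) by rewrite mulr_gt0.
    have be1 : n.+1%:R * (t i + h) < n.+1%:R by rewrite gtr_pMr.
    have albe : n.+1%:R * (t i - h) <= n.+1%:R * (t i + h) by rewrite ler_pM2l //; lra.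
    by have [s s1 s2] := single_jump_time (mW i) al0 be1 (HQ i) (int i) albe; exists s.
  have st i : `|s i - t i| <= h.
    have [/andP[]] := Hs i; rewrite !ler_pM2l // => s1 s2 _.
    by rewrite ler_norml; apply/andP; split; lra.
  have cnt i := (Hs i).2.
  have bounds := boxed_jumps_bounds n0 nd0 reg QA disj Hrest cnt.
  have HL u : 0 <= u <= 1 -> \sum_(i < j) z i * (s i <= u)%R%:R <=
      n.+1%:R^-1 * large_jumps N (n.+1%:R * delta) (n.+1%:R * u) w <=
      \sum_(i < j) (z i + h1) * (s i <= u)%R%:R.
    move=> /bounds; rewrite ler_pdivlMl // ler_pdivrMl // !mulr_sumr.
    by under eq_bigr do rewrite -mulrA; under [X in _ <= _ <= X]eq_bigr do rewrite -mulrA.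
  apply: (@le_lt_trans _ _ (e / 2)); last by rewrite ltr_pdivrMr // ltr_pMr // ltr1n.
  apply: (boxes_close Hw0 sxi hw (ltW h10) st HL Hy hj).
  by move: h1j; move: (_ * h1) => x; lra.
have PHle : (P (box_event N Q A) <= P [set w | (dJ1 xi (Y n w) < e)%R] + (P Z + P Z2))%E.
  apply: (@le_trans _ _ (P ([set w | dJ1 xi (Y n w) < e] `|` (Z `|` Z2)))).
    apply: le_measure; rewrite ?inE //; first by apply: measurableU => //; exact: measurableU.
    move=> w Hw; have [zz|nz] := pselect ((Z `|` Z2) w); first by right.
    by left; apply: sub.
  apply: le_trans (measureU2 _ mball (measurableU _ _ mZ mZ2)) _.
  by apply: leeD => //; exact: measureU2.
have PZ2' : (P Z2 <= 0)%E by rewrite le_eqVlt; apply/orP; left; apply/eqP; exact: PZ2.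
have {}PHle : (P (box_event N Q A) <= P [set w | (dJ1 xi (Y n w) < e)%R] +
    (expR (- ((lambda * j%:R + eta) * v n)))%:E)%E.
  by apply: (le_trans PHle); apply: leeD => //; rewrite -[leRHS]adde0; apply: leeD.
(* The box event is at least twice as likely as the failure of the approximation. *)
have num : 2 * expR (- ((lambda * j%:R + eta) * v n)) <= q ^+ j * expR (- j.+1%:R).
  rewrite /q -expRM_natl -expRD -[2 in leLHS](@lnK R) ?posrE // -expRD ler_expR.
  have je : j%:R * (eta / 2 / j.+1%:R) <= eta / 2.
    by rewrite mulrCA -[leRHS]mulr1 ler_pM2l ?divr_gt0 // ler_pdivrMr // mul1r ler_nat.
  have := ler_wpM2r vn0 je; move: hV; rewrite ler_pdivrMr ?divr_gt0 //.
  move: (eta / 2 / j.+1%:R) (v n) (ln 2) j.+1%:R j%:R => x y l k k'; lra.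
have num' : ((2 * expR (- ((lambda * j%:R + eta) * v n)))%:E <= (q ^+ j * expR (- j.+1%:R))%:E)%E.
  by rewrite lee_fin.
have fin2 := le_trans (le_trans num' PH) PHle.
have pf : P [set w | (dJ1 xi (Y n w) < e)%R] \is a fin_num by exact: fin_num_measure.
move: fin2; rewrite -(fineK pf) -EFinD !lee_fin.
by rewrite mulrDl mul1r lerD2r.
Qed.

End lower_probability.

(** * The theorem *)

Lemma skorokhod_measurable d0 (T0 : measurableType d0) (R : realType) (Y : T0 -> skorokhod R) :
  (forall t, 0 <= t <= 1 -> measurable_fun setT (fun w => Y w t)) ->
  forall G : set (skorokhod R), open G -> measurable (Y @^-1` G).
Proof.
move=> mY G /open_mdistP oG; pose G' : set (skorokhod_prod R 1) := [set y | G (y ord0)].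
have oG' : open G'.
  apply/open_mdistP => x Gx; have [e e0 He] := oG _ Gx; exists e => // y xy.
  by apply: He; apply: le_lt_trans xy; rewrite /mdist /= /dprod big_ord1.
exact: (skorokhod_prod_measurable (Y := fun w _ => Y w) (fun i t t01 => mY t t01) oG').
Qed.

Section generated_paths.
Context d (T : measurableType d) (R : realType) (X : T -> cadlag_path R).
Variables (b : R) (nu : {sigma_finite_measure set R -> \bar R}) (n : nat).

Let gen : set (set T) := \bigcup_(t in `[0, +oo[) g_sigma_algebra_preimage (fun w => X w t).

(** Measurability with respect to the paths themselves, so that the independence of the
    processes passes to the scaled paths. *)
Lemma scaled_path_generated (G : set (skorokhod R)) : open G ->
  generated_sigma `[0, +oo[ (fun t w => X w t) ((fun w => scaled_path b nu n.+1 (X w)) @^-1` G).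
Proof.
pose T0 := g_sigma_algebraType gen.
have mX t : 0 <= t -> measurable_fun setT ((fun w => X w t) : T0 -> R).
  move=> t0 _ A mA; rewrite setTI; apply: sub_gen_smallest.
  exists t; first by rewrite /= in_itv /= andbT.
  by exists A => //; rewrite setTI.
move=> oG; apply: (@skorokhod_measurable _ T0 R (fun w => scaled_path b nu n.+1 (X w)) _ G oG).
move=> t t01; rewrite /= /scaled_fun t01; have /andP[t0 _] := t01.
apply: measurable_funM => //; apply: measurable_funB => //; apply: measurable_funB => //.
by apply: mX; rewrite mulr_ge0.
Qed.

Lemma generated_paths_measurable : (forall t, 0 <= t -> measurable_fun setT (fun w => X w t)) ->
  generated_sigma `[0, +oo[ (fun t w => X w t) `<=` measurable.
Proof.
move=> mX; apply: generated_measurable => A [t /=]; rewrite in_itv /= andbT => t0 [B mB <-].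
exact: mX.
Qed.

End generated_paths.

Theorem theorem3p4 (R : realType) (disp : measure_display)
    (T : measurableType disp) (P : probability T R)
    (d : nat) (gamma c beta : R) (lambda a b : 'I_d -> R)
    (nu : 'I_d -> {sigma_finite_measure set R -> \bar R})
    (X : 'I_d -> T -> cadlag_path R) :
  (0 < d)%N -> 1 < gamma -> 0 < c -> (forall i, 0 < lambda i) ->
  (forall i, levy_process P (a i) (b i) (nu i) (X i)) ->
  mutually_independent P
    (fun i => generated_sigma `[0, +oo[ (fun t w => X i w t)) ->
  (forall i, nu i `]-oo, 0[%classic = 0%E) ->
  (forall i, \forall x \near +oo,
    nu i `[x, +oo[%classic =
    (c * x `^ beta * expR (- (lambda i * ln x `^ gamma)))%:E) ->
  extended_LDP P
    (fun n w => (fun i => scaled_path (b i) (nu i) n.+1 (X i w))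
                : skorokhod_prod R d)
    (I_prod lambda)
    (fun n => ln n.+1%:R `^ gamma).
Proof.
move=> _ gamma1 c0 lambda0 levy indep nu_neg tail.
have gamma0 : 0 < gamma by exact: lt_trans gamma1.
pose Y i n w := scaled_path (b i) (nu i) n.+1 (X i w).
have YF i n (G : set (skorokhod R)) : open G ->
    generated_sigma `[0, +oo[ (fun t w => X i w t) (Y i n @^-1` G).
  exact: scaled_path_generated.
have Fm i : generated_sigma `[0, +oo[ (fun t w => X i w t) `<=` measurable.
  by apply: generated_paths_measurable; have [] := levy i.
have mY i n G : open G -> measurable (Y i n @^-1` G) by move=> /YF /Fm.
have approx i : exists2 N : R.-ker T ~> (R * R)%type,
    poisson_random_measure P (time_space_intensity (nu i)) N &
    forall K eps, 0 < K -> 0 < eps -> exists2 delta0, 0 < delta0 &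
      forall delta, 0 < delta -> delta <= delta0 -> \forall n \near \oo,
      large_jump_approximation P N gamma (Y i) K eps delta n.
  have [lm mX [B [N [BM prmN _ XE]]]] := levy i.
  have [V HV] := levy_second_moment_finite c0 (lambda0 i) gamma1 (tail i) lm.
  exists N => // K eps K0 eps0.
  exact: (coordinate_bad_event prmN (nu_neg i) HV BM mX XE c0 (lambda0 i) gamma1 (tail i) K0 eps0).
apply: (extended_LDP_of_coordinates lambda0 _ indep _ Fm YF).
- apply/cvgryPge => A; exact: (pinfty_ln_nat (powR_unbounded A gamma0)).
- by move=> i; exact: smallest_sigma_algebra.
- move=> i k e eta e0 eta0; have [N prmN bad] := approx i.
  exact: (coordinate_upper_bound prmN c0 (lambda0 i) gamma1 (tail i) (@mY i) bad k e0 eta0).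
- move=> i j xi z t e eta sxi e0 eta0; have [N prmN bad] := approx i.
  exact: (coordinate_lower_bound prmN c0 (lambda0 i) gamma1 (tail i) (@mY i) bad sxi e0 eta0).
- move=> n G oG; apply: skorokhod_prod_measurable oG => i t t01.
  have [_ mX _] := levy i; rewrite /= /Y /scaled_path /= /scaled_fun t01; have /andP[t0 _] := t01.
  apply: measurable_funM => //; apply: measurable_funB => //; apply: measurable_funB => //.
  by apply: mX; rewrite mulr_ge0.
Qed.
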